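(* Let $\boldsymbol{F}$ be a family of bicomplex meromorphic functions defined in a domain $\Omega\subset\mathbb{T}$. Suppose there exist $\alpha,\beta,\gamma\in\mathbb{T}$ such that (a) $\alpha-\beta$, $\beta-\gamma$, $\gamma-\alpha$ are invertible in $\mathbb{T}$, and (b) $S\cap\mathcal{R}(f)=\varnothing$ for all $f\in\boldsymbol{F}$, where $S=\{w\in\mathbb{T}: w-\alpha\in\mathcal{NC}\}\cup\{w\in\mathbb{T}: w-\beta\in\mathcal{NC}\}\cup\{w\in\mathbb{T}: w-\gamma\in\mathcal{NC}\}$ and $\mathcal{R}(f)$ denotes the range of $f$. Then $\boldsymbol{F}$ is normal in $\Omega$.
   Context: Bicomplex numbers: $\mathbb{T}=\{z_1+z_2\mathbf{i_2} : z_1,z_2\in\mathbb{C}(\mathbf{i_1})\}$, where $\mathbb{C}(\mathbf{i_1})=\{x+y\mathbf{i_1}: x,y\in\mathbb{R}\}$ is the field of complex numbers with imaginary unit $\mathbf{i_1}$, $\mathbf{i_1}^2=\mathbf{i_2}^2=-1$, $\mathbf{i_1}\mathbf{i_2}=\mathbf{i_2}\mathbf{i_1}=\mathbf{j}$, $\mathbf{j}^2=1$; $\mathbb{T}$ is identified with $\mathbb{R}^4$ and carries the Euclidean topology. The projections $\mathcal{P}_1,\mathcal{P}_2:\mathbb{T}\to\mathbb{C}(\mathbf{i_1})$ are $\mathcal{P}_1(z_1+z_2\mathbf{i_2})=z_1-z_2\mathbf{i_1}$, $\mathcal{P}_2(z_1+z_2\mathbf{i_2})=z_1+z_2\mathbf{i_1}$.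 With $\mathbf{e_1}=(1+\mathbf{j})/2$, $\mathbf{e_2}=(1-\mathbf{j})/2$, every $w\in\mathbb{T}$ is uniquely $w=\mathcal{P}_1(w)\mathbf{e_1}+\mathcal{P}_2(w)\mathbf{e_2}$, and the ring operations act componentwise. A domain is a nonempty open connected set. The null-cone is $\mathcal{NC}=\{z_1+z_2\mathbf{i_2}\in\mathbb{T}: z_1^2+z_2^2=0\}$; $w\in\mathbb{T}$ is invertible if and only if $w\notin\mathcal{NC}$. Extended bicomplex plane: $\overline{\mathbb{T}}$ is the set of all formal $w=w_1\mathbf{e_1}+w_2\mathbf{e_2}$ with $w_1,w_2\in\overline{\mathbb{C}(\mathbf{i_1})}=\mathbb{C}(\mathbf{i_1})\cup\{\infty\}$; $\mathcal{P}_i(w)=w_i$ extends the projections to $\overline{\mathbb{T}}$. Chordal metrics: $\chi$ is the chordal metric on $\overline{\mathbb{C}(\mathbf{i_1})}$, $\chi(a,b)=\frac{|a-b|}{\sqrt{1+|a|^2}\sqrt{1+|b|^2}}$ for finite $a,b$, $\chi(a,\infty)=\frac{1}{\sqrt{1+|a|^2}}$ for finite $a$, $\chi(\infty,\infty)=0$. The bicomplex chordal metric on $\overline{\mathbb{T}}$ is $\chi_e(z,w)=\sqrt{\frac{\chi^2(\mathcal{P}_1(z),\mathcal{P}_1(w))+\chi^2(\mathcal{P}_2(z),\mathcal{P}_2(w))}{2}}$. Bicomplex meromorphic functions: a function $f$ on an open set $\Omega\subset\mathbb{T}$ (with values in $\overline{\mathbb{T}}$) is bicomplex meromorphic if there are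 meromorphic functions $f_{e1}$ on $\mathcal{P}_1(\Omega)$ and $f_{e2}$ on $\mathcal{P}_2(\Omega)$ (taking the value $\infty$ at their poles) such that $f(w)=f_{e1}(\mathcal{P}_1(w))\mathbf{e_1}+f_{e2}(\mathcal{P}_2(w))\mathbf{e_2}$ for all $w\in\Omega$. Normality: a sequence $\{f_n\}$ of $\overline{\mathbb{T}}$-valued functions converges bispherically uniformly to $f$ on a set $E$ if for every $\epsilon>0$ there is $n_0$ with $\chi_e(f_n(w),f(w))<\epsilon$ for all $n\ge n_0$ and $w\in E$. A family $\boldsymbol{F}$ of bicomplex meromorphic functions in $\Omega$ is normal in $\Omega$ if every sequence in $\boldsymbol{F}$ contains a subsequence which converges bispherically uniformly on compact subsets of $\Omega$ (to some $\overline{\mathbb{T}}$-valued function). *)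

(* Defs.v *)
From HB Require Import structures.
From mathcomp Require Import all_boot all_order all_algebra.
From mathcomp Require Import all_classical all_reals all_analysis.
From mathcomp Require Import complex.
From mathcomp Require Import ring.

Set Implicit Arguments.
Unset Strict Implicit.
Unset Printing Implicit Defensive.

Import Order.TTheory GRing.Theory Num.Theory.
Import numFieldNormedType.Exports.

Local Open Scope classical_set_scope.
Local Open Scope ring_scope.

(* [R[i]^o] is the field [R[i]] seen as a normed space over itself, so that
   [derivable f a 1] is complex differentiability of [f] at [a]. *)
Notation cplx R := ((complex R)^o) (only parsing).

(* [(z1, z2)] stands for z1 + z2 i2. The topology is the product topology, i.e.
   the Euclidean topology of R^4. Only the additive and topological structures
   are copied from the product: the multiplication below is not the
   componentwise one. *)
Definition bicomplex (R : realType) : Type := (cplx R * cplx R)%type.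

HB.instance Definition _ (R : realType) :=
  NormedModule.copy (bicomplex R) (cplx R * cplx R)%type.

Section bicomplex_ring.
Variable R : realType.
Implicit Types w v u : bicomplex R.

Definition bc_one : bicomplex R := (1, 0).

Definition bc_mul w v : bicomplex R :=
  (w.1 * v.1 - w.2 * v.2, w.1 * v.2 + w.2 * v.1).

Let bc_mulA : associative bc_mul.
Proof. by move=> [a b] [c d] [e f]; rewrite /bc_mul /=; congr pair; ring. Qed.

Let bc_mulC : commutative bc_mul.
Proof. by move=> [a b] [c d]; rewrite /bc_mul /=; congr pair; ring. Qed.

Let bc_mul1 : left_id bc_one bc_mul.
Proof. by move=> [a b]; rewrite /bc_mul /=; congr pair; ring. Qed.

Let bc_mulDl : left_distributive bc_mul +%R.
Proof.
by move=> [a b] [c d] [e f]; rewrite /bc_mul /=; congr pair => /=; ring.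
Qed.

Let bc_one_neq0 : bc_one != 0.
Proof. by apply/eqP => -[] /eqP; rewrite oner_eq0. Qed.

HB.instance Definition _ := GRing.Zmodule_isComNzRing.Build (bicomplex R)
  bc_mulA bc_mulC bc_mul1 bc_mulDl bc_one_neq0.

Definition bc_sqn w : R[i] := w.1 ^+ 2 + w.2 ^+ 2.

Definition bc_inv w : bicomplex R :=
  if bc_sqn w == 0 then w else (w.1 / bc_sqn w, - w.2 / bc_sqn w).

Let bc_mulV : {in [pred w | bc_sqn w != 0], left_inverse 1 bc_inv *%R}.
Proof.
move=> [a b]; rewrite inE => n0; rewrite /bc_inv (negbTE n0).
rewrite /bc_sqn /= in n0 *.
by congr pair => /=; field.
Qed.

Let bc_unitP w v : v * w = 1 -> [pred w | bc_sqn w != 0] w.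
Proof.
case: w v => a b [c d] [] e1 e2; rewrite /= /bc_sqn /=; apply/eqP => n0.
have : (c ^+ 2 + d ^+ 2) * (a ^+ 2 + b ^+ 2)
       = (c * a - d * b) ^+ 2 + (c * b + d * a) ^+ 2 by ring.
rewrite e1 e2 n0 mulr0 expr1n expr0n addr0 => /esym/eqP.
by rewrite oner_eq0.
Qed.

Let bc_invN : {in [predC [pred w | bc_sqn w != 0]], bc_inv =1 id}.
Proof. by move=> w; rewrite !inE negbK /bc_inv => ->. Qed.

HB.instance Definition _ := GRing.ComNzRing_hasMulInverse.Build (bicomplex R)
  bc_mulV bc_unitP bc_invN.

End bicomplex_ring.

Section bicomplex_functions.
Variable R : realType.
Local Notation C := (cplx R).
Local Notation T := (bicomplex R).
Local Notation normc := (@Normc.normc R).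

Definition null_cone : set T := [set w | w.1 ^+ 2 + w.2 ^+ 2 = 0].

Definition bc_proj1 (w : T) : C := w.1 - w.2 * ('i)%C.
Definition bc_proj2 (w : T) : C := w.1 + w.2 * ('i)%C.

(* The underlying type is [option C], with [None] as the point at infinity. *)
Definition ext_cplx : Type := one_point_compactification C.

(* [(w1, w2)] stands for w1 e1 + w2 e2: these are the idempotent components,
   unlike in [bicomplex]. *)
Definition ext_bicomplex : Type := (ext_cplx * ext_cplx)%type.

Definition bc_embed (w : T) : ext_bicomplex := (Some (bc_proj1 w), Some (bc_proj2 w)).

Definition chordal (a b : ext_cplx) : R :=
  match a, b with
  | Some x, Some y => normc (x - y) /
      (Num.sqrt (1 + normc x ^+ 2) * Num.sqrt (1 + normc y ^+ 2))
  | Some x, None | None, Some x => 1 / Num.sqrt (1 + normc x ^+ 2)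
  | None, None => 0
  end.

Definition bc_chordal (z w : ext_bicomplex) : R :=
  Num.sqrt ((chordal z.1 w.1 ^+ 2 + chordal z.2 w.2 ^+ 2) / 2).

(* Outside [U] the values of [g] are irrelevant when [U] is open; a function
   equal to infinity on a nonempty open subset of [U] is not meromorphic. *)
Definition meromorphic (U : set C) (g : C -> ext_cplx) : Prop :=
  forall a, U a -> exists f : C -> C,
    (\forall z \near a, g z = Some (f z) /\ derivable f z 1) \/
    [/\ g a = None,
        \forall z \near a^', g z = Some (f z) /\ derivable f z 1 &
        normc (f z) @[z --> a^'] --> +oo].

Definition bc_meromorphic (Omega : set T) (f : T -> ext_bicomplex) : Prop :=
  exists f1 f2 : C -> ext_cplx,
    [/\ meromorphic (bc_proj1 @` Omega) f1, meromorphic (bc_proj2 @` Omega) f2 &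
        forall w, Omega w -> f w = (f1 (bc_proj1 w), f2 (bc_proj2 w))].

Definition bispherical_cvg (E : set T) (u : nat -> T -> ext_bicomplex)
    (f : T -> ext_bicomplex) : Prop :=
  forall eps : R, 0 < eps -> exists n0 : nat,
    forall n w, (n0 <= n)%N -> E w -> bc_chordal (u n w) (f w) < eps.

Definition normal_family (Omega : set T) (F : set (T -> ext_bicomplex)) : Prop :=
  forall u : nat -> T -> ext_bicomplex, (forall n, F (u n)) ->
  exists2 phi : nat -> nat, {homo phi : m n / (m < n)%N} &
  exists f : T -> ext_bicomplex, forall K : set T, compact K -> K `<=` Omega ->
    bispherical_cvg K (fun n => u (phi n)) f.

Definition is_domain (Omega : set T) : Prop :=
  [/\ Omega !=set0, open Omega & connected Omega].

Definition null_translate (alpha : T) : set T :=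
  [set w | null_cone (w - alpha)].

End bicomplex_functions.

(* Main.v *)
Require Import Defs.
From HB Require Import structures.
From mathcomp Require Import all_boot all_order all_algebra.
From mathcomp Require Import all_classical all_reals all_analysis.
From mathcomp Require Import complex.
From mathcomp Require Import ring lra zify.

Set Implicit Arguments.
Unset Strict Implicit.
Unset Printing Implicit Defensive.

Import Order.TTheory GRing.Theory Num.Theory.
Import numFieldNormedType.Exports.

(** A bicomplex meromorphic function splits as f1(P1 w) e1 + f2(P2 w) e2. If
    f1 took the value P1 alpha at P1 w, then, the range of f avoiding the
    finite points of the null translates, f2 would be infinite at P2 v for
    every v of the open set Omega with P1 v = P1 w, hence on an open set,
    whereas poles are isolated. So f1 omits the three values P1 alpha, P1
    beta, P1 gamma, which are distinct because the differences are invertible,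
    and likewise for f2 (components_omit). The statement is thus Montel's
    normality test for each component, followed by an extraction of
    subsequences.

    Montel's test is obtained from an explicit Lipschitz bound
    (omit3_equi_lipschitz). A Moebius map turns f1 into a holomorphic function
    g omitting 0 and 1, and the Ahlfors-Schwarz method bounds the spherical
    derivative |g'| / (1 + |g|^2) in terms of the distance to the boundary
    only (spherical_derivative_le). Indeed the plane minus 0 and 1 carries an
    explicit metric of curvature bounded above by a negative constant, here

      (1 + |w|^(1/4)) (1 + |w - 1|^(1/4)) / (|w|^(7/8) |w - 1|^(7/8)) |dw|,

    and at a maximum of the ratio of its pullback by g to the Poincare metric
    of a disc, the Laplacian of the logarithm of the ratio is nonpositive; the
    curvature inequality then bounds this maximum (ahlfors_at_max). Laplacians
    are read off second order expansions of real functions (jet): summing such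
    an expansion over h, ih, -h, -ih leaves the constant term and the
    coefficient of |h|^2 (jet_max).

    These expansions require g to be differentiable more than once. This is
    Cauchy's theory, for functions which are only assumed to be complex
    differentiable at each point, in the following elementary form. Contour
    integrals are replaced by dyadic midpoint sums along the boundary of a
    square, which are additive under subdivision and vanish on affine
    functions, so that Goursat's bisection argument applies to them (goursat).
    For the difference quotient of f at a this gives |f(a)| <= 2 max |f|
    (centre_bound), the maximum being taken away from a. Applied to second
    difference quotients, this estimate makes the first ones Lipschitz, so
    that singularities at which a function is continuous are removable
    (removable_singularity); hence difference quotients are again holomorphic,
    and so are derivatives (cderiv_holo).

    Finally, in stereographic coordinates the chordal distance is the
    Euclidean distance in R^3; the coordinates of the functions of the family
    are real functions bounded by 1 and equicontinuous at each point of Omega,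
    and a sequential form of the Arzela-Ascoli theorem (arzela_ascoli)
    concludes. *)

Local Open Scope classical_set_scope.
Local Open Scope ring_scope.

(** * Bisection of squares *)

Section SquareInduction.
Variable R : realType.

(** Bisection: a property that passes from the four quarters of a square to
    the square, and holds on all small squares around each point, holds.
    Otherwise a nested sequence of bad squares shrinks to a point. Compactness
    of squares, Goursat's lemma and the mean value inequality of
    lipschitz_of_local are instances. *)
Lemma square_induction (P : R -> R -> R -> Prop) (x0 y0 s0 : R) :
  0 < s0 ->
  (forall x y s, 0 < s -> P x y (s / 2) -> P (x + s / 2) y (s / 2) ->
     P x (y + s / 2) (s / 2) -> P (x + s / 2) (y + s / 2) (s / 2) ->
     P x y s) ->
  (forall p q, x0 <= p <= x0 + s0 -> y0 <= q <= y0 + s0 ->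
     exists2 d : R, 0 < d & forall x y s, 0 < s -> s < d ->
       x0 <= x -> x + s <= x0 + s0 -> y0 <= y -> y + s <= y0 + s0 ->
       x <= p <= x + s -> y <= q <= y + s -> P x y s) ->
  P x0 y0 s0.
Proof.
move=> s0_gt0 Psplit Ploc; apply: contrapT => nP.
pose bad (t : R * R * R) := 0 < t.2 /\ ~ P t.1.1 t.1.2 t.2.
have /choice [g gP] : forall t, exists t', bad t ->
    [/\ bad t', t'.2 = t.2 / 2, t.1.1 <= t'.1.1 <= t.1.1 + t.2 / 2
      & t.1.2 <= t'.1.2 <= t.1.2 + t.2 / 2].
  move=> [[x y] s]; case: (pselect (bad (x, y, s))) => [[/= s0' nPt]|nb]; last by exists (x, y, s).
  have sh : 0 < s / 2 by rewrite divr_gt0.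
  case: (pselect (P x y (s / 2))) => [P1|nP1]; last first.
    by exists (x, y, s / 2) => _; split => //=; lra.
  case: (pselect (P (x + s / 2) y (s / 2))) => [P2|nP2]; last first.
    by exists (x + s / 2, y, s / 2) => _; split => //=; lra.
  case: (pselect (P x (y + s / 2) (s / 2))) => [P3|nP3]; last first.
    by exists (x, y + s / 2, s / 2) => _; split => //=; lra.
  case: (pselect (P (x + s / 2) (y + s / 2) (s / 2))) => [P4|nP4]; last first.
    by exists (x + s / 2, y + s / 2, s / 2) => _; split => //=; lra.
  by exfalso; apply: nPt; apply: Psplit.
pose t k := iter k g (x0, y0, s0).
have bt k : bad (t k).
  by elim: k => [|k IH]; [split | rewrite /t iterS; have [] := gP _ IH].
have st k : (t k).2 = s0 / 2 ^+ k.
  elim: k => [|k IH]; first by rewrite expr0 divr1.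
  rewrite /t iterS; have [_ -> _ _] := gP _ (bt k).
  by rewrite -/(t k) IH exprS invfM; field; rewrite expf_neq0.
have nest k j : ((t k).1.1 <= (t (k + j)%N).1.1 /\
    (t (k + j)%N).1.1 + (t (k + j)%N).2 <= (t k).1.1 + (t k).2) /\
    ((t k).1.2 <= (t (k + j)%N).1.2 /\
    (t (k + j)%N).1.2 + (t (k + j)%N).2 <= (t k).1.2 + (t k).2).
  elim: j => [|j [[IH1 IH2] [IH3 IH4]]]; first by rewrite addn0.
  rewrite addnS [t _.+1]/t iterS -/(t (k + j)%N).
  have [_ -> /andP[a1 a2] /andP[b1 b2]] := gP _ (bt (k + j)%N).
  by split; split; lra.
(* Applied to both coordinates of the lower left corners, whose suprema give
   the limit point. *)
have corner (f : R * R * R -> R) :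
    (forall k j, f (t k) <= f (t (k + j)%N) /\
       f (t (k + j)%N) + (t (k + j)%N).2 <= f (t k) + (t k).2) ->
    exists p, forall k, f (t k) <= p <= f (t k) + (t k).2.
  move=> nf; pose A := range (fun k => f (t k)).
  have ubk k : ubound A (f (t k) + (t k).2).
    move=> _ [j _ <-]; have [jk|/ltnW kj] := leqP j k.
      have [+ _] := nf j (k - j)%N; rewrite subnKC // => h.
      by rewrite (le_trans h) // lerDl ltW //; case: (bt k).
    have [_] := nf k (j - k)%N; rewrite subnKC // => h.
    by rewrite (le_trans _ h) // lerDl ltW //; case: (bt j).
  have A0 : A !=set0 by exists (f (t 0%N)), 0%N.
  exists (sup A) => k; apply/andP; split.
    by apply: ub_le_sup; [exists (f (t 0%N) + (t 0%N).2)|exists k].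
  exact: ge_sup.
have [p pP] := corner (fun u => u.1.1) (fun k j => (nest k j).1).
have [q qP] := corner (fun u => u.1.2) (fun k j => (nest k j).2).
have [d d0 dP] := Ploc p q (pP 0%N) (qP 0%N).
(* The k-th square has side s0 / 2 ^ k and contains (p, q). *)
have [k kd] : exists k, s0 / 2 ^+ k < d.
  exists (Num.bound (s0 / d)); rewrite ltr_pdivrMr ?exprn_gt0 //.
  rewrite mulrC -ltr_pdivrMr //.
  apply: (lt_trans (archi_boundP (ltW (divr_gt0 s0_gt0 d0)))).
  by rewrite -natrX ltr_nat ltn_expl.
have [tk0 nPk] := bt k; apply: nPk; apply: dP => //.
- by rewrite st.
- by have [[]] := nest 0%N k.
- by have [[]] := nest 0%N k.
- by have [_ []] := nest 0%N k.
- by have [_ []] := nest 0%N k.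
Qed.

End SquareInduction.

(** * Norm and differentiability on the complex plane *)

Section ComplexNorm.
Variable R : realType.
Local Notation C := R[i].
Local Notation N := (@Normc.normc R).
Local Notation Re := (@complex.Re R).
Local Notation Im := (@complex.Im R).
Local Notation "x %:C" := (real_complex R x).
Implicit Types (x y : R) (z w a b : C).

Lemma norm_cnormE z : `|z| = (N z)%:C.
Proof. by []. Qed.

Lemma cnorm0 : N 0 = 0. Proof. exact: Normc.normc0. Qed.
Lemma cnorm_ge0 z : 0 <= N z.
Proof. by case: z => x y; rewrite /= sqrtr_ge0. Qed.
Lemma cnorm_eq0 z : (N z == 0) = (z == 0).
Proof. by apply/eqP/eqP => [/Normc.eq0_normc//|->]; exact: cnorm0. Qed.
Lemma cnorm_gt0 z : (0 < N z) = (z != 0).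
Proof. by rewrite lt_neqAle cnorm_ge0 eq_sym cnorm_eq0 andbT. Qed.
Lemma cnormM z w : N (z * w) = N z * N w. Proof. exact: Normc.normcM. Qed.
Lemma cnormV z : N z^-1 = (N z)^-1. Proof. exact: Normc.normcV. Qed.
Lemma cnormN z : N (- z) = N z. Proof. exact: normcN. Qed.
Lemma cnormD_le z w : N (z + w) <= N z + N w. Proof. exact: le_normcD. Qed.
Lemma cnormB_le z w : N (z - w) <= N z + N w.
Proof. by rewrite -[N w]cnormN cnormD_le. Qed.
Lemma cnorm_distC z w : N (z - w) = N (w - z). Proof. by rewrite -cnormN opprB. Qed.
Lemma cnorm_dist_le z w a : N (z - w) <= N (z - a) + N (a - w).
Proof. by rewrite (_ : z - w = (z - a) + (a - w)) ?cnormD_le//; ring. Qed.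
Lemma cnorm_le_add_dist z w : N z <= N w + N (z - w).
Proof. by rewrite {1}(_ : z = w + (z - w)) ?cnormD_le//; ring. Qed.
Lemma cnorm1 : N 1 = 1. Proof. exact: Normc.normc1. Qed.
Lemma cnormX z n : N (z ^+ n) = N z ^+ n.
Proof. by elim: n => [|n IH]; rewrite ?expr0 ?cnorm1// !exprS cnormM IH. Qed.
Lemma cnorm_real x : N x%:C = `|x|.
Proof. by rewrite /= expr0n addr0 sqrtr_sqr. Qed.
Lemma cnorm_i : N 'i%C = 1.
Proof. by rewrite /= expr0n add0r expr1n sqrtr1. Qed.
Lemma cnorm_sqr z : N z ^+ 2 = Re z ^+ 2 + Im z ^+ 2.
Proof. by case: z => x y /=; rewrite sqr_sqrtr// addr_ge0// sqr_ge0. Qed.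
Lemma Re_le_cnorm z : `|Re z| <= N z.
Proof.
by case: z => x y /=; rewrite -sqrtr_sqr ler_sqrt ?lerDl ?addr_ge0 ?sqr_ge0.
Qed.
Lemma Im_le_cnorm z : `|Im z| <= N z.
Proof.
by case: z => x y /=; rewrite -(sqrtr_sqr y) ler_sqrt ?lerDr ?addr_ge0 ?sqr_ge0.
Qed.
Lemma cnorm_le_ReIm z : N z <= `|Re z| + `|Im z|.
Proof.
rewrite -(@ler_pXn2r _ 2) ?nnegrE ?addr_ge0 ?cnorm_ge0//.
rewrite cnorm_sqr sqrrD !real_normK ?num_real//.
have : 0 <= `|Re z| * `|Im z| by rewrite mulr_ge0.
lra.
Qed.
End ComplexNorm.

Section ComplexDerivative.
Variable R : realType.
Local Notation C := R[i].
Local Notation N := (@Normc.normc R).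
Local Notation Re := (@complex.Re R).
Local Notation Im := (@complex.Im R).
Local Notation "x %:C" := (real_complex R x).
Implicit Types (f g k : C -> C) (z w a b l : C).

Definition ccont f a := forall e : R, 0 < e -> exists2 d : R, 0 < d &
  forall z, N (z - a) < d -> N (f z - f a) <= e.

(** Differentiability in terms of real radii, so that estimates take place in
    R rather than in the partially ordered field R[i]. *)
Definition cdiff f a l := forall e : R, 0 < e -> exists2 d : R, 0 < d &
  forall z, N (z - a) < d -> N (f z - f a - l * (z - a)) <= e * N (z - a).

Lemma nbhs_normcP (a : C^o) (P : set C) :
  nbhs a P <-> exists2 d : R, 0 < d & forall z, N (z - a) < d -> P z.
Proof.
split=> [/nbhs_ballP[e /= e0 eP]|[d d0 dP]].
  have [e1 e2] : Im e = 0 /\ 0 < Re e.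
    by move: e0; rewrite ltcE /= => /andP[/eqP -> ->].
  exists (Re e) => // z zd; apply: eP; rewrite -ball_normE /ball_ /=.
  by rewrite distrC ltcE /= e1 eqxx.
apply/nbhs_ballP; exists (d%:C) => /=; first by rewrite ltcE /= eqxx.
by move=> z; rewrite -ball_normE /ball_ /= distrC ltcE /= => /andP[_]; exact: dP.
Qed.

(** The algebra of continuous and differentiable functions is inherited from
    the topology of R[i] through this equivalence and the next one. *)
Lemma ccontP (f : C^o -> C^o) (a : C^o) : ccont f a <-> f @ a --> f a.
Proof.
split=> [fa|fa e e0].
  apply: (@cvgrPdist_le _ _ _ _ (nbhs_filter a) _ _).2 => e e0.
  have [e1 e2] : Im e = 0 /\ 0 < Re e.
    by move: e0; rewrite ltcE /= => /andP[/eqP -> ->].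
  have [d d0 dP] := fa _ e2.
  apply/nbhs_normcP; exists d => // z /dP; rewrite distrC norm_cnormE lecE /= e1.
  by rewrite eqxx.
have e0' : 0 < e%:C by rewrite ltcE /= eqxx.
have /nbhs_normcP[d d0 dP] := (@cvgrPdist_le _ _ _ _ (nbhs_filter a) _ _).1 fa _ e0';
  exists d => // z /dP.
by rewrite distrC norm_cnormE lecE /= => /andP[].
Qed.

(** Caratheodory's form of the derivative, which reduces the rules for
    derivatives to those for continuity. *)
Lemma caratheodory f a l : cdiff f a l <->
  exists k, [/\ ccont k a, k a = l & forall z, f z - f a = k z * (z - a)].
Proof.
split=> [fa|[k [ka kl fk]] e e0].
  exists (fun z => if z == a then l else (f z - f a) / (z - a)); split.
  - move=> e e0; have [d d0 dP] := fa e e0; exists d => // z zd; rewrite eqxx.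
    case: eqVneq => [_|za]; first by rewrite subrr cnorm0 ltW.
    have nza : z - a != 0 by rewrite subr_eq0.
    rewrite (_ : _ - l = (f z - f a - l * (z - a)) / (z - a)); last by field.
    by rewrite cnormM cnormV ler_pdivrMr ?dP// cnorm_gt0.
  - by rewrite eqxx.
  - move=> z; case: eqVneq => [->|za]; first by rewrite !subrr mulr0.
    by rewrite divfK // subr_eq0.
have [d d0 dP] := ka e e0; exists d => // z zd.
by rewrite fk -mulrBl cnormM ler_wpM2r ?cnorm_ge0// -kl dP.
Qed.

Lemma ccont_cst l a : ccont (fun=> l) a.
Proof. by move=> e e0; exists 1 => // z _; rewrite subrr cnorm0 ltW. Qed.

Lemma ccont_id a : ccont (fun z => z) a.
Proof. by move=> e e0; exists e => // z /ltW. Qed.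

Lemma ccontD f g a : ccont f a -> ccont g a -> ccont (fun z => f z + g z) a.
Proof. by move=> /ccontP fa /ccontP ga; apply/ccontP; exact: (cvgD fa ga). Qed.

Lemma ccontM f g a : ccont f a -> ccont g a -> ccont (fun z => f z * g z) a.
Proof. by move=> /ccontP fa /ccontP ga; apply/ccontP; exact: (cvgM fa ga). Qed.

Lemma ccontN f a : ccont f a -> ccont (fun z => - f z) a.
Proof. by move=> /ccontP fa; apply/ccontP; exact: (cvgN fa). Qed.

Lemma ccontB f g a : ccont f a -> ccont g a -> ccont (fun z => f z - g z) a.
Proof. by move=> fa ga; apply: ccontD => //; exact: ccontN. Qed.

Lemma ccontV f a : f a != 0 -> ccont f a -> ccont (fun z => (f z)^-1) a.
Proof. by move=> fa0 /ccontP fa; apply/ccontP; exact: (cvgV fa0 fa). Qed.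

Lemma cdiff_cont f a l : cdiff f a l -> ccont f a.
Proof.
move=> /caratheodory[k [ka _ fk]].
have -> : f = (fun z => f a + k z * (z - a)) by apply/funext => z; rewrite -fk; ring.
apply: ccontD; first exact: ccont_cst.
by apply: ccontM => //; apply: ccontB; [exact: ccont_id|exact: ccont_cst].
Qed.

Lemma cdiff_cst l a : cdiff (fun=> l) a 0.
Proof. by apply/caratheodory; exists (fun=> 0); split => [|//|z]; [exact: ccont_cst|ring]. Qed.

Lemma cdiff_id a : cdiff (fun z => z) a 1.
Proof. by apply/caratheodory; exists (fun=> 1); split => [|//|z]; [exact: ccont_cst|ring]. Qed.

Lemma cdiffD f g a l m : cdiff f a l -> cdiff g a m ->
  cdiff (fun z => f z + g z) a (l + m).
Proof.
move=> /caratheodory[k [ka <- fk]] /caratheodory[j [ja <- gj]].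
apply/caratheodory; exists (fun z => k z + j z); split => // [|z].
  exact: ccontD.
by rewrite mulrDl -fk -gj; ring.
Qed.

Lemma cdiffM f g a l m : cdiff f a l -> cdiff g a m ->
  cdiff (fun z => f z * g z) a (l * g a + f a * m).
Proof.
move=> fd /[dup] gd /caratheodory[j [ja <- gj]].
move: (fd) => /caratheodory[k [ka <- fk]].
apply/caratheodory; exists (fun z => k z * g z + f a * j z); split => // [|z].
  apply: ccontD; apply: ccontM => //; [exact: cdiff_cont gd|exact: ccont_cst].
rewrite mulrDl -(mulrA (f a)) -gj mulrAC -fk; ring.
Qed.

Lemma cdiffN f a l : cdiff f a l -> cdiff (fun z => - f z) a (- l).
Proof.
move=> /caratheodory[k [ka <- fk]].
apply/caratheodory; exists (fun z => - k z); split => // [|z].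
  exact: ccontN.
by rewrite mulNr -fk; ring.
Qed.

Lemma cdiffB f g a l m : cdiff f a l -> cdiff g a m ->
  cdiff (fun z => f z - g z) a (l - m).
Proof. by move=> fd gd; apply: cdiffD => //; exact: cdiffN. Qed.

Lemma cdiffV f a l : f a != 0 -> cdiff f a l ->
  cdiff (fun z => (f z)^-1) a (- l / f a ^+ 2).
Proof.
move=> fa0 fd e e0.
have fc := ccontV fa0 (cdiff_cont fd).
have nfa : 0 < N (f a) by rewrite cnorm_gt0.
have [d1 d10 d1P] := cdiff_cont fd (divr_gt0 nfa (ltr0Sn _ 1)).
move: (fd) => /caratheodory[k [ka kl fk]].
have jc : ccont (fun z => - k z * (f z)^-1 * (f a)^-1) a.
  by apply: ccontM; [apply: ccontM => //; exact: ccontN|exact: ccont_cst].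
have [d2 d20 d2P] := jc e e0.
exists (Num.min d1 d2) => [|z]; first by rewrite lt_min d10.
rewrite lt_min => /andP[z1 z2].
have fz0 : f z != 0.
  rewrite -cnorm_gt0; have := d1P _ z1; have := cnorm_le_add_dist (f a) (f z).
  by rewrite cnorm_distC; lra.
rewrite (_ : _ - _ = (- k z / f z / f a - - k a / f a / f a) * (z - a)).
  by rewrite cnormM ler_wpM2r ?cnorm_ge0// d2P.
have h : (f z)^-1 - (f a)^-1 = - (k z * (z - a)) / f z / f a by rewrite -fk; field; rewrite fa0.
by rewrite h kl; field; rewrite fa0.
Qed.

Lemma cdiff_local f g a l (d : R) : 0 < d ->
  (forall z, N (z - a) < d -> f z = g z) -> cdiff f a l -> cdiff g a l.
Proof.
move=> d0 fg fd e e0; have [d' d'0 d'P] := fd e e0.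
exists (Num.min d d') => [|z]; first by rewrite lt_min d0.
rewrite lt_min => /andP[z1 z2]; rewrite -!fg ?d'P//.
by rewrite subrr cnorm0.
Qed.

Lemma ccont_local f g a (d : R) : 0 < d ->
  (forall z, N (z - a) < d -> f z = g z) -> ccont f a -> ccont g a.
Proof.
move=> d0 fg fd e e0; have [d' d'0 d'P] := fd e e0.
exists (Num.min d d') => [|z]; first by rewrite lt_min d0.
rewrite lt_min => /andP[z1 z2]; rewrite -!fg ?d'P//.
by rewrite subrr cnorm0.
Qed.

Lemma derivable_cdiff (f : C^o -> C^o) (a : C^o) : derivable f a 1 -> exists l, cdiff f a l.
Proof.
move=> fd; exists ('D_1 f a) => e e0.
have e0' : 0 < e%:C by rewrite ltcE /= eqxx.
have fd' : h^-1 *: (f (h *: (1 : C^o) + a) - f a) @[h --> (0 : C^o)^'] --> 'D_1 f a.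
  exact: fd.
have /nbhs_normcP[d d0 dP] := (@cvgrPdist_le _ _ _ _ (dnbhs_filter _) _ _).1 fd' _ e0'.
exists d => // z zd.
have [->|za] := eqVneq z a; first by rewrite !subrr mulr0 subr0 cnorm0 mulr0.
have nza : z - a != 0 by rewrite subr_eq0.
have := dP (z - a); rewrite subr0 => /(_ zd nza).
rewrite distrC norm_cnormE lecE /= => /andP[_].
have -> : (z - a) *: (1 : C^o) + a = z by rewrite /GRing.scale /= mulr1 subrK.
rewrite -(ler_pM2r (_ : 0 < N (z - a))) ?cnorm_gt0//; apply: le_trans.
rewrite -cnormM le_eqVlt; apply/orP; left; apply/eqP; congr N.
by rewrite /GRing.scale /= mulrBl mulrAC mulVf // mul1r.
Qed.

End ComplexDerivative.

(** * Midpoint sums along the boundary of a square *)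

Lemma bdry_affine_alg (F : numFieldType) (u v X Y S I : F) :
u * S + v * ((X + I * Y) * S + S ^+ 2 / 2) +
(u * (0 + I * S) + v * ((X + S + I * Y) * (0 + I * S) + (0 + I * S) ^+ 2 / 2)) -
(u * S + v * ((X + I * (Y + S)) * S + S ^+ 2 / 2)) -
(u * (0 + I * S) + v * ((X + I * Y) * (0 + I * S) + (0 + I * S) ^+ 2 / 2)) = 0.
Proof. ring. Qed.

Section Edge.
Variable R : realType.
Local Notation C := R[i].
Local Notation N := (@Normc.normc R).
Local Notation Re := (@complex.Re R).
Local Notation Im := (@complex.Im R).
Local Notation "x %:C" := (real_complex R x).
Implicit Types (f g : C -> C) (p d u v : C) (m : nat).

(** The midpoint sum for the integral of f along the segment from p to p + d,
    cut into 2 ^ m equal parts. The recursion is the additivity of the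
    integral under bisection, at the finite level. *)
Fixpoint edge f p d m : C :=
  if m is k.+1 then edge f p (d / 2) k + edge f (p + d / 2) (d / 2) k
  else f (p + d / 2) * d.

Lemma seg_left p d (t : R) : p + t%:C * (d / 2) = p + (t / 2)%:C * d.
Proof. by rewrite rmorphM /= fmorphV /= (rmorph_nat _ 2); ring. Qed.

Lemma seg_right p d (t : R) : p + d / 2 + t%:C * (d / 2) = p + ((1 + t) / 2)%:C * d.
Proof. by rewrite rmorphM /= fmorphV /= (rmorph_nat _ 2) rmorphD rmorph1; ring. Qed.

Lemma seg_mid d : (1 / 2)%:C * d = d / 2.
Proof. by rewrite rmorphM /= fmorphV /= (rmorph_nat _ 2) rmorph1; ring. Qed.

Lemma edge_ext f g p d m :
  (forall t : R, 0 <= t <= 1 -> f (p + t%:C * d) = g (p + t%:C * d)) ->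
  edge f p d m = edge g p d m.
Proof.
elim: m p d => [|m IH] p d fg /=.
  have := fg (1 / 2); rewrite seg_mid => -> //; lra.
congr (_ + _); apply: IH => t t01; rewrite ?seg_right ?seg_left; apply: fg; lra.
Qed.

Lemma edge_bound f p d m (M : R) :
  (forall t : R, 0 <= t <= 1 -> N (f (p + t%:C * d)) <= M) ->
  N (edge f p d m) <= M * N d.
Proof.
elim: m p d => [|m IH] p d fM /=.
  have := fM (1 / 2); rewrite seg_mid => h.
  by rewrite cnormM ler_wpM2r ?cnorm_ge0// h //; lra.
have N2 : N (d / 2) = N d / 2.
  by rewrite cnormM cnormV -(rmorph_nat (real_complex R) 2) cnorm_real ger0_norm.
have h1 : N (edge f p (d / 2) m) <= M * N (d / 2).
  by apply: IH => t t01; rewrite seg_left; apply: fM; lra.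
have h2 : N (edge f (p + d / 2) (d / 2) m) <= M * N (d / 2).
  by apply: IH => t t01; rewrite seg_right; apply: fM; lra.
by apply: le_trans (cnormD_le _ _) _; move: h1 h2; rewrite N2; lra.
Qed.

Lemma edge_Re_ge f p d m (k : R) :
  (forall t : R, 0 <= t <= 1 -> k <= Re (f (p + t%:C * d) * d)) ->
  k <= Re (edge f p d m).
Proof.
elim: m p d k => [|m IH] p d k fk /=.
  have := fk (1 / 2); rewrite seg_mid => h.
  by apply: h; lra.
have Re2 z : Re (z * (d / 2)) = Re (z * d) / 2.
  rewrite mulrA; case: (z * d) => x y.
  by rewrite -(rmorph_nat (real_complex R) 2) -fmorphV /= mulr0 subr0.
have h1 : k / 2 <= Re (edge f p (d / 2) m).
  apply: IH => t t01; rewrite seg_left Re2.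
  by have := fk (t / 2); lra.
have h2 : k / 2 <= Re (edge f (p + d / 2) (d / 2) m).
  apply: IH => t t01; rewrite seg_right Re2.
  by have := fk ((1 + t) / 2); lra.
by rewrite raddfD /=; lra.
Qed.

Lemma edgeD f g p d m :
  edge (fun z => f z + g z) p d m = edge f p d m + edge g p d m.
Proof. by elim: m p d => [|m IH] p d /=; [rewrite mulrDl|rewrite !IH addrACA]. Qed.

Lemma edgeZ u f p d m : edge (fun z => u * f z) p d m = u * edge f p d m.
Proof. by elim: m p d => [|m IH] p d /=; [rewrite mulrA|rewrite !IH mulrDr]. Qed.

Lemma edge_affine u v p d m :
  edge (fun z => u + v * z) p d m = u * d + v * (p * d + d ^+ 2 / 2).
Proof. by elim: m p d => [|m IH] p d /=; rewrite ?IH; field. Qed.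

Definition in_square (x y s : R) : set C :=
  [set z | x <= Re z <= x + s /\ y <= Im z <= y + s].

(** The counterclockwise sum along the boundary of the square: the last two
    terms are the upper and left sides, which are summed from left to right
    and upwards, hence the signs. *)
Definition bdry f (x y s : R) m : C :=
  edge f (Complex x y) s%:C m + edge f (Complex (x + s) y) (Complex 0 s) m
  - edge f (Complex x (y + s)) s%:C m - edge f (Complex x y) (Complex 0 s) m.

(** The sums along the inner sides of the four quarters cancel. *)
Lemma bdry_split f x y s m : bdry f x y s m.+1 =
  bdry f x y (s / 2) m + bdry f (x + s / 2) y (s / 2) m +
  bdry f x (y + s / 2) (s / 2) m + bdry f (x + s / 2) (y + s / 2) (s / 2) m.
Proof.
have h1 : s%:C / 2 = (s / 2)%:C by rewrite rmorphM /= fmorphV /= (rmorph_nat _ 2).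
have h2 : Complex 0 s / 2 = Complex 0 (s / 2).
  rewrite -(rmorph_nat (real_complex R) 2) -fmorphV /=.
  by apply/eqP; rewrite eq_complex /= ; apply/andP; split; apply/eqP; ring.
have h3 (a b c : R) : Complex a b + c%:C = Complex (a + c) b.
  by apply/eqP; rewrite eq_complex /= addr0 !eqxx.
have h4 (a b c : R) : Complex a b + Complex 0 c = Complex a (b + c).
  by apply/eqP; rewrite eq_complex /= addr0 !eqxx.
have h5 (a : R) : a + s / 2 + s / 2 = a + s by field.
by rewrite /bdry /= h1 h2 !h3 !h4 !h5; ring.
Qed.

Lemma seg_h (x y s t : R) : Complex x y + t%:C * s%:C = Complex (x + t * s) y.
Proof. by apply/eqP; rewrite eq_complex /=; apply/andP; split; apply/eqP; ring. Qed.

Lemma seg_v (x y s t : R) : Complex x y + t%:C * Complex 0 s = Complex x (y + t * s).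
Proof. by apply/eqP; rewrite eq_complex /=; apply/andP; split; apply/eqP; ring. Qed.

Lemma cnorm_imag (s : R) : N (Complex 0 s) = `|s|.
Proof. by rewrite /= expr0n add0r sqrtr_sqr. Qed.

Definition on_boundary (x y s : R) : set C :=
  [set z | in_square x y s z /\ [\/ Re z = x, Re z = x + s, Im z = y | Im z = y + s]].

Lemma on_boundary_segment (x y s t : R) : 0 < s -> 0 <= t <= 1 ->
  [/\ on_boundary x y s (Complex (x + t * s) y), on_boundary x y s (Complex (x + t * s) (y + s)),
      on_boundary x y s (Complex x (y + t * s)) & on_boundary x y s (Complex (x + s) (y + t * s))].
Proof.
move=> s0 /andP[t0 t1]; have h1 : 0 <= t * s by rewrite mulr_ge0// ltW.
have h2 : t * s <= s by rewrite ler_piMl // ltW.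
split; (split; [split; rewrite /=; lra|]).
- by apply: Or43.
- by apply: Or44.
- by apply: Or41.
- by apply: Or42.
Qed.

Lemma bdry_bound f x y s m (M : R) : 0 < s ->
  (forall z, on_boundary x y s z -> N (f z) <= M) -> N (bdry f x y s m) <= 4 * M * s.
Proof.
move=> s0 fM.
have e1 : N (edge f (Complex x y) s%:C m) <= M * N s%:C.
  apply: edge_bound => t t01; rewrite seg_h.
  by apply: fM; have [] := on_boundary_segment x y s0 t01.
have e2 : N (edge f (Complex (x + s) y) (Complex 0 s) m) <= M * N (Complex 0 s).
  apply: edge_bound => t t01; rewrite seg_v.
  by apply: fM; have [] := on_boundary_segment x y s0 t01.
have e3 : N (edge f (Complex x (y + s)) s%:C m) <= M * N s%:C.
  apply: edge_bound => t t01; rewrite seg_h.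
  by apply: fM; have [] := on_boundary_segment x y s0 t01.
have e4 : N (edge f (Complex x y) (Complex 0 s) m) <= M * N (Complex 0 s).
  apply: edge_bound => t t01; rewrite seg_v.
  by apply: fM; have [] := on_boundary_segment x y s0 t01.
rewrite cnorm_real gtr0_norm // in e1 e3; rewrite cnorm_imag gtr0_norm // in e2 e4.
rewrite /bdry; apply: le_trans (cnormB_le _ _) _.
have := cnormB_le (edge f (Complex x y) s%:C m + edge f (Complex (x + s) y) (Complex 0 s) m)
  (edge f (Complex x (y + s)) s%:C m).
have := cnormD_le (edge f (Complex x y) s%:C m) (edge f (Complex (x + s) y) (Complex 0 s) m).
lra.
Qed.

Lemma bdryD f g x y s m :
  bdry (fun z => f z + g z) x y s m = bdry f x y s m + bdry g x y s m.
Proof. by rewrite /bdry !edgeD; ring. Qed.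

Lemma bdryZ u f x y s m : bdry (fun z => u * f z) x y s m = u * bdry f x y s m.
Proof. by rewrite /bdry !edgeZ; ring. Qed.

(** The midpoint rule is exact on affine functions, which have a primitive. *)
Lemma bdry_affine u v x y s m : bdry (fun z => u + v * z) x y s m = 0.
Proof.
rewrite /bdry !edge_affine.
have E (a b : R) : Complex a b = a%:C + 'i%C * b%:C by exact: complexE (Complex a b).
have D (a b : R) : (a + b)%:C = a%:C + b%:C by rewrite rmorphD.
rewrite (E x y) (E (x + s)) (E x (y + s)) (E 0 s) !D (rmorph0 (real_complex R)).
exact: bdry_affine_alg.
Qed.

Lemma bdry_ext f g x y s m : 0 < s ->
  (forall z, on_boundary x y s z -> f z = g z) -> bdry f x y s m = bdry g x y s m.
Proof.
move=> s0 fg; rewrite /bdry; congr (_ + _ - _ - _); apply: edge_ext => t t01.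
all: by rewrite ?seg_h ?seg_v; apply: fg; have [] := on_boundary_segment x y s0 t01.
Qed.

End Edge.

(** * Goursat's theorem for midpoint sums *)

Section Goursat.
Variable R : realType.
Local Notation C := R[i].
Local Notation N := (@Normc.normc R).
Local Notation Re := (@complex.Re R).
Local Notation Im := (@complex.Im R).
Local Notation "x %:C" := (real_complex R x).
Implicit Types (f g : C -> C) (p z : C) (S : seq C) (x y s t : R) (m : nat).

(** The signed square root: over an interval of length s around 0 its
    increment is at least the square root of s. *)
Definition ssqrt t : R := Num.sqrt t - Num.sqrt (- t).

Lemma ssqrt_mono s t : s <= t -> ssqrt s <= ssqrt t.
Proof.
by move=> st; rewrite /ssqrt lerB // ler_wsqrtr // lerN2.
Qed.

Lemma ssqrt_straddle s t : 0 <= s -> t <= 0 <= t + s -> Num.sqrt s <= ssqrt (t + s) - ssqrt t.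
Proof.
move=> s0 /andP[t0 ts0];
  rewrite /ssqrt (@ler0_sqrtr _ t) // (@ler0_sqrtr _ (- (t + s))) ?oppr_le0//.
rewrite subr0 sub0r opprK.
have h1 := sqrtr_ge0 (t + s); have h2 := sqrtr_ge0 (- t).
rewrite -(@ler_pXn2r _ 2) ?nnegrE ?addr_ge0 ?sqrtr_ge0//.
rewrite sqrrD !sqr_sqrtr ?oppr_ge0//.
have : 0 <= Num.sqrt (t + s) * Num.sqrt (- t) by rewrite mulr_ge0.
lra.
Qed.

(** A mass of p in a square, additive under subdivision as a mixed second
    difference, and at least the side of each square that contains p. *)
Definition point_mass p x y s : R :=
  (ssqrt (x + s - Re p) - ssqrt (x - Re p)) * (ssqrt (y + s - Im p) - ssqrt (y - Im p)).

(** The measure of a square against which its boundary sum is compared. The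
    area absorbs the error near a point of differentiability, which is of the
    order of s ^ 2; the masses absorb the error near the exceptional points of
    S, where mere continuity gives an error of the order of s. *)
Definition gauge S x y s : R := s ^+ 2 + \sum_(p <- S) point_mass p x y s.

Lemma point_mass_ge0 p x y s : 0 <= s -> 0 <= point_mass p x y s.
Proof. by move=> s0; rewrite mulr_ge0// subr_ge0 ssqrt_mono//; lra. Qed.

Lemma point_mass_ge p x y s : 0 < s -> in_square x y s p -> s <= point_mass p x y s.
Proof.
move=> s0 [px py]; rewrite -{1}(sqr_sqrtr (ltW s0)) expr2 /point_mass.
apply: ler_pM; rewrite ?sqrtr_ge0//.
  by rewrite (addrAC x); apply: ssqrt_straddle; [exact: ltW|lra].
by rewrite (addrAC y); apply: ssqrt_straddle; [exact: ltW|lra].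
Qed.

Lemma gauge_split S x y s : gauge S x y s =
  gauge S x y (s / 2) + gauge S (x + s / 2) y (s / 2) +
  gauge S x (y + s / 2) (s / 2) + gauge S (x + s / 2) (y + s / 2) (s / 2).
Proof.
have h (a : R) : a + s / 2 + s / 2 = a + s by field.
rewrite /gauge (_ : \sum_(p <- S) point_mass p x y s = \sum_(p <- S) (
  point_mass p x y (s / 2) + point_mass p (x + s / 2) y (s / 2) +
  point_mass p x (y + s / 2) (s / 2) + point_mass p (x + s / 2) (y + s / 2) (s / 2))).
  by rewrite !big_split /=; field.
by apply: eq_bigr => p _; rewrite /point_mass !h; ring.
Qed.

Lemma gauge_ge S p x y s : 0 < s -> p \in S -> in_square x y s p -> s <= gauge S x y s.
Proof.
move=> s0 pS psq; rewrite /gauge (big_rem p) //=.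
have := point_mass_ge s0 psq; have := sqr_ge0 s.
have : 0 <= \sum_(q <- rem p S) point_mass q x y s.
  by apply: sumr_ge0 => q _; apply: point_mass_ge0; exact: ltW.
lra.
Qed.

Lemma gauge_sqr S x y s : 0 <= s -> s ^+ 2 <= gauge S x y s.
Proof.
by move=> s0; rewrite lerDl; apply: sumr_ge0 => q _; exact: point_mass_ge0.
Qed.

Lemma in_square_dist x y s p z : in_square x y s p -> in_square x y s z -> N (z - p) <= 2 * s.
Proof.
move=> [p1 p2] [z1 z2]; apply: le_trans (cnorm_le_ReIm _) _.
rewrite !raddfB /=.
have : `|Re z - Re p| <= s by rewrite ler_norml; lra.
have : `|Im z - Im p| <= s by rewrite ler_norml; lra.
lra.
Qed.

(** Both sides are additive under subdivision into quarters, so it is enough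
    to treat small squares around each point; there f is affine, or constant
    at a point of S, up to a small error, and boundary sums vanish on affine
    functions. *)
Lemma goursat f S x0 y0 s0 : 0 < s0 ->
  (forall z, in_square x0 y0 s0 z -> (exists l, cdiff f z l) \/ (z \in S /\ ccont f z)) ->
  forall e : R, 0 < e -> exists m0, forall m, (m0 <= m)%N ->
    N (bdry f x0 y0 s0 m) <= e * gauge S x0 y0 s0.
Proof.
move=> s00 fS e e0.
apply: (@square_induction R (fun x y s : R => exists m0, forall m, (m0 <= m)%N ->
    N (bdry f x y s m) <= e * gauge S x y s)) => //.
  move=> x y s s_gt0 [m1 h1] [m2 h2] [m3 h3] [m4 h4].
  exists (m1 + m2 + m3 + m4).+1 => -[//|m mm].
  rewrite bdry_split gauge_split.
  have [k1 k2 k3 k4] : [/\ m1 <= m, m2 <= m, m3 <= m & m4 <= m]%N by split; lia.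
  move: (h1 _ k1) (h2 _ k2) (h3 _ k3) (h4 _ k4).
  move: (bdry _ _ _ _ _) (bdry _ _ _ _ _) (bdry _ _ _ _ _) (bdry _ _ _ _ _) => b4 b3 b2 b1.
  have := cnormD_le (b1 + b2 + b3) b4; have := cnormD_le (b1 + b2) b3; have := cnormD_le b1 b2.
  move: (gauge _ _ _ _) (gauge _ _ _ _) (gauge _ _ _ _) (gauge _ _ _ _) => g4 g3 g2 g1.
  by rewrite !(mulrDr e); lra.
move=> p q p01 q01; set a := Complex p q.
have asq : in_square x0 y0 s0 a by [].
have [[l fl]|[aS fa]] := fS _ asq.
  have e8 : 0 < e / 8 by lra.
  have [d d0 dP] := fl _ e8; exists (d / 2); first lra.
  move=> x y s sp sd _ _ _ _ px qy; exists 0%N => m _.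
  have asq' : in_square x y s a by [].
  apply: le_trans (_ : e * s ^+ 2 <= _); last by rewrite ler_pM2l// gauge_sqr ?ltW.
  (* Subtracting the affine part does not change the sum. *)
  have -> : bdry f x y s m = bdry (fun z => f z - f a - l * (z - a)) x y s m.
    transitivity (bdry (fun z => (f z - f a - l * (z - a)) + ((f a - l * a) + l * z)) x y s m).
      by apply: bdry_ext => // z _; ring.
    by rewrite bdryD bdry_affine addr0.
  apply: le_trans (_ : 4 * (e / 8 * (2 * s)) * s <= _).
    apply: bdry_bound => // z [zsq _].
    have zs := in_square_dist asq' zsq.
    by apply: le_trans (dP _ _) _; [lra|rewrite ler_pM2l].
  by rewrite le_eqVlt; apply/orP; left; apply/eqP; field.
have e4 : 0 < e / 4 by lra.
have [d d0 dP] := fa _ e4; exists (d / 2); first lra.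
move=> x y s sp sd _ _ _ _ px qy; exists 0%N => m _.
have asq' : in_square x y s a by [].
apply: le_trans (_ : e * s <= _); last by rewrite ler_pM2l// (gauge_ge _ aS).
have -> : bdry f x y s m = bdry (fun z => f z - f a) x y s m.
  transitivity (bdry (fun z => (f z - f a) + (f a + 0 * z)) x y s m).
    by apply: bdry_ext => // z _; ring.
  by rewrite bdryD bdry_affine addr0.
apply: le_trans (_ : 4 * (e / 4) * s <= _); last by rewrite le_eqVlt; apply/orP; left; apply/eqP;
  field.
by apply: bdry_bound => // z [zsq _]; apply: dP; have := in_square_dist asq' zsq; lra.
Qed.

Lemma edge_Im_ge f p (d : C) m k :
  (forall t : R, 0 <= t <= 1 -> k <= Im (f (p + t%:C * d) * d)) ->
  k <= Im (edge f p d m).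
Proof.
move=> fk; have ReIm z : Re (- 'i%C * z) = Im z by case: z => a b /=; ring.
rewrite -ReIm -edgeZ; apply: edge_Re_ge => t t01.
by rewrite -mulrA ReIm fk.
Qed.

Lemma edge_Im_le f p (d : C) m k :
  (forall t : R, 0 <= t <= 1 -> Im (f (p + t%:C * d) * d) <= - k) ->
  Im (edge f p d m) <= - k.
Proof.
move=> fk; have ReIm z : Re ('i%C * z) = - Im z by case: z => a b /=; ring.
rewrite lerNr -ReIm -edgeZ; apply: edge_Re_ge => t t01.
by rewrite -mulrA ReIm -lerNr fk.
Qed.

(** A lower bound for the winding number 2 pi: along each side of the square
    of half side r, the imaginary part of dz / z is r / |z|^2 |dz|, with |z|^2
    <= 2 r^2 and a side of length 2 r. *)
Lemma winding_origin r m : 0 < r -> 4 <= Im (bdry (fun z => z^-1) (- r) (- r) (2 * r) m).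
Proof.
move=> r0.
have key t : 0 <= t <= 1 -> 1 <= r / (r ^+ 2 + (- r + t * (2 * r)) ^+ 2) * (2 * r).
  move=> /andP[t0 t1]; have r2 : 0 < r ^+ 2 by rewrite exprn_gt0.
  rewrite mulrAC ler_pdivlMr; last by rewrite ltr_wpDr ?sqr_ge0.
  rewrite mul1r.
  have : 0 <= t * (1 - t) * r ^+ 2 by apply: mulr_ge0; [apply: mulr_ge0 => //;
    rewrite subr_ge0|exact: ltW].
  lra.
have rr : - r + 2 * r = r by ring.
have e1 : 1 <= Im (edge (fun z => z^-1) (Complex (- r) (- r)) (2 * r)%:C m).
  apply: edge_Im_ge => t t01; rewrite seg_h /=.
  have := key t t01; rewrite sqrrN [X in _ <= X ->
    _](_ : _ = - - r / ((- r + t * (2 * r)) ^+ 2 + r ^+ 2) * (2 * r)); last by rewrite opprK addrC.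
  by rewrite mulr0 add0r mulNr.
have e2 : 1 <= Im (edge (fun z => z^-1) (Complex r (- r)) (Complex 0 (2 * r)) m).
  by apply: edge_Im_ge => t t01; rewrite seg_v /= mulr0 addr0 key.
have e3 : Im (edge (fun z => z^-1) (Complex (- r) r) (2 * r)%:C m) <= - 1.
  apply: edge_Im_le => t t01; rewrite seg_h /= mulr0 add0r.
  by have := key t t01; rewrite addrC mulNr lerN2.
have e4 : Im (edge (fun z => z^-1) (Complex (- r) (- r)) (Complex 0 (2 * r)) m) <= - 1.
  apply: edge_Im_le => t t01; rewrite seg_v /= mulr0 addr0.
  by have := key t t01; rewrite sqrrN !mulNr lerN2.
rewrite /bdry rr !raddfB /= !raddfD /=; lra.
Qed.

End Goursat.

(** * Cauchy's estimate and removable singularities *)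

Section Removable.
Variable R : realType.
Local Notation C := R[i].
Local Notation N := (@Normc.normc R).
Local Notation Re := (@complex.Re R).
Local Notation Im := (@complex.Im R).
Local Notation "x %:C" := (real_complex R x).
Implicit Types (f g : C -> C) (p a b z w l : C) (S : seq C) (x y s t r M : R) (m : nat).

Definition dq f a l z : C := if z == a then l else (f z - f a) / (z - a).

Lemma dqK f a l z : f z - f a = dq f a l z * (z - a).
Proof.
rewrite /dq; case: eqVneq => [->|za]; first by rewrite !subrr mulr0.
by rewrite divfK // subr_eq0.
Qed.

Lemma dq_cont_base f a l : cdiff f a l -> ccont (dq f a l) a.
Proof.
move=> fl e e0; have [d d0 dP] := fl e e0; exists d => // z zd.
rewrite {2}/dq eqxx; have [->|za] := eqVneq z a; first by rewrite /dq eqxx subrr cnorm0 ltW.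
have nza : z - a != 0 by rewrite subr_eq0.
have -> : dq f a l z - l = (f z - f a - l * (z - a)) / (z - a).
  by rewrite (dqK _ _ l) -mulrBl mulfK.
by rewrite cnormM cnormV ler_pdivrMr ?dP// cnorm_gt0.
Qed.

Lemma dq_near f a l z : z != a ->
  forall w, N (w - z) < N (z - a) -> (f w - f a) / (w - a) = dq f a l w.
Proof.
move=> za w; rewrite /dq; case: eqVneq => // ->.
by rewrite cnorm_distC ltxx.
Qed.

Lemma dq_cont f a l z : z != a -> ccont f z -> ccont (dq f a l) z.
Proof.
move=> za fz; have nza : z - a != 0 by rewrite subr_eq0.
apply: (@ccont_local _ _ _ _ (N (z - a)) _ (dq_near f l za)); first by rewrite cnorm_gt0.
apply: ccontM; first by apply: ccontB => //; exact: ccont_cst.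
by apply: ccontV => //; apply: ccontB; [exact: ccont_id|exact: ccont_cst].
Qed.

Lemma dq_diff f a l z : z != a -> (exists k, cdiff f z k) -> exists k, cdiff (dq f a l) z k.
Proof.
move=> za [k fz]; have nza : z - a != 0 by rewrite subr_eq0.
eexists; apply: (@cdiff_local _ _ _ _ _ (N (z - a)) _ (dq_near f l za)); first by rewrite cnorm_gt0.
apply: cdiffM; first by apply: cdiffB; [exact: fz|exact: cdiff_cst].
by apply: cdiffV => //; apply: cdiffB; [exact: cdiff_id|exact: cdiff_cst].
Qed.

(** Points of S may be singularities, as long as f is continuous there. *)
Definition holo_at S f z := (exists l, cdiff f z l) \/ (z \in S /\ ccont f z).

Lemma holo_at_cont S f z : holo_at S f z -> ccont f z.
Proof. by case=> [[l /cdiff_cont]|[]]. Qed.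

Lemma dq_holo S f a l z : cdiff f a l -> holo_at S f z -> holo_at (a :: S) (dq f a l) z.
Proof.
move=> fa fz; have [->|za] := eqVneq z a.
  by right; rewrite mem_head; split => //; exact: dq_cont_base.
case: fz => [fz|[zS fz]]; first by left; exact: dq_diff.
by right; rewrite inE zS orbT; split => //; exact: dq_cont.
Qed.

Lemma edge_shift f p a (d : C) m : edge f (p + a) d m = edge (fun z => f (z + a)) p d m.
Proof. by elim: m p d => [|m IH] p d /=; rewrite (addrAC p) ?IH. Qed.

Lemma winding_centre a r m : 0 < r ->
  4 <= N (bdry (fun z => (z - a)^-1) (Re a - r) (Im a - r) (2 * r) m).
Proof.
move=> r0; apply: le_trans (le_trans (winding_origin m r0) _) (Im_le_cnorm _).
rewrite (_ : bdry (fun z => (z - a)^-1) _ _ _ _ = bdry (fun z => z^-1) (- r) (- r) (2 * r) m).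
  exact: ler_norm.
have E (u v : R) : Complex (u + Re a) (v + Im a) = Complex u v + a by case: a.
have E1 (u v w : R) : u - v + w = - v + w + u by ring.
rewrite /bdry !E1 ![_ a - r]addrC !E !edge_shift.
by do ![congr (_ + _) | congr (- _)]; apply: edge_ext => t _; rewrite addrK.
Qed.

Lemma centre_boundary_dist a r z : 0 < r ->
  on_boundary (Re a - r) (Im a - r) (2 * r) z -> r <= N (z - a).
Proof.
move=> r0 [_ zb].
case: zb => zb; [apply: le_trans (Re_le_cnorm _)|apply: le_trans (Re_le_cnorm _)|
  apply: le_trans (Im_le_cnorm _)|apply: le_trans (Im_le_cnorm _)]; rewrite raddfB /= zb.
- by rewrite (_ : _ - _ = - r) ?normrN ?ler_norm//; ring.
- by rewrite (_ : _ - _ = r) ?normrN ?ler_norm//; ring.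
- by rewrite (_ : _ - _ = - r) ?normrN ?ler_norm//; ring.
- by rewrite (_ : _ - _ = r) ?normrN ?ler_norm//; ring.
Qed.

Lemma centre_square_dist a r z : in_square (Re a - r) (Im a - r) (2 * r) z -> N (z - a) <= 2 * r.
Proof.
move=> [z1 z2]; apply: le_trans (cnorm_le_ReIm _) _; rewrite !raddfB /=.
have : `|Re z - Re a| <= r by rewrite ler_norml; lra.
have : `|Im z - Im a| <= r by rewrite ler_norml; lra.
lra.
Qed.

Lemma ler_all_eps x y : (forall e : R, 0 < e -> x <= y + e) -> x <= y.
Proof. by move=> h; apply/ler_addgt0Pr. Qed.

(** The difference quotient at a satisfies the hypotheses of Goursat's theorem
    with the exceptional points a :: S; its boundary sum is that of f / (z -
    a) minus f(a) times the winding sum. The former is at most 8 M and the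
    latter at least 4 in modulus. *)
Lemma centre_bound f S a r M l : 0 < r -> cdiff f a l ->
  (forall z, N (z - a) <= 2 * r -> holo_at S f z) ->
  (forall z, r <= N (z - a) <= 2 * r -> N (f z) <= M) -> N (f a) <= 2 * M.
Proof.
move=> r0 fa fS fM.
pose x := Re a - r; pose y := Im a - r; pose s := 2 * r.
have s0 : 0 < s by rewrite /s; lra.
have G0 : 0 < gauge (a :: S) x y s.
  by apply: lt_le_trans (gauge_sqr _ _ _ (ltW s0)); rewrite exprn_gt0.
apply: ler_all_eps => e e0.
have [m0 /(_ m0 (leqnn _)) h] : exists m0, forall m, (m0 <= m)%N ->
    N (bdry (dq f a l) x y s m) <= e / gauge (a :: S) x y s * gauge (a :: S) x y s.
  apply: goursat => //; last by rewrite divr_gt0.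
  by move=> z /centre_square_dist /fS; exact: dq_holo.
rewrite divfK ?gt_eqF// in h.
set W := bdry (fun z => (z - a)^-1) x y s m0.
have W4 : 4 <= N W by exact: winding_centre.
set V := bdry (fun z => f z * (z - a)^-1) x y s m0.
(* Each side has length s = 2 r, and |z - a| >= r on it. *)
have V8 : N V <= 4 * (M / r) * s.
  apply: bdry_bound => // z zb; have rz := centre_boundary_dist r0 zb.
  have z2 := centre_square_dist zb.1.
  have fz : N (f z) <= M by apply: fM; rewrite rz.
  rewrite cnormM cnormV ler_pM ?invr_ge0 ?cnorm_ge0// lef_pV2 ?posrE //.
  exact: lt_le_trans rz.
have E : bdry (dq f a l) x y s m0 = V + - f a * W.
  rewrite -bdryZ -bdryD; apply: bdry_ext => // z zb.
  have rz := centre_boundary_dist r0 zb.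
  rewrite /dq ifF ?mulrBl ?mulNr//; apply/negP => /eqP za.
  by move: rz; rewrite za subrr cnorm0 leNgt r0.
have : N (f a * W) <= N V + e.
  have -> : f a * W = V - bdry (dq f a l) x y s m0 by rewrite E; ring.
  by apply: le_trans (cnormB_le _ _) _; rewrite lerD2l.
have E8 : 4 * (M / r) * s = 8 * M by rewrite /s; field; rewrite gt_eqF.
rewrite E8 in V8.
rewrite cnormM => h2; have : N (f a) * 4 <= N (f a) * N W by rewrite ler_wpM2l ?cnorm_ge0.
lra.
Qed.

Lemma exists_near_notin S z r : 0 < r -> exists w, N (w - z) < r /\ w \notin S.
Proof.
move=> r0.
have [d d0 dP] : exists2 d : R, 0 < d & forall w, w \in S -> w != z -> d <= N (w - z).
  elim: S => [|u S [d d0 dP]]; first by exists 1.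
  have [->|uz] := eqVneq u z.
    exists d => // w; rewrite inE => /orP[/eqP ->|]; first by rewrite eqxx.
    exact: dP.
  exists (Num.min d (N (u - z))); first by rewrite lt_min d0 cnorm_gt0 subr_eq0.
  move=> w; rewrite inE ge_min => /orP[/eqP -> _|wS wz]; first by rewrite lexx orbT.
  by rewrite dP.
have m0 : 0 < Num.min r d / 2 by rewrite divr_gt0 // lt_min r0.
have m1 : Num.min r d / 2 < Num.min r d by rewrite ltr_pdivrMr// ltr_pMr; lra.
exists (z + (Num.min r d / 2)%:C).
have E : N (z + (Num.min r d / 2)%:C - z) = Num.min r d / 2.
  by rewrite addrC addKr cnorm_real gtr0_norm.
split; first by rewrite E (lt_le_trans m1) // ge_min lexx.
apply/negP => /dP; rewrite E => h.
have /h : z + (Num.min r d / 2)%:C != z by rewrite -subr_eq0 -cnorm_eq0 E gt_eqF.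
by move=> h2; move: (le_lt_trans h2 m1); rewrite lt_min ltxx andbF.
Qed.

(** On a boundary at distance at least r / 8 from b the quotient is at most 2
    M / (r / 8), and centre_bound doubles this bound. The points of b :: S are
    reached by continuity. *)
Lemma dq_bound f S a b l r M : 0 < r ->
  (forall z, N (z - a) < r -> holo_at S f z) ->
  (forall z, N (z - a) < r -> N (f z) <= M) ->
  N (b - a) < r / 16 -> cdiff f b l ->
  forall z, N (z - a) < r / 16 -> N (dq f b l z) <= 32 * M / r.
Proof.
move=> r0 fS fM ba fb.
have bS z : N (z - a) < r -> holo_at (b :: S) (dq f b l) z.
  by move=> /fS; exact: dq_holo.
have main z : N (z - a) < r / 16 -> z \notin b :: S -> N (dq f b l z) <= 32 * M / r.
  move=> za zbS; have zr : N (z - a) < r by lra.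
  have [k kz] : exists k, cdiff (dq f b l) z k.
    by case: (bS _ zr) => // -[zbS' _]; rewrite zbS' in zbS.
  have -> : 32 * M / r = 2 * (2 * M / (r / 8)) by field; rewrite gt_eqF.
  apply: (@centre_bound _ (b :: S) _ (r / 4) _ k) => //; first lra.
    by move=> w wz; apply: bS; have := cnorm_dist_le w a z; lra.
  move=> w /andP[w1 w2].
  have wr : N (w - a) < r by have := cnorm_dist_le w a z; lra.
  have wb : r / 8 <= N (w - b).
    have := cnorm_dist_le w z b; have := cnorm_dist_le b z a;
      rewrite (cnorm_distC a z) (cnorm_distC b z); lra.
  have wb' : w != b by apply: contraTneq wb => ->; rewrite subrr cnorm0 -ltNge; lra.
  rewrite /dq (negbTE wb') cnormM cnormV ler_pM ?invr_ge0 ?cnorm_ge0//.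
    have br : N (b - a) < r by lra.
    by have := cnormB_le (f w) (f b); have := fM _ wr; have := fM _ br; lra.
  by rewrite lef_pV2 ?posrE; lra.
move=> z za; apply: ler_all_eps => e e0.
have zr : N (z - a) < r by lra.
have [d d0 dP] := holo_at_cont (bS _ zr) e0.
have [w [wz wS]] : exists w, N (w - z) < Num.min d (r / 16 - N (z - a)) /\ w \notin b :: S.
  by apply: exists_near_notin; rewrite lt_min d0 subr_gt0.
move: wz; rewrite lt_min => /andP[w1 w2].
have wa : N (w - a) < r / 16 by have := cnorm_dist_le w a z; lra.
have := main _ wa wS; have := dP _ w1; rewrite cnorm_distC.
by have := cnorm_le_add_dist (dq f b l z) (dq f b l w); lra.
Qed.

(** The limit at a of a function that is Lipschitz on a punctured disc is the
    supremum of u z - M |z - a|. *)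
Lemma lip_limit (u : C -> R) a r M : 0 < r ->
  (forall z w, z != a -> w != a -> N (z - a) < r -> N (w - a) < r ->
     `|u z - u w| <= M * N (z - w)) ->
  exists L, forall z, z != a -> N (z - a) < r -> `|u z - L| <= M * N (z - a).
Proof.
move=> r0 uM.
(* Two points of the punctured disc are needed to see that 0 <= M. *)
pose p := a + (r / 2)%:C.
have pa : N (p - a) = r / 2 by rewrite addrC addKr cnorm_real gtr0_norm; lra.
have pa' : p != a by rewrite -subr_eq0 -cnorm_eq0 pa gt_eqF; lra.
have pr : N (p - a) < r by lra.
have M0 : 0 <= M.
  have q1 : N ((a - (r / 2)%:C) - a) = r / 2 by rewrite addrC addKr cnormN cnorm_real gtr0_norm;
    lra.
  have q2 : a - (r / 2)%:C != a by rewrite -subr_eq0 -cnorm_eq0 q1 gt_eqF; lra.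
  have q3 : N (a - (r / 2)%:C - a) < r by lra.
  have := uM _ _ pa' q2 pr q3; have := normr_ge0 (u p - u (a - (r / 2)%:C)).
  have : 0 < N (p - (a - (r / 2)%:C)).
    rewrite (_ : p - _ = r%:C) ?cnorm_real ?gtr0_norm//.
    by rewrite /p opprB addrC addrA subrK -rmorphD /=; congr (_%:C); field.
  move=> h1 h2 h3; have := le_trans h2 h3; by rewrite pmulr_lge0.
pose A := [set u z - M * N (z - a) | z in [set z | z != a /\ N (z - a) < r]].
have ubA w : w != a -> N (w - a) < r -> ubound A (u w + M * N (w - a)).
  move=> wa wr _ [z [za zr] <-].
  have := uM _ _ za wa zr wr; rewrite ler_norml => /andP[_].
  have : M * N (z - w) <= M * (N (z - a) + N (w - a)).
    by rewrite ler_wpM2l// (cnorm_distC w a) cnorm_dist_le.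
  rewrite mulrDr; lra.
have A0 : A !=set0 by exists (u p - M * N (p - a)), p.
exists (sup A) => w wa wr.
have h1 : u w - M * N (w - a) <= sup A.
  by apply: ub_le_sup; [exists (u p + M * N (p - a)); exact: ubA|exists w].
have h2 : sup A <= u w + M * N (w - a) by apply: ge_sup => //; exact: ubA.
by rewrite ler_norml; lra.
Qed.

(** Second difference quotients with nodes other than a are bounded near a, so
    the first ones are Lipschitz, uniformly in the nodes. Letting one node
    tend to a, the quotient of f at a is Lipschitz on the punctured disc,
    hence has a limit. *)
Lemma removable_singularity f a r : 0 < r ->
  (forall z, z != a -> N (z - a) < r -> exists l, cdiff f z l) -> ccont f a ->
  exists l, cdiff f a l.
Proof.
move=> r0 fd fa.
have [d1 d10 d1P] := fa 1 ltr01.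
pose d := Num.min d1 r.
have d0 : 0 < d by rewrite lt_min d10.
pose M := N (f a) + 1.
have fM z : N (z - a) < d -> N (f z) <= M.
  rewrite lt_min => /andP[/d1P h _]; have := cnorm_le_add_dist (f z) (f a); rewrite /M; lra.
have fh z : N (z - a) < d -> holo_at [:: a] f z.
  rewrite lt_min => /andP[_ zr]; have [->|za] := eqVneq z a.
    by right; rewrite mem_head.
  by left; exact: fd.
(* M1 and M2 bound the first and second difference quotients, on discs of
   radius d' and d2. *)
pose d' := d / 16; pose M1 := 32 * M / d; pose M2 := 32 * M1 / d'; pose d2 := d' / 16.
have d'0 : 0 < d' by rewrite /d'; lra.
have d20 : 0 < d2 by rewrite /d2; lra.
have h2 b z w : b != a -> z != a -> w != a -> z != b -> w != b ->
    N (b - a) < d2 -> N (z - a) < d2 -> N (w - a) < d2 ->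
    N ((f z - f b) / (z - b) - (f w - f b) / (w - b)) <= M2 * N (z - w).
  move=> ba za wa zb wb bd zd wd.
  have dr : d <= r by rewrite ge_min lexx orbT.
  have [l fb] : exists l, cdiff f b l by apply: fd => //; move: bd; rewrite /d2 /d'; lra.
  have M1P u : N (u - a) < d' -> N (dq f b l u) <= M1.
    by apply: (@dq_bound _ [:: a]) => //; move: bd; rewrite /d2 /d'; lra.
  have [k fk] : exists k, cdiff (dq f b l) w k.
    by apply: dq_diff => //; apply: fd => //; move: wd; rewrite /d2 /d'; lra.
  have kh u : N (u - a) < d' -> holo_at [:: b; a] (dq f b l) u.
    by move=> ud; apply: dq_holo => //; apply: fh; move: ud; rewrite /d'; lra.
  have := dq_bound d'0 kh M1P wd fk zd; rewrite -/M2 => h.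
  have E u : u != b -> (f u - f b) / (u - b) = dq f b l u by move=> /negbTE ub; rewrite /dq ub.
  by rewrite !E// (dqK _ _ k) cnormM ler_wpM2r ?cnorm_ge0.
pose q z := (f z - f a) / (z - a).
have h3 z w : z != a -> w != a -> N (z - a) < d2 -> N (w - a) < d2 ->
    N (q z - q w) <= M2 * N (z - w).
  move=> za wa zd wd; apply: ler_all_eps => e e0.
  have cq u : u != a -> ccont (fun b => (f u - f b) / (u - b)) a.
    move=> ua; apply: ccontM; first by apply: ccontB => //; exact: ccont_cst.
    apply: ccontV; first by rewrite subr_eq0.
    by apply: ccontB; [exact: ccont_cst|exact: ccont_id].
  have [r1 r10 r1P] := ccontB (cq _ za) (cq _ wa) e0.
  have [b [+ ]] : exists b, N (b - a) < Num.min r1 d2 /\ b \notin [:: a; z; w].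
    by apply: exists_near_notin; rewrite lt_min r10.
  rewrite lt_min !inE !negb_or => /andP[b1 b2] /and3P[ba bz bw].
  have := r1P _ b1; have : N ((f z - f b) / (z - b) - (f w - f b) / (w - b)) <= M2 * N (z - w).
    by apply: h2; rewrite // eq_sym.
  rewrite -/(q z) -/(q w) => k1; rewrite cnorm_distC => k2.
  by have := cnorm_le_add_dist (q z - q w) ((f z - f b) / (z - b) - (f w - f b) / (w - b)); lra.
have hR z w : z != a -> w != a -> N (z - a) < d2 -> N (w - a) < d2 ->
    `|Re (q z) - Re (q w)| <= M2 * N (z - w).
  by move=> za wa zd wd; rewrite -raddfB (le_trans (Re_le_cnorm _)) ?h3.
have hI z w : z != a -> w != a -> N (z - a) < d2 -> N (w - a) < d2 ->
    `|Im (q z) - Im (q w)| <= M2 * N (z - w).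
  by move=> za wa zd wd; rewrite -raddfB (le_trans (Im_le_cnorm _)) ?h3.
have [L1 L1P] := lip_limit d20 hR.
have [L2 L2P] := lip_limit d20 hI.
exists (Complex L1 L2) => e e0.
exists (Num.min d2 (e / (2 * `|M2| + 1))).
  by rewrite lt_min d20 divr_gt0// ltr_wpDl// mulr_ge0.
move=> z; rewrite lt_min => /andP[zd ze].
have [->|za] := eqVneq z a; first by rewrite !subrr mulr0 subr0 cnorm0 mulr0.
have nza : z - a != 0 by rewrite subr_eq0.
have -> : f z - f a - Complex L1 L2 * (z - a) = (q z - Complex L1 L2) * (z - a).
  by rewrite mulrBl /q divfK.
rewrite cnormM ler_wpM2r ?cnorm_ge0//.
apply: le_trans (cnorm_le_ReIm _) _; rewrite !raddfB /=.
have := L1P _ za zd; have := L2P _ za zd.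
move: ze; rewrite ltr_pdivlMr; last by rewrite ltr_wpDl// mulr_ge0.
have : M2 * N (z - a) <= `|M2| * N (z - a) by rewrite ler_wpM2r ?cnorm_ge0// ler_norm.
have := cnorm_ge0 (z - a); lra.
Qed.

End Removable.

(** * Derivatives of holomorphic functions *)

Section Derivative.
Variable R : realType.
Local Notation C := R[i].
Local Notation N := (@Normc.normc R).
Implicit Types (f g : C -> C) (a b z w l : C) (r s M e : R).

Lemma cdiff_unique f a l k : cdiff f a l -> cdiff f a k -> l = k.
Proof.
move=> fl fk; apply/eqP; rewrite -subr_eq0 -cnorm_eq0; apply/eqP/le_anti/andP; split;
  last exact: cnorm_ge0.
apply: ler_all_eps => e e0; have e2 : 0 < e / 2 by rewrite divr_gt0.
have [d1 d10 d1P] := fl _ e2; have [d2 d20 d2P] := fk _ e2.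
have [w [+ wa]] : exists w, N (w - a) < Num.min d1 d2 /\ w \notin [:: a].
  by apply: exists_near_notin; rewrite lt_min d10.
rewrite lt_min inE in wa * => /andP[w1 w2].
have h1 := d1P _ w1; have h2 := d2P _ w2.
have wa0 : 0 < N (w - a) by rewrite cnorm_gt0 subr_eq0.
rewrite -(ler_pM2r wa0) add0r -cnormM.
have -> : (l - k) * (w - a) = (f w - f a - k * (w - a)) - (f w - f a - l * (w - a)) by ring.
by apply: le_trans (cnormB_le _ _) _; lra.
Qed.

Definition cderiv f z : C := xget 0 [set l | cdiff f z l].

Lemma cderivP f z : (exists l, cdiff f z l) -> cdiff f z (cderiv f z).
Proof. by move=> [l fl]; rewrite /cderiv; case: xgetP => [_ ->//|/(_ l)]. Qed.

Lemma cderivE f z l : cdiff f z l -> cderiv f z = l.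
Proof. by move=> fl; apply: (cdiff_unique (cderivP _) fl); exists l. Qed.

(** Differentiability at each point of an open disc; the regularity of the
    derivative is a consequence. *)
Definition holo f a r := forall z, N (z - a) < r -> exists l, cdiff f z l.

Lemma holo_sub f a b r s : N (b - a) + s <= r -> holo f a r -> holo f b s.
Proof. by move=> h fr z zb; apply: fr; have := cnorm_dist_le z a b; lra. Qed.

(** The difference quotient is continuous at a, so a is a removable
    singularity. Everything on higher derivatives follows from this. *)
Lemma dq_holo_disc f a r : 0 < r -> holo f a r -> holo (dq f a (cderiv f a)) a r.
Proof.
move=> r0 fr z zr; have fa : cdiff f a (cderiv f a) by apply/cderivP/fr; rewrite subrr cnorm0.
have [->|za] := eqVneq z a; last by apply: dq_diff => //; exact: fr.
apply: (removable_singularity r0); last exact: dq_cont_base.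
by move=> w wa wr; apply: dq_diff => //; exact: fr.
Qed.

(** The derivative at z is the value at z of the difference quotient at z,
    which is bounded independently of z. *)
Lemma cderiv_bounded f a r : 0 < r -> holo f a r ->
  exists M d, [/\ 0 < d, d <= r & forall z, N (z - a) < d -> N (cderiv f z) <= M].
Proof.
move=> r0 fr; have [l fa] : exists l, cdiff f a l by apply: fr; rewrite subrr cnorm0.
have [d1 d10 d1P] := cdiff_cont fa ltr01.
pose d := Num.min d1 r.
have d0 : 0 < d by rewrite lt_min d10.
have dr : d <= r by rewrite ge_min lexx orbT.
exists (32 * (N (f a) + 1) / d), (d / 16); split; [lra|lra|] => z zd.
have <- : dq f z (cderiv f z) z = cderiv f z by rewrite /dq eqxx.
apply: (@dq_bound _ f [::] a z) => //.
- by move=> w wd; left; apply: fr; lra.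
- move=> w; rewrite lt_min => /andP[/d1P h _].
  by have := cnorm_le_add_dist (f w) (f a); lra.
- by apply/cderivP/fr; lra.
Qed.

(** The product rule for f z = f a + (z - a) k z. *)
Lemma cderiv_dq f a r : 0 < r -> holo f a r ->
  let k := dq f a (cderiv f a) in forall z, N (z - a) < r ->
    cderiv f z = k z + (z - a) * cderiv k z.
Proof.
move=> r0 fr k z zr; have kz := cderivP (dq_holo_disc r0 fr zr).
apply: cderivE.
have h := cdiffD (cdiff_cst (f a) z) (cdiffM (cdiffB (cdiff_id z) (cdiff_cst a z)) kz).
rewrite -/k subr0 add0r mul1r in h.
apply: cdiff_local ltr01 _ h => w _.
by rewrite mulrC -dqK addrC subrK.
Qed.

Lemma cderiv_cont f a r : 0 < r -> holo f a r -> ccont (cderiv f) a.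
Proof.
move=> r0 fr; have kr := dq_holo_disc r0 fr.
have [M [d [d0 dr dP]]] := cderiv_bounded r0 kr.
have aa : N (a - a) < r by rewrite subrr cnorm0.
have [l ka] := kr a aa.
move=> e e0; have e2 : 0 < e / 2 by rewrite divr_gt0.
have [d1 d10 d1P] := cdiff_cont ka e2.
have M1 : 0 < `|M| + 1 by rewrite ltr_wpDl.
exists (Num.min (Num.min d d1) (e / 2 / (`|M| + 1))).
  by rewrite !lt_min d0 d10 divr_gt0.
move=> z; rewrite !lt_min => /andP[/andP[z1 z2]]; rewrite ltr_pdivlMr// => z3.
rewrite (cderiv_dq r0 fr) ?(lt_le_trans z1)//.
set k := dq f a (cderiv f a) in dP d1P *.
have kaE : k a = cderiv f a by rewrite /k /dq eqxx.
rewrite -kaE addrAC; apply: le_trans (cnormD_le _ _) _.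
have := d1P _ z2; have : N ((z - a) * cderiv k z) <= N (z - a) * (`|M| + 1).
  rewrite cnormM ler_wpM2l ?cnorm_ge0//; apply: le_trans (dP _ z1) _.
  by have := ler_norm M; lra.
lra.
Qed.

(** In f' = k + (z - a) k', the second term is differentiable at the centre,
    where k' is continuous. *)
Lemma cderiv_holo f a r : 0 < r -> holo f a r -> holo (cderiv f) a r.
Proof.
move=> r0 fr b br; have r'0 : 0 < r - N (b - a) by lra.
have fb : holo f b (r - N (b - a)) by apply: holo_sub fr; lra.
have kb := dq_holo_disc r'0 fb.
have bb : N (b - b) < r - N (b - a) by rewrite subrr cnorm0.
have [l kl] := kb b bb; have k'c := cderiv_cont r'0 kb.
set k := dq _ _ _ in kb kl k'c.
exists (l + cderiv k b).
apply: (cdiff_local r'0 (f := fun z => k z + (z - b) * cderiv k z)).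
  by move=> z zb; rewrite (cderiv_dq r'0 fb).
apply: cdiffD => //; apply/caratheodory; exists (cderiv k); split => // z.
by rewrite subrr mul0r subr0 mulrC.
Qed.

Lemma holo_taylor2 f a r : 0 < r -> holo f a r -> exists c2, forall e, 0 < e ->
  exists2 d, 0 < d & forall h, N h < d ->
    N (f (a + h) - (f a + cderiv f a * h + c2 * h ^+ 2)) <= e * N h ^+ 2.
Proof.
move=> r0 fr; have aa : N (a - a) < r by rewrite subrr cnorm0.
have [l kl] := dq_holo_disc r0 fr aa; exists l => e e0.
have [d d0 dP] := kl e e0; exists d => // h hd.
have E : a + h - a = h by rewrite addrC addKr.
have := dP (a + h); rewrite E => /(_ hd).
rewrite {2}/dq eqxx => H.
have -> : f (a + h) - (f a + cderiv f a * h + l * h ^+ 2) =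
    (dq f a (cderiv f a) (a + h) - cderiv f a - l * h) * h.
  by have := dqK f a (cderiv f a) (a + h); rewrite E !mulrBl => <-; ring.
by rewrite cnormM expr2 mulrA ler_wpM2r ?cnorm_ge0.
Qed.

End Derivative.

(** * Second order jets of real functions on the plane *)

Section Jets.
Variable R : realType.
Local Notation C := R[i].
Local Notation N := (@Normc.normc R).
Local Notation Re := (@complex.Re R).
Local Notation "x %:C" := (real_complex R x).
Implicit Types (U V : C -> R) (z b h : C) (c m e k : R).

(** The expansion U (z + h) = c + Re (b h) + Re (q h^2) + m |h|^2 + o(|h|^2).
    Every real expansion of order two has this form; the coefficient m is a
    quarter of the Laplacian. *)
Definition jet U z c b m := exists q : C, forall e, 0 < e ->
  exists2 d : R, 0 < d & forall h, N h < d ->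
  `|U (z + h) - (c + Re (b * h) + Re (q * h ^+ 2) + m * N h ^+ 2)| <= e * N h ^+ 2.

Lemma jet_base U z c b m : jet U z c b m -> U z = c.
Proof.
move=> [q /(_ 1 ltr01)[d d0 /(_ 0)]]; rewrite cnorm0 => /(_ d0).
rewrite !expr0n /= !mulr0 !addr0 ?raddf0 normr_le0 subr_eq0.
by move/eqP.
Qed.

Lemma jetD U V z c c' b b' m m' : jet U z c b m -> jet V z c' b' m' ->
  jet (fun w => U w + V w) z (c + c') (b + b') (m + m').
Proof.
move=> [q H] [q' H']; exists (q + q') => e e0.
have e2 : 0 < e / 2 by rewrite divr_gt0.
have [d d0 dP] := H _ e2; have [d' d'0 d'P] := H' _ e2.
exists (Num.min d d') => [|h]; first by rewrite lt_min d0.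
rewrite lt_min => /andP[/dP h1 /d'P h2].
rewrite !(mulrDl, raddfD) /=; move: h1 h2; rewrite !ler_norml; lra.
Qed.

Lemma Re_realM k z : Re (k%:C * z) = k * Re z.
Proof. by case: z => x y /=; rewrite mul0r subr0. Qed.

Definition taylor2 (f : R -> R) (c p q : R) := forall e, 0 < e ->
  exists2 d : R, 0 < d & forall y, `|y| < d ->
  `|f (c + y) - (f c + p * y + q * y ^+ 2)| <= e * y ^+ 2.

(** The square of a linear form contributes |b|^2 / 2 to the coefficient of
    |h|^2, which is how second derivatives enter in jet_comp. *)
Lemma Re_mul_sqr b h : Re (b * h) ^+ 2 =
  Re ((b ^+ 2 / 2) * h ^+ 2) + N b ^+ 2 / 2 * N h ^+ 2.
Proof.
rewrite !cnorm_sqr (_ : b ^+ 2 / 2 * h ^+ 2 = (b * h) ^+ 2 / 2); last by rewrite exprMn mulrAC.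
have -> z : Re (z / 2) = Re z / 2.
  by rewrite -(rmorph_nat (real_complex R) 2) -fmorphV mulrC Re_realM mulrC.
by case: b h => b1 b2 [h1 h2] /=; field.
Qed.

(** With y = U (z + h) - c, whose square is Re (b h)^2 up to o(|h|^2),
    substitute into the expansion of f at c. *)
Lemma jet_comp U z c b m f p q : jet U z c b m -> taylor2 f c p q ->
  jet (fun w => f (U w)) z (f c) (p%:C * b) (p * m + q * N b ^+ 2 / 2).
Proof.
move=> [s H] T; exists (p%:C * s + q%:C * (b ^+ 2 / 2)) => e e0.
pose B := N b; pose K := N s + `|m|; pose D := 2 * B + K + 1.
have B0 : 0 <= B by exact: cnorm_ge0.
have K0 : 0 <= K by rewrite addr_ge0 ?cnorm_ge0.
have D1 : 1 <= D by rewrite /D; lra.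
have D2 : 0 < 3 * D ^+ 2 by apply: mulr_gt0 => //; apply: exprn_gt0; lra.
have p1 : 0 < 3 * (`|p| + 1) by have := normr_ge0 p; lra.
have q1 : 0 < 3 * (`|q| + 1) * D ^+ 2.
  by apply: mulr_gt0; [have := normr_ge0 q; lra|apply: exprn_gt0; lra].
(* The errors of U and of f, and the cubic part of y^2 - Re (b h)^2, get a
   third of e each. *)
pose e1 := Num.min 1 (e / (3 * (`|p| + 1))).
have e10 : 0 < e1 by rewrite lt_min ltr01 divr_gt0.
have [d1 d10 d1P] := H _ e10.
have e20 : 0 < e / (3 * D ^+ 2) by rewrite divr_gt0.
have [d2 d20 d2P] := T _ e20.
pose d := Num.min (Num.min 1 d1) (Num.min (d2 / D) (e / (3 * (`|q| + 1) * D ^+ 2))).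
have Dgt0 : 0 < D by lra.
exists d; first by rewrite !lt_min ltr01 d10 !divr_gt0.
move=> h; rewrite !lt_min => /andP[/andP[h1 /d1P hU] /andP[]].
rewrite !ltr_pdivlMr// => h2 h3.
set t := N h in h1 hU h2 h3 *; have t0 : 0 <= t by exact: cnorm_ge0.
set L := Re (b * h) in hU *; pose y := U (z + h) - c.
have hL : `|L| <= B * t by apply: le_trans (Re_le_cnorm _) _; rewrite cnormM.
have tt : t ^+ 2 <= t by rewrite expr2 ler_piMl// ltW.
have e1le : e1 <= 1 by rewrite ge_min lexx.
have e1le' : `|p| * e1 <= e / 3.
  have : e1 * (3 * (`|p| + 1)) <= e by rewrite -ler_pdivlMr// ge_min lexx orbT.
  have : 0 <= e1 by exact: ltW. have := normr_ge0 p; lra.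
pose Q := Re (s * h ^+ 2) + m * t ^+ 2.
have hQ : `|Q| <= K * t ^+ 2.
  apply: le_trans (ler_normD _ _) _; rewrite mulrDl lerD//.
    by apply: le_trans (Re_le_cnorm _) _; rewrite cnormM cnormX.
  by rewrite normrM normrX (ger0_norm t0).
pose rho := y - L - Q.
have hr : `|rho| <= e1 * t ^+ 2.
  by move: hU; rewrite /rho /y /Q; congr (`|_| <= _); ring.
have t20 : 0 <= t ^+ 2 by rewrite sqr_ge0.
have hyL : `|y - L| <= (K + 1) * t ^+ 2.
  have : `|y - L| <= `|Q| + `|rho|.
    by rewrite (_ : y - L = Q + rho) ?ler_normD// /rho; ring.
  have : e1 * t ^+ 2 <= 1 * t ^+ 2 by rewrite ler_wpM2r.
  lra.
have hy : `|y| <= D * t.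
  have : `|y| <= `|L| + `|y - L| by rewrite {1}(_ : y = L + (y - L)) ?ler_normD//; ring.
  have : (K + 1) * t ^+ 2 <= (K + 1) * t by rewrite ler_wpM2l//; lra.
  have : 0 <= B * t by rewrite mulr_ge0.
  rewrite /D; lra.
have hyL2 : `|y + L| <= D * t.
  have : `|y + L| <= `|L| + `|L| + `|y - L|.
    rewrite {1}(_ : y + L = L + L + (y - L)); last by ring.
    by apply: le_trans (ler_normD _ _) _; rewrite lerD2r ler_normD.
  have : (K + 1) * t ^+ 2 <= (K + 1) * t by rewrite ler_wpM2l//; lra.
  rewrite /D; lra.
have yd2 : `|y| < d2 by apply: le_lt_trans hy _; rewrite mulrC.
have hs := d2P y yd2.
have cy : c + y = U (z + h) by rewrite /y; ring.
rewrite cy in hs.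
have E1 : `|q * (y ^+ 2 - L ^+ 2)| <= e / 3 * t ^+ 2.
  rewrite subr_sqr !normrM.
  have : `|y - L| * `|y + L| <= (D * t ^+ 2) * (D * t).
    apply: ler_pM => //; apply: le_trans hyL _; rewrite ler_wpM2r// /D; lra.
  move=> k1; apply: le_trans (_ : `|q| * (D * t ^+ 2 * (D * t)) <= _).
    by rewrite ler_wpM2l.
  have : (t * (3 * (`|q| + 1) * D ^+ 2)) * t ^+ 2 <= e * t ^+ 2.
    by rewrite ler_wpM2r// ltW.
  have : 0 <= D ^+ 2 * t * t ^+ 2 by apply: mulr_ge0 => //; apply: mulr_ge0 => //; exact: sqr_ge0.
  lra.
have E2 : e / (3 * D ^+ 2) * y ^+ 2 <= e / 3 * t ^+ 2.
  have : y ^+ 2 <= D ^+ 2 * t ^+ 2.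
    by rewrite -exprMn -[y ^+ 2]real_normK ?num_real// ler_pXn2r ?nnegrE// mulr_ge0// ltW.
  move=> k1; apply: le_trans (_ : e / (3 * D ^+ 2) * (D ^+ 2 * t ^+ 2) <= _).
    by rewrite ler_wpM2l// ltW.
  by rewrite le_eqVlt; apply/orP; left; apply/eqP; field; rewrite gt_eqF.
have E3 : `|p * rho| <= e / 3 * t ^+ 2.
  rewrite normrM; apply: le_trans (_ : `|p| * (e1 * t ^+ 2) <= _).
    by rewrite ler_wpM2l.
  by rewrite mulrA ler_wpM2r.
have -> : f (U (z + h)) - (f c + Re (p%:C * b * h) +
   Re ((p%:C * s + q%:C * (b ^+ 2 / 2)) * h ^+ 2) + (p * m + q * N b ^+ 2 / 2) * t ^+ 2)
  = (f (U (z + h)) - (f c + p * y + q * y ^+ 2)) + p * rho + q * (y ^+ 2 - L ^+ 2).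
  rewrite mulrDl [Re (_ + _)]raddfD /= -(mulrA p%:C b) -(mulrA p%:C s) -(mulrA q%:C) !Re_realM.
  rewrite [L ^+ 2]Re_mul_sqr /rho /Q -/t -/L; ring.
apply: le_trans (ler_normD _ _) _.
have := ler_normD (f (U (z + h)) - (f c + p * y + q * y ^+ 2)) (p * rho).
lra.
Qed.

Lemma taylor2_affine u v c : taylor2 (fun x => u + v * x) c v 0.
Proof.
move=> e e0; exists 1 => // y _.
rewrite /= (_ : _ - _ = 0); last by ring.
by rewrite normr0 mulr_ge0 ?sqr_ge0// ltW.
Qed.

Lemma taylor2_sqr c : taylor2 (fun x => x ^+ 2) c (2 * c) 1.
Proof.
move=> e e0; exists 1 => // y _.
rewrite /= (_ : _ - _ = 0); last by ring.
by rewrite normr0 mulr_ge0 ?sqr_ge0// ltW.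
Qed.

(** The average over h, ih, -h, -ih kills both the linear forms and the real
    parts of quadratic forms. *)
Lemma jet_max U z c b m (d : R) : jet U z c b m -> 0 < d ->
  (forall h, N h < d -> U (z + h) <= U z) -> m <= 0.
Proof.
move=> J d0 Umax; have Uz := jet_base J; case: J => q H.
apply: ler_all_eps => e e0; rewrite add0r.
have [d' d'0 dP] := H e e0.
pose t := Num.min d d' / 2.
have m0 : 0 < Num.min d d' by rewrite lt_min d0.
have t0 : 0 < t by rewrite /t; lra.
have t1 : t < Num.min d d' by rewrite /t; lra.
move: t1; rewrite lt_min => /andP[t1 t2].
have key h : N h = t -> c + Re (b * h) + Re (q * h ^+ 2) + m * t ^+ 2 <= c + e * t ^+ 2.
  move=> ht; have := dP h; rewrite ht => /(_ t2); have := Umax h; rewrite ht => /(_ t1).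
  by rewrite Uz ler_norml; lra.
have n1 : N t%:C = t by rewrite cnorm_real gtr0_norm.
have k1 := key _ n1.
have k2 := key (- t%:C); rewrite cnormN in k2; have {}k2 := k2 n1.
have k3 := key ('i%C * t%:C); rewrite cnormM cnorm_i mul1r in k3; have {}k3 := k3 n1.
have k4 := key (- ('i%C * t%:C)); rewrite cnormN cnormM cnorm_i mul1r in k4; have {}k4 := k4 n1.
rewrite -(@ler_pM2r _ (t ^+ 2)) ?exprn_gt0//.
rewrite sqrrN mulrN raddfN /= in k2.
rewrite exprMn sqr_i mulN1r mulrN raddfN /= in k3.
rewrite sqrrN exprMn sqr_i mulN1r !mulrN !raddfN /= in k4.
lra.
Qed.

(** The remainder has derivative f' x - f' c - q (x - c), which is o(x - c),
    and the mean value theorem applies. *)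
Lemma taylor2_derive (f f' : R -> R) c q r : 0 < r ->
  (forall x, `|x - c| < r -> is_derive x 1 f (f' x)) -> is_derive c 1 f' q ->
  taylor2 f c (f' c) (q / 2).
Proof.
move=> r0 ff' f'q e e0.
have [d d0 dP] : exists2 d : R, 0 < d & forall y, `|y| < d ->
    `|f' (c + y) - f' c - q * y| <= e * `|y|.
  have [df <-] := f'q.
  have fd : h^-1 *: (f' (h *: (1 : R^o) + c) - f' c) @[h --> (0 : R^o)^'] --> 'D_1 f' c by exact: df.
  have := (@cvgrPdist_le _ _ _ _ (dnbhs_filter _) _ _).1 fd _ e0.
  move=> /nbhs_ballP[d /= d0 dP]; exists d => // y yd.
  have [->|y0] := eqVneq y 0; first by rewrite addr0 subrr mulr0 subrr !normr0 mulr0.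
  have := dP y; rewrite /ball /= sub0r normrN => /(_ yd y0).
  rewrite distrC -(ler_pM2r (_ : 0 < `|y|)) ?normr_gt0// -normrM; apply: le_trans.
  rewrite le_eqVlt; apply/orP; left; apply/eqP; congr `|_|.
  by rewrite /GRing.scale /= mulr1 mulrBl mulrAC mulVf// mul1r (addrC c).
exists (Num.min d r) => [|y]; first by rewrite lt_min d0.
rewrite lt_min => /andP[yd yr].
pose g x := f x - (f c + f' c * (x - c) + q / 2 * (x - c) ^+ 2).
have gd x : `|x - c| < r -> is_derive x 1 g (f' x - (f' c + q * (x - c))).
  move=> /ff' fx; apply: is_derive_eq.
  by rewrite /GRing.scale /= /GRing.scale /=; field.
have gc u : `|u - c| < r -> {for u, continuous g}.
  by move=> /gd[+ _] => /derivable1_diffP/differentiable_continuous.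
have gc0 : g c = 0 by rewrite /g; ring.
have gy : g (c + y) = f (c + y) - (f c + f' c * y + q / 2 * y ^+ 2).
  by rewrite /g (addrC c) addrK.
rewrite -gy.
have bnd s : `|s| <= `|y| -> `|f' (c + s) - (f' c + q * (c + s - c))| * `|y| <= e * y ^+ 2.
  move=> sy; have h1 := dP s (le_lt_trans sy yd).
  rewrite -[y ^+ 2]real_normK ?num_real// expr2 mulrA ler_wpM2r//.
  rewrite (_ : _ - _ = f' (c + s) - f' c - q * s); last by ring.
  by apply: le_trans h1 _; rewrite ler_wpM2l// ltW.
have [y0|y0|y0] := ltgtP 0 y; last first.
- by rewrite -y0 addr0 gc0 normr0 expr0n mulr0.
- have cy : c + y <= c by rewrite gerDl ltW.
  have [x xI||x] := @MVT_segment R g (fun x => f' x - (f' c + q * (x - c))) (c + y) c cy.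
  + apply: gd; move: xI yr; rewrite in_itv /= (ltr0_norm y0) => /andP[x1 x2] yr.
    by rewrite ltr_norml; lra.
  + apply: continuous_in_subspaceT => x; rewrite inE /= in_itv /= => /andP[x1 x2].
    by apply: gc; move: yr; rewrite (ltr0_norm y0) ltr_norml; lra.
  + rewrite in_itv /= => /andP[x1 x2]; rewrite gc0 sub0r (_ : c - (c + y) = - y); last by ring.
    move=> gE.
    rewrite -normrN gE normrM normrN.
    have := bnd (x - c); rewrite (addrC c) subrK; apply.
    by rewrite (ltr0_norm y0) ler_norml; lra.
- have cy : c <= c + y by rewrite lerDl ltW.
  have [x xI||x] := @MVT_segment R g (fun x => f' x - (f' c + q * (x - c))) c (c + y) cy.
  + apply: gd; move: xI yr; rewrite in_itv /= (gtr0_norm y0) => /andP[x1 x2] yr.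
    by rewrite ltr_norml; lra.
  + apply: continuous_in_subspaceT => x; rewrite inE /= in_itv /= => /andP[x1 x2].
    by apply: gc; move: yr; rewrite (gtr0_norm y0) ltr_norml; lra.
  + rewrite in_itv /= => /andP[x1 x2]; rewrite gc0 subr0 (_ : c + y - c = y); last by ring.
    move=> gE.
    rewrite gE normrM.
    have := bnd (x - c); rewrite (addrC c) subrK; apply.
    by rewrite (gtr0_norm y0) ler_norml; lra.
Qed.

Lemma taylor2_expR c : taylor2 expR c (expR c) (expR c / 2).
Proof. by apply: (@taylor2_derive _ expR _ _ 1) => // x _; exact: is_derive_expR. Qed.

Lemma taylor2_ln c : 0 < c -> taylor2 (@ln R) c c^-1 (- c ^- 2 / 2).
Proof.
move=> c0; apply: (@taylor2_derive _ (fun x => x^-1) _ _ c) => // [x|].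
  by rewrite ltr_norml => /andP[h1 h2]; apply: is_derive1_ln; lra.
have c0' : c != 0 by rewrite gt_eqF.
have h := is_deriveV (f := fun x : R => x) c0' (is_derive_id c 1).
by apply: is_derive_eq; rewrite /GRing.scale /= mulr1.
Qed.

End Jets.

(** * Jets of logarithms, and maxima on a square *)

Section HyperbolicMetric.
Variable R : realType.
Local Notation C := R[i].
Local Notation N := (@Normc.normc R).
Local Notation Re := (@complex.Re R).
Local Notation Im := (@complex.Im R).
Local Notation "x %:C" := (real_complex R x).
Implicit Types (f g : C -> C) (U V : C -> R) (a z w b h : C) (r s t x e : R).

Lemma jet_Re f a r : 0 < r -> holo f a r ->
  jet (fun z => Re (f z)) a (Re (f a)) (cderiv f a) 0.
Proof.
move=> r0 fr; have [q H] := holo_taylor2 r0 fr; exists q => e e0.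
have [d d0 dP] := H e e0; exists d => // h /dP; apply: le_trans.
by rewrite mul0r addr0 -!raddfD -raddfB /=; exact: Re_le_cnorm.
Qed.

Lemma jet_Im f a r : 0 < r -> holo f a r ->
  jet (fun z => Im (f z)) a (Im (f a)) (- 'i%C * cderiv f a) 0.
Proof.
have E z : Im z = Re (- 'i%C * z) by case: z => x y /=; ring.
move=> r0 fr; have [q H] := holo_taylor2 r0 fr; exists (- 'i%C * q) => e e0.
have [d d0 dP] := H e e0; exists d => // h /dP; apply: le_trans.
rewrite mul0r addr0 !E -!mulrA -!E -!raddfD -raddfB /=; exact: Im_le_cnorm.
Qed.

(** The real and imaginary parts of f are harmonic, hence have m = 0, and
    |f|^2 is the sum of their squares. *)
Lemma jet_normsq f a r : 0 < r -> holo f a r ->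
  exists b, N b ^+ 2 = 4 * N (f a) ^+ 2 * N (cderiv f a) ^+ 2 /\
    jet (fun z => N (f z) ^+ 2) a (N (f a) ^+ 2) b (N (cderiv f a) ^+ 2).
Proof.
move=> r0 fr.
have J1 := jet_comp (jet_Re r0 fr) (taylor2_sqr _).
have J2 := jet_comp (jet_Im r0 fr) (taylor2_sqr _).
have J := jetD J1 J2.
set b := (X in jet _ _ _ X _) in J; exists b; split; last first.
  have -> : (fun z => N (f z) ^+ 2) = (fun z => Re (f z) ^+ 2 + Im (f z) ^+ 2).
    by apply/funext => z; rewrite cnorm_sqr.
  rewrite cnorm_sqr; move: J; congr (jet _ _ _ _ _).
  by rewrite cnormM cnormN cnorm_i; field.
rewrite /b !cnorm_sqr; case: (f a) (cderiv f a) => x y [u v] /=; ring.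
Qed.

(** The logarithm of the modulus of a holomorphic function without zeros is
    harmonic. *)
Lemma jet_ln_norm f a r : 0 < r -> holo f a r -> f a != 0 ->
  exists b, N b ^+ 2 = 4 * N (cderiv f a) ^+ 2 / N (f a) ^+ 2 /\
    jet (fun z => ln (N (f z) ^+ 2)) a (ln (N (f a) ^+ 2)) b 0.
Proof.
move=> r0 fr fa0; have [b [bE J]] := jet_normsq r0 fr.
have n0 : 0 < N (f a) ^+ 2 by rewrite exprn_gt0// cnorm_gt0.
have n0' : N (f a) != 0 by rewrite cnorm_eq0.
have := jet_comp J (taylor2_ln n0) => J'.
exists ((N (f a) ^+ 2)^-1%:C * b); split.
  rewrite cnormM exprMn bE cnorm_real ger0_norm ?invr_ge0 ?sqr_ge0//; field.
  by [].
move: J'; congr (jet _ _ _ _ _).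
by rewrite bE; field.
Qed.

(** For U = ln |f|^2 the inner exponential is |f|^(1/4). This term is the one
    that produces negative curvature, the logarithm of the rest of the metric
    being harmonic. *)
Lemma jet_ln_1p_root U a c b : jet U a c b 0 ->
  let s := expR (c / 8) in exists b',
  jet (fun z => ln (1 + expR (U z / 8))) a (ln (1 + s)) b' (s * N b ^+ 2 / (256 * (1 + s) ^+ 2)).
Proof.
move=> J s; have s0 : 0 < s by exact: expR_gt0.
have J1 := jet_comp J (taylor2_affine 0 (1 / 8) c).
have J2 := jet_comp J1 (taylor2_expR _).
have J3 := jet_comp J2 (taylor2_affine 1 1 _).
have s1 : 0 < 1 + s by lra.
have E1 : 0 + 1 / 8 * c = c / 8 by field.
rewrite E1 -/s in J3.
have := J3; have E2 : 1 + 1 * s = 1 + s by ring.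
rewrite E2 => J4.
have J5 := jet_comp J4 (taylor2_ln s1).
eexists; move: J5; congr (jet _ _ _ _ _).
  by apply/funext => z; congr (ln (_ + _)); rewrite mul1r; congr expR; field.
rewrite !cnormM !cnorm_real normr1 exprMn exprMn (ger0_norm (ltW s0)).
rewrite exprMn exprMn (ger0_norm (_ : 0 <= 1 / 8)); last by lra.
field; rewrite gt_eqF//.
Qed.

(** The Poincare metric of the disc of radius r is 2 r / (r^2 - |w - a|^2)
    |dw|; the coefficient of |h|^2 found here expresses that its curvature is
    -1. *)
Lemma jet_defect a z r : N (z - a) < r -> exists b,
  jet (fun w => ln (r ^+ 2 - N (w - a) ^+ 2)) z (ln (r ^+ 2 - N (z - a) ^+ 2)) b
     (- (r ^+ 2 / (r ^+ 2 - N (z - a) ^+ 2) ^+ 2)).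
Proof.
move=> zr; have c0 : 0 < r ^+ 2 - N (z - a) ^+ 2.
  by rewrite subr_gt0 ltr_pXn2r ?nnegrE ?cnorm_ge0// (le_trans (cnorm_ge0 (z - a)))// ltW.
have dw w : cdiff (fun w => w - a) w (1 - 0).
  by apply: cdiffB; [exact: cdiff_id|exact: cdiff_cst].
have hw : holo (fun w => w - a) z 1 by move=> w _; exists (1 - 0).
have [b [bE J]] := jet_normsq ltr01 hw.
rewrite (cderivE (dw z)) subr0 cnorm1 in bE J.
have J1 := jet_comp J (taylor2_affine (r ^+ 2) (- 1) _).
rewrite mulN1r in J1.
have J2 := jet_comp J1 (taylor2_ln c0).
eexists; move: J2; congr (jet _ _ _ _ _).
  by apply/funext => w; rewrite mulN1r.
rewrite cnormM cnorm_real normrN normr1 mul1r bE; field.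
by rewrite gt_eqF.
Qed.

(** By bisection, a locally bounded function is bounded; if U did not attain
    its supremum, this would apply to 1 / (sup U - U). *)
Lemma usc_max (U : C -> R) x y s : 0 < s ->
  (forall p, in_square x y s p -> forall e, 0 < e -> exists2 d : R, 0 < d &
     forall z, N (z - p) < d -> U z <= U p + e) ->
  exists2 p, in_square x y s p & forall z, in_square x y s z -> U z <= U p.
Proof.
move=> s0 usc.
have bounded (V : C -> R) : (forall p, in_square x y s p -> exists2 d : R, 0 < d &
     exists M, forall z, in_square x y s z -> N (z - p) < d -> V z <= M) ->
    exists M, forall z, in_square x y s z -> V z <= M.
  move=> Vloc.
  have [M MP] : exists M, forall z, in_square x y s z -> in_square x y s z -> V z <= M.
    apply: (@square_induction R (fun x' y' s' => exists M, forall z,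
        in_square x' y' s' z -> in_square x y s z -> V z <= M)) => //.
      move=> x' y' s' s'0 [M1 h1] [M2 h2] [M3 h3] [M4 h4].
      exists (Num.max (Num.max M1 M2) (Num.max M3 M4)) => z [z1 z2] zz.
      rewrite !le_max.
      have [zx|zx] := leP (Re z) (x' + s' / 2); have [zy|zy] := leP (Im z) (y' + s' / 2).
      - by rewrite h1 //; split; lra.
      - by rewrite h3 ?orbT //; split; lra.
      - by rewrite h2 ?orbT //; split; lra.
      - by rewrite h4 ?orbT //; split; lra.
    move=> p q p01 q01; have sq : in_square x y s (Complex p q) by [].
    have [d d0 [M MP]] := Vloc _ sq; exists (d / 2); first lra.
    move=> x' y' s' s'0 s'd _ _ _ _ px qy; exists M => z zs zz; apply: MP => //.
    have pq : in_square x' y' s' (Complex p q) by [].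
    by have := in_square_dist pq zs; lra.
  by exists M => z zz; exact: MP.
have [M MP] : exists M, forall z, in_square x y s z -> U z <= M.
  apply: bounded => p /usc /(_ 1 ltr01)[d d0 dP]; exists d => //.
  by exists (U p + 1) => z _; exact: dP.
pose A := [set U z | z in in_square x y s].
have A0 : A !=set0.
  by exists (U (Complex x y)), (Complex x y) => //; split => /=; lra.
have Aub : has_ubound A by exists M => _ [z zs <-]; exact: MP.
apply: contrapT => nmax.
have lt z : in_square x y s z -> U z < sup A.
  move=> zs; rewrite lt_neqAle; apply/andP; split; last first.
    by apply: ub_le_sup => //; exists z.
  apply/negP => /eqP E; apply: nmax; exists z => // w ws; rewrite E.
  by apply: ub_le_sup => //; exists w.
have [M' M'P] : exists M', forall z, in_square x y s z -> (sup A - U z)^-1 <= M'.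
  apply: bounded => p ps; have lp := lt p ps.
  have e0 : 0 < (sup A - U p) / 2 by lra.
  have [d d0 dP] := usc p ps _ e0; exists d => //.
  exists (((sup A - U p) / 2)^-1) => z zs zd.
  have := dP z zd; have := lt z zs => h1 h2; rewrite lef_pV2 ?posrE; lra.
have M'0 : 0 < M'.
  have ps : in_square x y s (Complex x y) by split => /=; lra.
  by apply: lt_le_trans (M'P _ ps); rewrite invr_gt0 subr_gt0 lt.
have : sup A <= sup A - M'^-1.
  apply: ge_sup => // _ [z zs <-].
  have := M'P z zs; have h := lt z zs.
  rewrite -[X in _ <= X -> _]invrK lef_pV2 ?posrE ?invr_gt0//; lra.
have : 0 < M'^-1 by rewrite invr_gt0.
lra.
Qed.

End HyperbolicMetric.

(** * A negatively curved metric on the plane minus two points *)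

Section Ahlfors.
Variable R : realType.
Local Notation C := R[i].
Local Notation N := (@Normc.normc R).
Implicit Types (f g : C -> C) (U V : C -> R) (a p z w b h : C) (r s t x y e : R).

(** Continuity of real functions of a complex variable, with the same
    convention as ccont. *)
Definition rcont U p := forall e, 0 < e -> exists2 d : R, 0 < d &
  forall z, N (z - p) < d -> `|U z - U p| <= e.

Lemma rcontP (U : C^o -> R) (p : C^o) : rcont U p <-> U @ p --> U p.
Proof.
split=> [Up|Up e e0].
  apply: (@cvgrPdist_le _ _ _ _ (nbhs_filter p) _ _).2 => e e0.
  have [d d0 dP] := Up _ e0.
  by apply/nbhs_normcP; exists d => // z /dP; rewrite distrC.
have /nbhs_normcP[d d0 dP] := (@cvgrPdist_le _ _ _ _ (nbhs_filter p) _ _).1 Up _ e0.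
by exists d => // z /dP; rewrite distrC.
Qed.

Lemma rcont_cst x p : rcont (fun=> x) p.
Proof. by move=> e e0; exists 1 => // z _; rewrite subrr normr0 ltW. Qed.

Lemma rcontD U V p : rcont U p -> rcont V p -> rcont (fun z => U z + V z) p.
Proof. by move=> /rcontP fa /rcontP ga; apply/rcontP; exact: (cvgD fa ga). Qed.

Lemma rcontM U V p : rcont U p -> rcont V p -> rcont (fun z => U z * V z) p.
Proof. by move=> /rcontP fa /rcontP ga; apply/rcontP; exact: (cvgM fa ga). Qed.

Lemma rcontX U n p : rcont U p -> rcont (fun z => U z ^+ n) p.
Proof.
move=> Up; elim: n => [|n IH]; first exact: rcont_cst.
by under [X in rcont X]eq_fun do rewrite exprS; exact: rcontM.
Qed.

Lemma rcont_comp U (f : R -> R) p : rcont U p -> {for U p, continuous f} ->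
  rcont (fun z => f (U z)) p.
Proof.
move=> Up fU e e0.
have /nbhs_ballP[d /= d0 dP] := (@cvgrPdist_le _ _ _ _ (nbhs_filter _) _ _).1 fU _ e0.
have d2 : 0 < d / 2 by rewrite divr_gt0.
have [d1 d10 d1P] := Up _ d2; exists d1 => // z /d1P zd.
rewrite distrC; apply: dP; rewrite /ball /= distrC; apply: le_lt_trans zd _; lra.
Qed.

Lemma rcont_N f p : ccont f p -> rcont (fun z => N (f z)) p.
Proof.
move=> fp e /fp[d d0 dP]; exists d => // z /dP H.
have := cnorm_le_add_dist (f z) (f p); have := cnorm_le_add_dist (f p) (f z);
  rewrite (cnorm_distC (f p)) ler_norml; lra.
Qed.

(** The power |w|^(1/4), written so that its logarithm is visibly harmonic. *)
Definition root4 w : R := expR (ln (N w ^+ 2) / 8).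

Lemma root4_gt0 w : 0 < root4 w. Proof. exact: expR_gt0. Qed.

Lemma root4_X8 w : w != 0 -> root4 w ^+ 8 = N w ^+ 2.
Proof.
move=> w0; rewrite -expRM_natl /root4 (_ : _ * _ = ln (N w ^+ 2)); last by field.
by rewrite lnK // posrE exprn_gt0 // cnorm_gt0.
Qed.

Lemma root4_X4 w : w != 0 -> root4 w ^+ 4 = N w.
Proof.
move=> w0; apply/eqP; rewrite -(@eqrXn2 _ 2) ?cnorm_ge0//;
  last by rewrite exprn_ge0// ltW// root4_gt0.
by rewrite -exprM (root4_X8 w0).
Qed.

Lemma rcont_root4 f p : f p != 0 -> ccont f p -> rcont (fun z => root4 (f z)) p.
Proof.
move=> fp0 fp; apply: (rcont_comp (f := expR)); last exact: continuous_expR.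
apply: rcontM; last exact: rcont_cst.
apply: (rcont_comp (f := @ln R)); first by apply: rcontX; exact: rcont_N.
by apply: continuous_ln; rewrite exprn_gt0// cnorm_gt0.
Qed.

(** For s^4 = |w| and t^4 = |w - 1|, this says that the curvature of the
    metric is bounded above by a negative constant. The larger of s and t is
    at least 1 / 2, so that its ninth power, on the right, dominates the left
    hand side of degree 8. *)
Lemma curvature_ineq s t : 0 < s -> 0 < t -> 1 <= s ^+ 4 + t ^+ 4 ->
  (1 + s) ^+ 4 * (1 + t) ^+ 4 <= 2 * 3 ^+ 8 * (t ^+ 7 * (1 + t) ^+ 2 + s ^+ 7 * (1 + s) ^+ 2).
Proof.
move=> s0 t0 st1.
have main x y : 0 < x -> 0 < y -> y <= x -> 1 <= x ^+ 4 + y ^+ 4 ->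
    (1 + x) ^+ 4 * (1 + y) ^+ 4 <= 2 * 3 ^+ 8 * (y ^+ 7 * (1 + y) ^+ 2 + x ^+ 7 * (1 + x) ^+ 2).
  move=> x0 y0 yx xy1.
  have x12 : 1 / 2 <= x.
    rewrite leNgt; apply/negP => xlt.
    have h1 : x ^+ 4 < (1 / 2) ^+ 4 by rewrite ltrXn2r // ltW.
    have h2 : y ^+ 4 <= x ^+ 4 by rewrite ler_pXn2r ?nnegrE // ltW.
    have : (1 / 2 : R) ^+ 4 <= 1 / 2 by rewrite !exprS expr0; lra.
    lra.
  have h1 : (1 + y) ^+ 4 <= (1 + x) ^+ 4 by rewrite ler_pXn2r ?nnegrE//; lra.
  have h2 : (1 + x) ^+ 4 <= (3 * x) ^+ 4 by rewrite ler_pXn2r ?nnegrE//; lra.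
  have p1 : 0 <= (1 + y) ^+ 4 by rewrite exprn_ge0; lra.
  have p2 : 0 <= (1 + x) ^+ 4 by rewrite exprn_ge0; lra.
  have h3 : (1 + x) ^+ 4 * (1 + y) ^+ 4 <= (3 * x) ^+ 4 * (3 * x) ^+ 4.
    by apply: ler_pM => //; exact: le_trans h2.
  apply: le_trans h3 _.
  have -> : (3 * x) ^+ 4 * (3 * x) ^+ 4 = 3 ^+ 8 * x ^+ 8 by ring.
  rewrite -[leRHS]mulrA [leRHS]mulrCA ler_wpM2l ?exprn_ge0//.
  have q1 : 0 <= y ^+ 7 * (1 + y) ^+ 2.
    by apply: mulr_ge0; apply: exprn_ge0; lra.
  have q2 : x ^+ 7 * (x / 2) <= x ^+ 7 * (1 + x) ^+ 2.
    rewrite ler_wpM2l ?exprn_ge0//; first exact: ltW.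
    have : 0 <= x ^+ 2 by exact: sqr_ge0.
    lra.
  have -> : x ^+ 8 = 2 * (x ^+ 7 * (x / 2)) by field.
  lra.
have [le_ts|/ltW le_st] := leP t s; first exact: main.
by rewrite mulrC [X in _ <= _ * X]addrC; apply: main => //; rewrite addrC.
Qed.

(** The triangle inequalities between w, w - 1 and 1. *)
Lemma root4_ineq w : w != 0 -> w != 1 ->
  let s := root4 w in let t := root4 (w - 1) in
  t ^+ 4 <= s ^+ 4 + 1 /\ 1 <= s ^+ 4 + t ^+ 4.
Proof.
move=> w0 w1 s t; rewrite /s /t !root4_X4 ?subr_eq0//.
have := cnormB_le w 1; have := cnorm_le_add_dist 1 w; rewrite (cnorm_distC 1) cnorm1.
by move=> h1 h2; split; lra.
Qed.

(** The metric dominates the spherical metric, up to a constant: at infinity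
    its density decreases like |w|^(-5/4), which is slower than |w|^(-2). *)
Lemma density2_growth s t : 0 < s -> 0 < t -> t ^+ 4 <= s ^+ 4 + 1 ->
  s ^+ 7 * t ^+ 7 <= (2 ^+ 7 * (1 + s ^+ 8)) ^+ 2 * ((1 + s) ^+ 2 * (1 + t) ^+ 2).
Proof.
move=> s0 t0 ts.
have t1 : t <= 1 + s.
  rewrite -(@ler_pXn2r _ 4) ?nnegrE//; [|exact: ltW|lra].
  apply: le_trans ts _.
  have : 0 <= s ^+ 3 by apply: exprn_ge0; exact: ltW.
  have : 0 <= s ^+ 2 by exact: sqr_ge0.
  by have -> : (1 + s) ^+ 4 = s ^+ 4 + 1 + (4 * s ^+ 3 + 6 * s ^+ 2 + 4 * s); [ring|lra].
have sq (x : R) : (1 + x) ^+ 2 <= 2 * (1 + x ^+ 2) by have := sqr_ge0 (1 - x); lra.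
have s8 : (1 + s) ^+ 8 <= 2 ^+ 7 * (1 + s ^+ 8).
  have k1 : ((1 + s) ^+ 2) ^+ 4 <= (2 * (1 + s ^+ 2)) ^+ 4.
    by rewrite ler_pXn2r ?nnegrE ?sqr_ge0// mulr_ge0// addr_ge0// sqr_ge0.
  have k2 : ((1 + s ^+ 2) ^+ 2) ^+ 2 <= (2 * (1 + (s ^+ 2) ^+ 2)) ^+ 2.
    by rewrite ler_pXn2r ?nnegrE ?sqr_ge0// mulr_ge0// addr_ge0// sqr_ge0.
  have k3 := sq (s ^+ 4).
  lra.
have s1 : s <= 1 + s by lra.
have p7 : s ^+ 5 * t ^+ 5 <= (1 + s) ^+ 5 * (1 + s) ^+ 5.
  by apply: ler_pM; rewrite ?exprn_ge0 ?ler_pXn2r ?nnegrE//; lra.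
have p8 : (1 + s) ^+ 5 * (1 + s) ^+ 5 <= ((1 + s) ^+ 8) ^+ 2.
  by rewrite -exprD -exprM ler_weXn2l//; lra.
have p9 : ((1 + s) ^+ 8) ^+ 2 <= (2 ^+ 7 * (1 + s ^+ 8)) ^+ 2.
  rewrite ler_pXn2r ?nnegrE// ?(le_trans _ s8)//; apply: exprn_ge0; lra.
have -> : s ^+ 7 * t ^+ 7 = (s ^+ 5 * t ^+ 5) * (s ^+ 2 * t ^+ 2) by ring.
apply: ler_pM.
- by rewrite mulr_ge0// exprn_ge0// ltW.
- by rewrite mulr_ge0// exprn_ge0// ltW.
- exact: le_trans (le_trans p7 p8) p9.
- apply: ler_pM; rewrite ?sqr_ge0// ler_pXn2r ?nnegrE//; lra.
Qed.

End Ahlfors.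

(** * The maximum principle for the metric *)

Section AhlforsSchwarz.
Variable R : realType.
Local Notation C := R[i].
Local Notation N := (@Normc.normc R).
Implicit Types (f g : C -> C) (U V : C -> R) (a p z w b h : C) (r s t x y e : R).

(** The square of the density of a metric on the plane minus 0 and 1. Its
    singularities at 0, 1 and infinity are conical, with total angles pi / 4,
    pi / 4 and pi / 2, small enough for negative curvature to be compatible
    with the Gauss-Bonnet formula. *)
Definition density2 w : R :=
  (1 + root4 w) ^+ 2 * (1 + root4 (w - 1)) ^+ 2 / (root4 w ^+ 7 * root4 (w - 1) ^+ 7).

Lemma density2_gt0 w : 0 < density2 w.
Proof.
have h1 := root4_gt0 w; have h2 := root4_gt0 (w - 1).
by apply: divr_gt0; apply: mulr_gt0; apply: exprn_gt0; lra.
Qed.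

Lemma ln_root4 w : ln (root4 w) = ln (N w ^+ 2) / 8.
Proof. by rewrite expRK. Qed.

Lemma lnXnE n x : 0 < x -> ln (x ^+ n) = n%:R * ln x.
Proof. by move=> x0; rewrite lnXn// mulr_natl. Qed.

Lemma ln_density2 w : ln (density2 w) =
  2 * ln (1 + root4 w) + 2 * ln (1 + root4 (w - 1))
  - 7 / 8 * ln (N w ^+ 2) - 7 / 8 * ln (N (w - 1) ^+ 2).
Proof.
have h1 := root4_gt0 w; have h2 := root4_gt0 (w - 1).
have p1 : 0 < 1 + root4 w by lra.
have p2 : 0 < 1 + root4 (w - 1) by lra.
have E (x y s t : R) : 0 < x -> 0 < y -> 0 < s -> 0 < t ->
    ln (x ^+ 2 * y ^+ 2 / (s ^+ 7 * t ^+ 7)) = 2 * ln x + 2 * ln y - 7 * ln s - 7 * ln t.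
  move=> x0 y0 s0 t0.
  have x2 := exprn_gt0 2 x0; have y2 := exprn_gt0 2 y0.
  have s7 := exprn_gt0 7 s0; have t7 := exprn_gt0 7 t0.
  rewrite ln_div ?posrE ?(mulr_gt0 x2) ?(mulr_gt0 s7)// (lnM x2)// (lnM s7)//.
  by rewrite !lnXnE//; ring.
by rewrite /density2 E// !ln_root4; field.
Qed.

(** The logarithm of the ratio of the pulled back metric to the Poincare
    metric has a nonpositive coefficient of |h|^2 at a maximum. In this
    coefficient only the terms ln (1 + |f|^(1/4)), ln (1 + |f - 1|^(1/4)) and
    ln (r^2 - |w - a|^2) contribute; curvature_ineq turns the resulting
    inequality into a bound. *)
Lemma ahlfors_at_max f a r z d : 0 < r -> N (z - a) < r -> 0 < d ->
  holo f z d -> f z != 0 -> f z != 1 -> cderiv f z != 0 ->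
  (forall w, N (w - z) < d -> cderiv f w != 0 -> f w != 0 -> f w != 1 -> N (w - a) < r ->
    N (cderiv f w) ^+ 2 * density2 (f w) * (r ^+ 2 - N (w - a) ^+ 2) ^+ 2 <=
    N (cderiv f z) ^+ 2 * density2 (f z) * (r ^+ 2 - N (z - a) ^+ 2) ^+ 2) ->
  N (cderiv f z) ^+ 2 * density2 (f z) * (r ^+ 2 - N (z - a) ^+ 2) ^+ 2 <=
    128 * 3 ^+ 8 * r ^+ 2.
Proof.
move=> r0 zr d0 fh fz0 fz1 f'z0 zmax.
have f1h : holo (fun w => f w - 1) z d.
  by move=> w /fh[l fl]; exists (l - 0); apply: cdiffB => //; exact: cdiff_cst.
have zz : N (z - z) < d by rewrite subrr cnorm0.
have f1' : cderiv (fun w => f w - 1) z = cderiv f z.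
  rewrite -[RHS]subr0; apply: cderivE; apply: cdiffB; last exact: cdiff_cst.
  by apply: cderivP; exact: fh.
have fz1' : f z - 1 != 0 by rewrite subr_eq0.
have [b0 [_ J0]] := jet_ln_norm d0 (cderiv_holo d0 fh) f'z0.
have [b1 [b1E J1]] := jet_ln_norm d0 fh fz0.
have [b2 [b2E J2]] := jet_ln_norm d0 f1h fz1'.
rewrite f1' in b2E.
have [b1' K1] := jet_ln_1p_root J1; have [b2' K2] := jet_ln_1p_root J2.
rewrite b1E in K1; rewrite b2E in K2.
have [b3 J3] := jet_defect zr.
pose c := r ^+ 2 - N (z - a) ^+ 2.
have defect_gt0 w : N (w - a) < r -> 0 < r ^+ 2 - N (w - a) ^+ 2.
  by move=> wr; rewrite subr_gt0 ltr_pXn2r ?nnegrE ?cnorm_ge0// ltW.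
have c0 : 0 < c by exact: defect_gt0.
have prod_gt0 w : cderiv f w != 0 -> N (w - a) < r ->
    0 < N (cderiv f w) ^+ 2 * density2 (f w) * (r ^+ 2 - N (w - a) ^+ 2) ^+ 2.
  move=> f'w wr; apply: mulr_gt0; last by apply: exprn_gt0; exact: defect_gt0.
  by apply: mulr_gt0; [apply: exprn_gt0; rewrite cnorm_gt0|exact: density2_gt0].
(* Scaling by constants, applied to the terms of the logarithm of the ratio. *)
have two U m b c' : jet U z c' b m -> exists b'', jet (fun w => 2 * U w) z (2 * c') b'' (2 * m).
  move=> J; have := jet_comp J (taylor2_affine 0 2 _) => J'.
  eexists; move: J'; congr (jet _ _ _ _ _); first by apply/funext => w; ring.
    ring.
  by ring.
have seven U b c' : jet U z c' b 0 -> exists b'',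
  jet (fun w => - (7 / 8) * U w) z (- (7 / 8) * c') b'' 0.
  move=> J; have := jet_comp J (taylor2_affine 0 (- (7 / 8)) _) => J'.
  eexists; move: J'; congr (jet _ _ _ _ _); first by apply/funext => w; ring.
    ring.
  by ring.
have [b4 L1] := two _ _ _ _ K1; have [b5 L2] := two _ _ _ _ K2.
have [b6 L3] := two _ _ _ _ J3.
have [b7 M1] := seven _ _ _ J1; have [b8 M2] := seven _ _ _ J2.
have J := jetD (jetD J0 (jetD (jetD L1 L2) (jetD M1 M2))) L3.
have s0 := root4_gt0 (f z); have t0 := root4_gt0 (f z - 1).
have [_ st1] := root4_ineq fz0 fz1.
have logE w : cderiv f w != 0 -> N (w - a) < r ->
    ln (N (cderiv f w) ^+ 2 * density2 (f w) * (r ^+ 2 - N (w - a) ^+ 2) ^+ 2) =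
    ln (N (cderiv f w) ^+ 2) + (2 * ln (1 + root4 (f w)) + 2 * ln (1 + root4 (f w - 1))
     + (- (7 / 8) * ln (N (f w) ^+ 2) + - (7 / 8) * ln (N (f w - 1) ^+ 2)))
     + 2 * ln (r ^+ 2 - N (w - a) ^+ 2).
  move=> f'w wr; have h0 := defect_gt0 w wr.
  have h1 : 0 < N (cderiv f w) ^+ 2 by rewrite exprn_gt0// cnorm_gt0.
  have h2 := density2_gt0 (f w).
  have h3 := mulr_gt0 h1 h2; have h4 := exprn_gt0 2 h0.
  rewrite (lnM h3 h4) (lnM h1 h2) ln_density2.
  by rewrite (lnXnE 2 h0); ring.
have cf := cdiff_cont (cderivP (fh z zz)).
have [r1 r10 r1P] : exists2 r1 : R, 0 < r1 & forall w, N (w - z) < r1 ->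
    [/\ cderiv f w != 0, f w != 0, f w != 1 & N (w - a) < r].
  have nonzero g : ccont g z -> g z != 0 -> exists2 r1 : R, 0 < r1 &
      forall w, N (w - z) < r1 -> g w != 0.
    move=> gc gz; have e0 : 0 < N (g z) / 2 by rewrite divr_gt0 // cnorm_gt0.
    have [r1 r10 H] := gc _ e0; exists r1 => // w /H.
    by apply: contraTneq => ->; rewrite sub0r cnormN -ltNge; lra.
  have [q1 q10 Q1] := nonzero _ (cderiv_cont d0 fh) f'z0.
  have [q2 q20 Q2] := nonzero _ cf fz0.
  have [q3 q30 Q3] := nonzero _ (ccontB cf (ccont_cst 1 z)) fz1'.
  exists (Num.min (Num.min q1 q2) (Num.min q3 (r - N (z - a)))).
    by rewrite !lt_min q10 q20 q30 subr_gt0.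
  move=> w; rewrite !lt_min => /andP[/andP[w1 w2] /andP[w3 w4]].
  split; [exact: Q1|exact: Q2|by rewrite -subr_eq0; exact: Q3|].
  by have := cnorm_dist_le w a z; lra.
have rd0 : 0 < Num.min r1 d by rewrite lt_min r10.
have H : 0 + (2 * (root4 (f z) * (4 * N (cderiv f z) ^+ 2 / N (f z) ^+ 2) / (256 * (1 + root4 (f z)) ^+ 2)) +
    2 * (root4 (f z - 1) * (4 * N (cderiv f z) ^+ 2 / N (f z - 1) ^+ 2) / (256 * (1 + root4 (f z - 1)) ^+ 2)) + (0 + 0))
    + 2 * - (r ^+ 2 / c ^+ 2) <= 0.
  apply: (jet_max J rd0) => h; rewrite lt_min => /andP[h1 h2].
  have hE : z + h - z = h by rewrite addrC addKr.
  have [f'w fw0 fw1 wr] : [/\ cderiv f (z + h) != 0, f (z + h) != 0,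
    f (z + h) != 1 & N (z + h - a) < r].
    by apply: r1P; rewrite hE.
  rewrite -!logE//.
  rewrite ler_ln ?posrE ?prod_gt0//.
  by apply: zmax; rewrite ?hE.
set s := root4 (f z) in s0 st1 *; set t := root4 (f z - 1) in t0 st1 *.
rewrite -(root4_X8 fz0) -(root4_X8 fz1') -/s -/t !add0r in H.
set D := N (cderiv f z) ^+ 2 in H *; rewrite -/c.
have s1 : 0 < 1 + s by lra.
have t1 : 0 < 1 + t by lra.
have D0 : 0 <= D by exact: sqr_ge0.
have H' : D * c ^+ 2 * ((s ^+ 7 * (1 + s) ^+ 2)^-1 + (t ^+ 7 * (1 + t) ^+ 2)^-1) <= 64 * r ^+ 2.
  have c2 : 0 < c ^+ 2 by rewrite exprn_gt0.
  have : c ^+ 2 * (s * (4 * D / s ^+ 8) / (256 * (1 + s) ^+ 2)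
     + t * (4 * D / t ^+ 8) / (256 * (1 + t) ^+ 2) - r ^+ 2 / c ^+ 2) <= 0.
    rewrite pmulr_rle0 //; move: H; lra.
  have -> : c ^+ 2 * (s * (4 * D / s ^+ 8) / (256 * (1 + s) ^+ 2)
     + t * (4 * D / t ^+ 8) / (256 * (1 + t) ^+ 2) - r ^+ 2 / c ^+ 2) =
    (D * c ^+ 2 * ((s ^+ 7 * (1 + s) ^+ 2)^-1 + (t ^+ 7 * (1 + t) ^+ 2)^-1) - 64 * r ^+ 2) / 64.
    by field; rewrite !gt_eqF.
  by rewrite pmulr_lle0 ?invr_gt0// subr_le0.
have M := curvature_ineq s0 t0 st1.
have M' : density2 (f z) <= 2 * 3 ^+ 8 * ((s ^+ 7 * (1 + s) ^+ 2)^-1 + (t ^+ 7 * (1 + t) ^+ 2)^-1).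
  rewrite /density2 -/s -/t.
  have P : 0 < (1 + s) ^+ 2 * (1 + t) ^+ 2 by rewrite mulr_gt0 ?exprn_gt0.
  have P7 : 0 < s ^+ 7 * t ^+ 7 by rewrite mulr_gt0 ?exprn_gt0.
  rewrite ler_pdivrMr// -(ler_pM2r P).
  have -> : 2 * 3 ^+ 8 * ((s ^+ 7 * (1 + s) ^+ 2)^-1 + (t ^+ 7 * (1 + t) ^+ 2)^-1) *
     (s ^+ 7 * t ^+ 7) * ((1 + s) ^+ 2 * (1 + t) ^+ 2) =
     2 * 3 ^+ 8 * (t ^+ 7 * (1 + t) ^+ 2 + s ^+ 7 * (1 + s) ^+ 2).
    by field; rewrite !gt_eqF.
  by apply: le_trans M; rewrite le_eqVlt; apply/orP; left; apply/eqP; ring.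
rewrite mulrAC; apply: le_trans (_ : D * c ^+ 2 * (2 * 3 ^+ 8 *
   ((s ^+ 7 * (1 + s) ^+ 2)^-1 + (t ^+ 7 * (1 + t) ^+ 2)^-1)) <= _).
  by rewrite ler_wpM2l // mulr_ge0 // sqr_ge0.
have k8 : 0 <= 2 * 3 ^+ 8 :> R by rewrite mulr_ge0// exprn_ge0.
by rewrite mulrCA; apply: le_trans (ler_wpM2l k8 H') _; lra.
Qed.

End AhlforsSchwarz.

(** * The Ahlfors-Schwarz estimate *)

Section Landau.
Variable R : realType.
Local Notation C := R[i].
Local Notation N := (@Normc.normc R).
Local Notation Re := (@complex.Re R).
Local Notation Im := (@complex.Im R).
Implicit Types (f g : C -> C) (U V : C -> R) (a p z w b h : C) (r s t x y e : R).

Lemma rcont_density2 f p : ccont f p -> f p != 0 -> f p != 1 ->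
  rcont (fun z => density2 (f z)) p.
Proof.
move=> fp f0 f1; have f1' : f p - 1 != 0 by rewrite subr_eq0.
have c1 := rcont_root4 f0 fp.
have c2 := @rcont_root4 _ (fun z => f z - 1) p f1' (ccontB fp (ccont_cst 1 p)).
have cV (U : C -> R) : 0 < U p -> rcont U p -> rcont (fun z => (U z)^-1) p.
  move=> Up cU; apply: (rcont_comp (f := GRing.inv)) => //.
  by apply: inv_continuous; rewrite gt_eqF.
apply: rcontM.
  by apply: rcontM; apply: rcontX; apply: rcontD => //; exact: rcont_cst.
apply: cV; last by apply: rcontM; apply: rcontX.
by apply: mulr_gt0; apply: exprn_gt0; exact: root4_gt0.
Qed.

(** The ratio of the metrics tends to 0 at the boundary of the disc of radius
    r, so it has a maximum inside, where ahlfors_at_max applies. *)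
Lemma ahlfors_schwarz f a r r1 : 0 < r -> r < r1 -> holo f a r1 ->
  (forall z, N (z - a) < r1 -> f z != 0 /\ f z != 1) ->
  forall z, N (z - a) < r ->
  N (cderiv f z) ^+ 2 * density2 (f z) * (r ^+ 2 - N (z - a) ^+ 2) ^+ 2 <=
    128 * 3 ^+ 8 * r ^+ 2.
Proof.
move=> r0 rr1 fh f01 z zr.
(* The positive part of r^2 - |w - a|^2 extends the ratio by 0 to the plane. *)
pose pos w := (r ^+ 2 - N (w - a) ^+ 2 + `|r ^+ 2 - N (w - a) ^+ 2|) / 2.
have pos_in w : N (w - a) < r -> pos w = r ^+ 2 - N (w - a) ^+ 2.
  move=> wr; rewrite /pos ger0_norm; first by field.
  by rewrite subr_ge0 ler_pXn2r ?nnegrE ?cnorm_ge0//; exact: ltW.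
have pos_out w : r <= N (w - a) -> pos w = 0.
  move=> wr; rewrite /pos ler0_norm; first by rewrite subrr mul0r.
  by rewrite subr_le0 ler_pXn2r ?nnegrE ?cnorm_ge0//; exact: ltW.
pose v w := N (cderiv f w) ^+ 2 * density2 (f w) * pos w ^+ 2.
pose U w := if N (w - a) < r1 then v w else 0.
have r10 : 0 < r1 by lra.
have U_in w : N (w - a) < r ->
    U w = N (cderiv f w) ^+ 2 * density2 (f w) * (r ^+ 2 - N (w - a) ^+ 2) ^+ 2.
  by move=> wr; rewrite /U (lt_trans wr rr1) /v pos_in.
have U_out w : r <= N (w - a) -> U w = 0.
  by move=> wr; rewrite /U /v pos_out// expr0n mulr0 if_same.
have vcont p : N (p - a) < r1 -> rcont v p.
  move=> pr; have [f0 f1] := f01 p pr.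
  have hp : holo f p (r1 - N (p - a)) by apply: holo_sub fh; lra.
  have fc : ccont f p by apply: cdiff_cont (cderivP (fh _ pr)).
  have dc : ccont (cderiv f) p by apply: cderiv_cont hp; lra.
  apply: rcontM.
    by apply: rcontM; [apply: rcontX; exact: rcont_N|exact: rcont_density2].
  apply: rcontX; apply: rcontM; last exact: rcont_cst.
  have dd : rcont (fun w => r ^+ 2 - N (w - a) ^+ 2) p.
    have -> : (fun w => r ^+ 2 - N (w - a) ^+ 2) = (fun w => r ^+ 2 + - 1 * N (w - a) ^+ 2).
      by apply/funext => w; ring.
    apply: rcontD; first exact: rcont_cst.
    apply: rcontM; first exact: rcont_cst.
    apply: rcontX; apply: rcont_N; apply: ccontB; [exact: ccont_id|exact: ccont_cst].
  apply: rcontD => //; apply: (rcont_comp (f := @Num.norm _ R)) => //.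
  exact: norm_continuous.
have [p psq pmax] : exists2 p, in_square (Re a - r1) (Im a - r1) (2 * r1) p &
    forall w, in_square (Re a - r1) (Im a - r1) (2 * r1) w -> U w <= U p.
  apply: usc_max; first lra.
  move=> p _ e e0; have [pr|pr] := ltP (N (p - a)) r1.
    have [d d0 dP] := vcont p pr e e0.
    exists (Num.min d (r1 - N (p - a))); first by rewrite lt_min d0 subr_gt0.
    move=> w; rewrite lt_min => /andP[/dP + wp].
    have wr : N (w - a) < r1 by have := cnorm_dist_le w a p; lra.
    rewrite /U pr wr ler_norml; lra.
  exists (r1 - r); first lra.
  move=> w wp; rewrite !U_out; [|lra|have := cnorm_dist_le p a w; rewrite (cnorm_distC p w);
    lra]; lra.
have insq_disc w : N (w - a) < r1 -> in_square (Re a - r1) (Im a - r1) (2 * r1) w.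
  move=> wr; have := Re_le_cnorm (w - a); have := Im_le_cnorm (w - a).
  rewrite !raddfB /= !ler_norml => /andP[i1 i2] /andP[j1 j2]; split; lra.
have zmax := pmax _ (insq_disc _ (lt_trans zr rr1)).
rewrite -U_in//; apply: (le_trans zmax).
have K0 : 0 <= 128 * 3 ^+ 8 * r ^+ 2.
  by apply: mulr_ge0; [apply: mulr_ge0 => //; apply: exprn_ge0|exact: sqr_ge0].
have [pr|pr] := ltP (N (p - a)) r; last by rewrite U_out.
have pr1 : N (p - a) < r1 by lra.
have [f'0|f'0] := eqVneq (cderiv f p) 0.
  by rewrite U_in// f'0 cnorm0 expr0n !mul0r.
have [f0 f1] := f01 p pr1.
rewrite U_in//; apply: (@ahlfors_at_max _ _ _ _ _ (r1 - N (p - a))) => //.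
- by rewrite subr_gt0.
- by apply: holo_sub fh; lra.
- by move=> w _ _ _ _ wr; rewrite -!U_in//; apply: pmax; apply: insq_disc; lra.
Qed.

(** The constant that results from ahlfors_schwarz on the disc of radius r /
    2, from density2_growth, and from (r / 2)^2 - |z - a|^2 >= 3 / 16 r^2. *)
Definition spherical_const r : R := Num.sqrt (2 * 128 * 3 ^+ 8 * 2 ^+ 16) / r.

(** The metric density2 dominates the spherical metric. *)
Lemma spherical_derivative_le f a r : 0 < r -> holo f a r ->
  (forall z, N (z - a) < r -> f z != 0 /\ f z != 1) ->
  forall z, N (z - a) < r / 4 ->
  N (cderiv f z) <= spherical_const r * (1 + N (f z) ^+ 2).
Proof.
move=> r0 fh f01 z zr.
have r2 : 0 < r / 2 by lra.
have r2r : r / 2 < r by lra.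
have zr2 : N (z - a) < r / 2 by lra.
have zr1 : N (z - a) < r by lra.
have A := ahlfors_schwarz r2 r2r fh f01 zr2.
have [f0 f1] := f01 z zr1.
have [ts _] := root4_ineq f0 f1.
set s := root4 (f z) in ts; set t := root4 (f z - 1) in ts.
have s0 : 0 < s := root4_gt0 _. have t0 : 0 < t := root4_gt0 _.
have P := density2_growth s0 t0 ts.
have s8 : s ^+ 8 = N (f z) ^+ 2 := root4_X8 f0.
set D := N (cderiv f z) in A *; have D0 : 0 <= D by exact: cnorm_ge0.
set X := 1 + N (f z) ^+ 2; rewrite s8 -/X in P.
have X0 : 0 < X by rewrite ltr_wpDr// sqr_ge0.
have Q : 0 < (1 + s) ^+ 2 * (1 + t) ^+ 2.
  by apply: mulr_gt0; apply: exprn_gt0; lra.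
have P7 : 0 < s ^+ 7 * t ^+ 7 by rewrite mulr_gt0 ?exprn_gt0.
have dens : ((2 ^+ 7 * X) ^+ 2)^-1 <= density2 (f z).
  rewrite /density2 -/s -/t ler_pdivlMr// ler_pdivrMl //.
  by apply: exprn_gt0; apply: mulr_gt0 => //; exact: exprn_gt0.
have dd : 3 / 16 * r ^+ 2 <= (r / 2) ^+ 2 - N (z - a) ^+ 2.
  have : N (z - a) ^+ 2 <= (r / 4) ^+ 2 by rewrite ler_pXn2r ?nnegrE ?cnorm_ge0//; lra.
  by have -> : (r / 4) ^+ 2 = r ^+ 2 / 16; [field|lra].
have dd2 : (3 / 16 * r ^+ 2) ^+ 2 <= ((r / 2) ^+ 2 - N (z - a) ^+ 2) ^+ 2.
  have h0 : 0 <= 3 / 16 * r ^+ 2 by rewrite mulr_ge0 ?sqr_ge0//; lra.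
  by rewrite ler_pXn2r ?nnegrE//; exact: le_trans dd.
have Y0 : 0 < (2 ^+ 7 * X) ^+ 2.
  by apply: exprn_gt0; apply: mulr_gt0 => //; exact: exprn_gt0.
have B : D ^+ 2 / (2 ^+ 7 * X) ^+ 2 * (3 / 16 * r ^+ 2) ^+ 2 <= 128 * 3 ^+ 8 * (r / 2) ^+ 2.
  apply: le_trans A; apply: ler_pM; rewrite ?sqr_ge0//.
    by rewrite mulr_ge0 ?sqr_ge0 ?invr_ge0 ?ltW.
  by rewrite ler_wpM2l ?sqr_ge0.
have rX : 0 < 3 / 16 * r ^+ 2 by rewrite mulr_gt0 ?exprn_gt0//; lra.
have E : D ^+ 2 <= 2 * 128 * 3 ^+ 8 * 2 ^+ 16 / r ^+ 2 * X ^+ 2.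
  move: B; rewrite mulrAC ler_pdivrMr// -ler_pdivlMr; last by rewrite exprn_gt0.
  move=> B; apply: le_trans B _.
  have -> : 128 * 3 ^+ 8 * (r / 2) ^+ 2 * (2 ^+ 7 * X) ^+ 2 / (3 / 16 * r ^+ 2) ^+ 2 =
    (128 * 3 ^+ 8 * 2 ^+ 16 / r ^+ 2 * X ^+ 2) * (16 / 9).
    by field; rewrite gt_eqF.
  have -> : 2 * 128 * 3 ^+ 8 * 2 ^+ 16 / r ^+ 2 * X ^+ 2 =
    (128 * 3 ^+ 8 * 2 ^+ 16 / r ^+ 2 * X ^+ 2) * 2.
    by field; rewrite gt_eqF.
  rewrite ler_wpM2l//; last lra.
  by rewrite !mulr_ge0 ?exprn_ge0 ?invr_ge0 ?exprn_ge0 ?ltW.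
have L0 : 0 <= spherical_const r by rewrite divr_ge0 ?sqrtr_ge0 ?ltW.
rewrite -(@ler_pXn2r _ 2) ?nnegrE//; last by apply: mulr_ge0 => //; exact: ltW.
apply: le_trans E _; rewrite exprMn /spherical_const exprMn sqr_sqrtr ?exprVn//.
Qed.

End Landau.

(** * The chordal distance and the sphere *)

Section Sphere.
Variable R : realType.
Local Notation C := R[i].
Local Notation N := (@Normc.normc R).
Local Notation Re := (@complex.Re R).
Local Notation Im := (@complex.Im R).
Local Notation "x %:C" := (real_complex R x).
Local Notation ext := (ext_cplx R).
Implicit Types (f g : C -> C) (u : C -> R) (a p q z b h : C) (r s t x y e : R) (v w : ext).

(** Stereographic projection onto the sphere x^2 + y^2 + t^2 = t of diameter
    1, with infinity sent to the origin, one coordinate at a time. *)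
Definition sphX v : R := if v is Some z then Re z / (1 + N z ^+ 2) else 0.
Definition sphY v : R := if v is Some z then Im z / (1 + N z ^+ 2) else 0.
Definition sphZ v : R := if v is Some z then 1 / (1 + N z ^+ 2) else 0.

(** With these coordinates the chordal distance is the Euclidean distance in
    R^3. *)
Lemma chordal_sph v w : chordal v w ^+ 2 =
  (sphX v - sphX w) ^+ 2 + (sphY v - sphY w) ^+ 2 + (sphZ v - sphZ w) ^+ 2.
Proof.
have pos z : 0 < 1 + N z ^+ 2 by rewrite ltr_wpDr// sqr_ge0.
have inf z : (1 / Num.sqrt (1 + N z ^+ 2)) ^+ 2 =
    (Re z / (1 + N z ^+ 2)) ^+ 2 + (Im z / (1 + N z ^+ 2)) ^+ 2 + (1 / (1 + N z ^+ 2)) ^+ 2.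
  rewrite expr_div_n sqr_sqrtr ?ltW// expr1n.
  have := pos z; rewrite cnorm_sqr; case: z => x y /= h.
  by field; rewrite gt_eqF.
case: v w => [z|] [w|] /=.
- rewrite expr_div_n exprMn !sqr_sqrtr ?ltW//.
  have := pos z; have := pos w; rewrite !cnorm_sqr; case: z w => x y [x' y'] /= h h'.
  by field; rewrite !gt_eqF.
- by rewrite !subr0; exact: inf.
- by rewrite !sub0r !sqrrN; exact: inf.
- by rewrite !subrr expr0n !addr0.
Qed.

Lemma chordal_ge0 v w : 0 <= chordal v w.
Proof.
by case: v w => [z|] [w|] //=; rewrite divr_ge0 ?mulr_ge0 ?sqrtr_ge0 ?cnorm_ge0.
Qed.

Lemma sph_le_chordal v w : [/\ `|sphX v - sphX w| <= chordal v w,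
  `|sphY v - sphY w| <= chordal v w & `|sphZ v - sphZ w| <= chordal v w].
Proof.
have E := chordal_sph v w.
have h1 := sqr_ge0 (sphX v - sphX w); have h2 := sqr_ge0 (sphY v - sphY w).
have h3 := sqr_ge0 (sphZ v - sphZ w).
by split; rewrite -(@ler_pXn2r _ 2) ?nnegrE ?chordal_ge0// real_normK ?num_real// E; lra.
Qed.

Lemma sph_bound v : [/\ `|sphX v| <= 1, `|sphY v| <= 1 & `|sphZ v| <= 1].
Proof.
case: v => [z|] /=; last by rewrite normr0.
have pos : 0 < 1 + N z ^+ 2 by rewrite ltr_wpDr// sqr_ge0.
have nz : N z <= 1 + N z ^+ 2 by have := sqr_ge0 (N z - 1 / 2); lra.
split; rewrite normrM normfV (gtr0_norm pos) ler_pdivrMr// mul1r.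
- exact: le_trans (Re_le_cnorm _) nz.
- exact: le_trans (Im_le_cnorm _) nz.
- by rewrite normr1 lerDl sqr_ge0.
Qed.

Lemma sph_on v : sphX v ^+ 2 + sphY v ^+ 2 + sphZ v ^+ 2 = sphZ v.
Proof.
case: v => [z|] /=; last by rewrite expr0n !addr0.
have : 0 < 1 + N z ^+ 2 by rewrite ltr_wpDr// sqr_ge0.
rewrite cnorm_sqr; case: z => x y /= h.
by field; rewrite gt_eqF.
Qed.

(** The sphere is closed in R^3, so limits of points of the sphere come from
    points of the extended plane. *)
Lemma sph_surj x y t : x ^+ 2 + y ^+ 2 + t ^+ 2 = t ->
  exists v, [/\ sphX v = x, sphY v = y & sphZ v = t].
Proof.
move=> E; have [t0|t0] := eqVneq t 0.
  rewrite t0 expr0n addr0 in E.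
  have hx := sqr_ge0 x; have hy := sqr_ge0 y.
  have x0 : x = 0 by apply/eqP; rewrite -sqrf_eq0; apply/eqP; lra.
  have y0 : y = 0 by apply/eqP; rewrite -sqrf_eq0; apply/eqP; lra.
  by exists None; rewrite x0 y0 t0.
exists (Some (Complex (x / t) (y / t))) => /=.
have -> : N (Complex (x / t) (y / t)) ^+ 2 = (t - t ^+ 2) / t ^+ 2.
  have E' : x ^+ 2 + y ^+ 2 = t - t ^+ 2 by lra.
  by rewrite cnorm_sqr [complex.Re _]/= [complex.Im _]/= !expr_div_n -mulrDl E'.
have -> : 1 + (t - t ^+ 2) / t ^+ 2 = t^-1 by field.
by split; field.
Qed.

(** p and q are homogeneous coordinates of v. In these the chordal distance
    has a single formula, and Moebius maps are linear. *)
Definition hcoord v p q : Prop :=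
  if v is Some z then q <> 0 /\ p = z * q else p <> 0 /\ q = 0.

Lemma chordal_hcoord v w p q p' q' : hcoord v p q -> hcoord w p' q' ->
  chordal v w ^+ 2 = N (p * q' - p' * q) ^+ 2 /
    ((N p ^+ 2 + N q ^+ 2) * (N p' ^+ 2 + N q' ^+ 2)).
Proof.
have nz z : z <> 0 -> N z != 0 by move=> z0; rewrite cnorm_eq0; apply/eqP.
have pos z : 1 + N z ^+ 2 != 0 by rewrite gt_eqF// ltr_wpDr// sqr_ge0.
have sq z : Num.sqrt (1 + N z ^+ 2) ^+ 2 = 1 + N z ^+ 2.
  by rewrite sqr_sqrtr// addr_ge0// sqr_ge0.
have fac z q0 : N (z * q0) ^+ 2 + N q0 ^+ 2 = N q0 ^+ 2 * (1 + N z ^+ 2).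
  by rewrite cnormM; ring.
case: v w => [z|] [w|] /= [h1 h2] [k1 k2]; rewrite ?h2 ?k2.
- rewrite !fac expr_div_n exprMn !sq.
  rewrite (_ : z * q * q' - w * q' * q = (z - w) * (q * q')); last by ring.
  by rewrite !cnormM; field; rewrite !pos !nz.
- rewrite fac mulr0 sub0r cnormN cnormM cnorm0 expr0n addr0 expr_div_n sq.
  by field; rewrite pos !nz.
- rewrite fac mulr0 subr0 cnormM cnorm0 expr0n addr0 expr_div_n sq.
  by field; rewrite pos !nz.
- by rewrite !mulr0 subr0 cnorm0 !expr0n mul0r.
Qed.

(** A local Lipschitz constant at each point is a global one on a disc: bisect
    the segment between two points. *)
Lemma lipschitz_of_local u a r (L : R) :
  (forall z, N (z - a) < r -> exists2 d : R, 0 < d & forall w : C, N (w - z) < d ->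
     `|u w - u z| <= L * N (w - z)) ->
  forall z b, N (z - a) < r -> N (b - a) < r -> `|u z - u b| <= L * N (z - b).
Proof.
move=> uL z b zr br.
(* The segment from b to z is bisected by means of squares, whose second
   coordinate is ignored. *)
pose c t := b + t%:C * (z - b).
have cB s t : N (c s - c t) = `|s - t| * N (z - b).
  by rewrite -cnorm_real -cnormM rmorphB /=; congr N; rewrite /c; ring.
have c_in t : 0 <= t <= 1 -> N (c t - a) < r.
  move=> /andP[t0 t1].
  have -> : c t - a = t%:C * (z - a) + (1 - t)%:C * (b - a).
    by rewrite rmorphB rmorph1 /c; ring.
  apply: le_lt_trans (cnormD_le _ _) _;
    rewrite !cnormM !cnorm_real (ger0_norm t0) ger0_norm ?subr_ge0//.
  have [-> |t1'] := eqVneq t 1; first by rewrite subrr mul0r addr0 mul1r.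
  have : (1 - t) * N (b - a) < (1 - t) * r.
    by rewrite ltr_pM2l// subr_gt0 lt_neqAle t1'.
  have : t * N (z - a) <= t * r by rewrite ler_wpM2l// ltW.
  lra.
have : `|u (c (0 + 1)) - u (c 0)| <= L * (1 * N (z - b)).
  apply: (@square_induction R (fun x y s => `|u (c (x + s)) - u (c x)| <= L * (s * N (z - b))) 0 0 1) => //.
    move=> x y s s0 h1 h2 _ _.
    rewrite (_ : x + s / 2 + s / 2 = x + s) in h2; last by field.
    have := ler_distD (u (c (x + s / 2))) (u (c (x + s))) (u (c x)).
    lra.
  move=> t y t01 _; rewrite add0r in t01.
  have [d d0 dP] := uL _ (c_in t t01).
  have n1 : 0 < N (z - b) + 1 by rewrite ltr_wpDl// cnorm_ge0.
  exists (d / (N (z - b) + 1)); first by rewrite divr_gt0.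
  move=> x y' s s0; rewrite ltr_pdivlMr// => sd _ _ _ _ /andP[xt tx] _.
  have near x' : `|x' - t| <= s -> `|u (c x') - u (c t)| <= L * (`|x' - t| * N (z - b)).
    move=> hx; rewrite -cB; apply: dP; rewrite cB; apply: le_lt_trans _ sd.
    have := cnorm_ge0 (z - b) => k; rewrite mulrDr mulr1.
    have : `|x' - t| * N (z - b) <= s * N (z - b) by rewrite ler_wpM2r.
    lra.
  have e1 : `|x + s - t| = x + s - t by rewrite ger0_norm; lra.
  have e2 : `|x - t| = t - x by rewrite distrC ger0_norm; lra.
  have h1 := near (x + s); rewrite e1 in h1;
    have {}h1 : `|u (c (x + s)) - u (c t)| <= L * ((x + s - t) * N (z - b)) by apply: h1; lra.
  have h2 := near x; rewrite e2 in h2;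
    have {}h2 : `|u (c x) - u (c t)| <= L * ((t - x) * N (z - b)) by apply: h2; lra.
  have := ler_distD (u (c t)) (u (c (x + s))) (u (c x)); rewrite (distrC (u (c t))).
  lra.
have -> : c (0 + 1) = z by rewrite /c add0r rmorph1; ring.
have -> : c 0 = b by rewrite /c rmorph0; ring.
by rewrite mul1r.
Qed.

End Sphere.

(** * Meromorphic functions omitting three values *)

Section Moebius.
Variable R : realType.
Local Notation C := R[i].
Local Notation N := (@Normc.normc R).
Local Notation ext := (ext_cplx R).
Variables (al be ga : C).
Hypotheses (nab : al != be) (nbg : be != ga) (nga : ga != al).
Implicit Types (f : C -> ext) (g h : C -> C) (a z b : C) (r e : R) (v w : ext).

Definition mratio : C := (be - ga) / (be - al).

(** The Moebius map that sends al, be, ga to 0, 1 and infinity. *)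
Definition moebius v : C :=
  if v is Some x then mratio * (x - al) / (x - ga) else mratio.

Let ba0 : be - al != 0. Proof. by rewrite subr_eq0 eq_sym. Qed.
Let bg0 : be - ga != 0. Proof. by rewrite subr_eq0. Qed.
Let ga0 : ga - al != 0. Proof. by rewrite subr_eq0. Qed.
Let ag0 : al - ga != 0. Proof. by rewrite subr_eq0 eq_sym. Qed.
Let mr0 : mratio != 0. Proof. by apply: mulf_neq0; rewrite ?invr_eq0. Qed.

Lemma moebius_neq0 v : v <> Some al -> v <> Some ga -> moebius v != 0.
Proof.
case: v => [x|] //= xa xg; apply: mulf_neq0; first apply: mulf_neq0 => //.
  by rewrite subr_eq0; apply/eqP => E; apply: xa; rewrite E.
by rewrite invr_eq0 subr_eq0; apply/eqP => E; apply: xg; rewrite E.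
Qed.

(** The value at infinity is (be - ga) / (be - al), which is 1 only if ga =
    al. *)
Lemma moebius_neq1 v : v <> Some be -> v <> Some ga -> moebius v != 1.
Proof.
case: v => [x|] /= xb xg; last first.
  apply/eqP => /(congr1 ( *%R^~ (be - al))); rewrite divfK// mul1r => /eqP.
  by rewrite -subr_eq0 (_ : _ - _ = al - ga) ?(negbTE ag0)//; ring.
have xg0 : x - ga != 0 by rewrite subr_eq0; apply/eqP => E; apply: xg; rewrite E.
have xb0 : x - be != 0 by rewrite subr_eq0; apply/eqP => E; apply: xb; rewrite E.
rewrite -subr_eq0 /mratio.
rewrite (_ : _ - 1 = (x - be) * (al - ga) / ((be - al) * (x - ga))).
  by apply: mulf_neq0; [apply: mulf_neq0|rewrite invr_eq0; apply: mulf_neq0].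
by field; rewrite xg0 ba0.
Qed.

(** The inverse map, in homogeneous coordinates. *)
Lemma moebius_hcoord v : v <> Some ga ->
  hcoord v (al * mratio - ga * moebius v) (mratio - moebius v).
Proof.
case: v => [x|] /= xg; last first.
  by rewrite subrr; split => //; apply/eqP; rewrite -mulrBl; apply: mulf_neq0.
have xg0 : x - ga != 0 by rewrite subr_eq0; apply/eqP => E; apply: xg; rewrite E.
split; last by field.
apply/eqP; rewrite (_ : _ - _ = mratio * (al - ga) / (x - ga)); last by field.
by apply: mulf_neq0; [apply: mulf_neq0|rewrite invr_eq0].
Qed.

(** The linear map of moebius_hcoord is invertible: g and 1 are combinations
    of its two components. *)
Lemma moebius_hcoord_low : exists2 c : R, 0 < c & forall g : C,
  c * (1 + N g ^+ 2) <= N (al * mratio - ga * g) ^+ 2 + N (mratio - g) ^+ 2.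
Proof.
(* A bounds the coefficients in ga q - p = mratio (ga - al) and al q - p = (ga
   - al) g. *)
pose A := 1 + N al + N ga.
have A1 : 1 <= A by rewrite /A; have := cnorm_ge0 al; have := cnorm_ge0 ga; lra.
pose k := N (mratio * (ga - al)); pose l := N (ga - al).
have k0 : 0 < k by rewrite cnorm_gt0; apply: mulf_neq0.
have l0 : 0 < l by rewrite cnorm_gt0.
pose m := Num.min (k ^+ 2) (l ^+ 2).
have m0 : 0 < m by rewrite lt_min !exprn_gt0.
exists (m / (4 * A ^+ 2)).
  by apply: divr_gt0 => //; apply: mulr_gt0 => //; apply: exprn_gt0; lra.
move=> g; set p := al * mratio - ga * g; set q := mratio - g.
have h1 : k <= A * (N p + N q).
  have -> : k = N (ga * q - p) by rewrite /k; congr N; rewrite /p /q; ring.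
  apply: le_trans (cnormB_le _ _) _; rewrite cnormM.
  have := mulr_ge0 (cnorm_ge0 al) (addr_ge0 (cnorm_ge0 p) (cnorm_ge0 q)).
  have := mulr_ge0 (cnorm_ge0 ga) (cnorm_ge0 p); have := cnorm_ge0 q; rewrite /A; lra.
have h2 : l * N g <= A * (N p + N q).
  have -> : l * N g = N (al * q - p) by rewrite /l -cnormM; congr N; rewrite /p /q; ring.
  apply: le_trans (cnormB_le _ _) _; rewrite cnormM.
  have := mulr_ge0 (cnorm_ge0 ga) (addr_ge0 (cnorm_ge0 p) (cnorm_ge0 q)).
  have := mulr_ge0 (cnorm_ge0 al) (cnorm_ge0 p); have := cnorm_ge0 q; rewrite /A; lra.
have sq (x y : R) : 0 <= x -> x <= y -> x ^+ 2 <= y ^+ 2.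
  by move=> x0 xy; rewrite ler_pXn2r ?nnegrE//; exact: le_trans xy.
have H1 := sq _ _ (ltW k0) h1.
have H2 := sq _ _ (mulr_ge0 (ltW l0) (cnorm_ge0 g)) h2.
have mk : m <= k ^+ 2 by rewrite ge_min lexx.
have ml : m * N g ^+ 2 <= l ^+ 2 * N g ^+ 2.
  by rewrite ler_wpM2r ?sqr_ge0// ge_min lexx orbT.
have A2 : 0 < 4 * A ^+ 2 by apply: mulr_gt0 => //; apply: exprn_gt0; lra.
rewrite mulrAC ler_pdivrMr//.
have S : (N p + N q) ^+ 2 <= 2 * (N p ^+ 2 + N q ^+ 2) by have := sqr_ge0 (N p - N q); lra.
have : A ^+ 2 * (N p + N q) ^+ 2 <= A ^+ 2 * (2 * (N p ^+ 2 + N q ^+ 2)).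
  by rewrite ler_wpM2l ?sqr_ge0.
rewrite !exprMn in H1 H2; lra.
Qed.

(** The inverse of a Moebius map is Lipschitz for the chordal distance; near z
    the distance of the values of moebius \o f at w and z is at most (B + 1)
    (1 + |moebius (f z)|^2) |w - z|. *)
Lemma moebius_inverse_lip (B : R) : 0 <= B -> exists2 L : R, 0 <= L &
  forall f z l, cdiff (fun w : C => moebius (f w)) z l ->
    N l <= B * (1 + N (moebius (f z)) ^+ 2) ->
    (exists2 d : R, 0 < d & forall w : C, N (w - z) < d -> f w <> Some ga) ->
    exists2 d : R, 0 < d & forall w : C, N (w - z) < d ->
      chordal (f w) (f z) <= L * N (w - z).
Proof.
move=> B0; have [c c0 cP] := moebius_hcoord_low.
pose K := N (mratio * (al - ga)).
have K0 : 0 <= K by exact: cnorm_ge0.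
exists (2 * K * (B + 1) / c); first by rewrite divr_ge0 ?mulr_ge0 ?addr_ge0// ltW.
move=> f z l fl lB [d0 d00 fga].
set g := fun w : C => moebius (f w) in fl *.
have X1 (w : C) : 1 <= 1 + N (g w) ^+ 2 by rewrite lerDl sqr_ge0.
have [d1 d10 H1] := fl 1 ltr01.
have h2 : 0 < 1 / 2 :> R by lra.
have [d2 d20 H2] := cdiff_cont fl h2.
exists (Num.min d0 (Num.min d1 d2)); first by rewrite !lt_min d00 d10.
move=> w; rewrite !lt_min => /and3P[w0 /H1 k1 /H2 k2].
have fz : f z <> Some ga by apply: fga; rewrite subrr cnorm0.
set t := N (w - z) in k1 *; have t0 : 0 <= t by exact: cnorm_ge0.
set Xz := 1 + N (g z) ^+ 2; set Xw := 1 + N (g w) ^+ 2.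
have Xz1 : 1 <= Xz by exact: X1.
have Xw1 : 1 <= Xw by exact: X1.
have dg : N (g w - g z) <= (B + 1) * Xz * t.
  have e1 : N (g w - g z) <= N (l * (w - z)) + N (g w - g z - l * (w - z)).
    by rewrite -{1}(subrKC (l * (w - z)) (g w - g z)) cnormD_le.
  rewrite cnormM -/t in e1.
  have e2 : N l * t <= B * Xz * t by rewrite ler_wpM2r.
  have e3 : t <= Xz * t by rewrite ler_peMl.
  lra.
(* Here |g w - g z| <= 1 / 2. *)
have XX : Xz <= 2 * Xw.
  have e1 : N (g z) <= N (g w) + 1 / 2 by have := cnorm_le_add_dist (g z) (g w);
    rewrite cnorm_distC; lra.
  have e2 : N (g z) ^+ 2 <= (N (g w) + 1 / 2) ^+ 2.
    by rewrite ler_pXn2r ?nnegrE ?cnorm_ge0// addr_ge0 ?cnorm_ge0//; lra.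
  have := sqr_ge0 (N (g w) - 1 / 2); rewrite /Xz /Xw; lra.
rewrite -(@ler_pXn2r _ 2) ?nnegrE ?chordal_ge0//; last first.
  by rewrite mulr_ge0// divr_ge0 ?mulr_ge0 ?addr_ge0// ltW.
rewrite (chordal_hcoord (moebius_hcoord (fga w w0)) (moebius_hcoord fz)) -/(g w) -/(g z).
rewrite (_ : _ * _ - _ * _ = mratio * (al - ga) * (g w - g z)); last by ring.
rewrite cnormM -/K.
have cw := cP (g w); have cz := cP (g z); rewrite -/Xz in cz; rewrite -/Xw in cw.
have cXw : 0 < c * Xw by apply: mulr_gt0 => //; lra.
have cXz : 0 < c * Xz by apply: mulr_gt0 => //; lra.
have den : c * Xw * (c * Xz) <= (N (al * mratio - ga * g w) ^+ 2 + N (mratio - g w) ^+ 2) *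
   (N (al * mratio - ga * g z) ^+ 2 + N (mratio - g z) ^+ 2).
  by apply: ler_pM => //; exact: ltW.
have num : (K * N (g w - g z)) ^+ 2 <= (K * ((B + 1) * Xz * t)) ^+ 2.
  have n1 : K * N (g w - g z) <= K * ((B + 1) * Xz * t) by rewrite ler_wpM2l.
  have n2 : 0 <= K * N (g w - g z) by apply: mulr_ge0 => //; exact: cnorm_ge0.
  by rewrite ler_pXn2r ?nnegrE//; exact: le_trans n1.
rewrite ler_pdivrMr; last by apply: lt_le_trans den; exact: mulr_gt0.
apply: le_trans num _.
apply: le_trans (_ : (2 * K * (B + 1) / c * t) ^+ 2 * (c * Xw * (c * Xz)) <= _); last first.
  by rewrite ler_wpM2l ?sqr_ge0.
have -> : (2 * K * (B + 1) / c * t) ^+ 2 * (c * Xw * (c * Xz)) =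
  (K * (B + 1) * t) ^+ 2 * (Xz * (4 * Xw)).
  by field; rewrite gt_eqF.
have -> : (K * ((B + 1) * Xz * t)) ^+ 2 = (K * (B + 1) * t) ^+ 2 * (Xz * Xz) by ring.
by rewrite ler_wpM2l ?sqr_ge0// ler_wpM2l; lra.
Qed.

Lemma moebius_diff h b l : cdiff h b l -> h b != ga ->
  exists k, cdiff (fun z => moebius (Some (h z))) b k.
Proof.
move=> hl hb; have hb0 : h b - ga != 0 by rewrite subr_eq0.
eexists; apply: cdiffM.
  by apply: cdiffM; [exact: cdiff_cst|apply: cdiffB; [exact: hl|exact: cdiff_cst]].
by apply: cdiffV => //; apply: cdiffB; [exact: hl|exact: cdiff_cst].
Qed.

(** As ga is omitted, moebius \o f is finite; near a pole of f it is close to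
    its value at infinity, so the pole is a removable singularity. *)
Lemma meromorphic_holo f a r :
  meromorphic [set z | N (z - a) < r] f ->
  (forall z, N (z - a) < r -> f z <> Some ga) ->
  holo (fun z => moebius (f z)) a r.
Proof.
move=> fm fga b br; have [h] := fm b br.
case=> [/nbhs_normcP[d d0 dP]|[fb /nbhs_normcP[d d0 dP] hoo]].
  have bb : N (b - b) < d by rewrite subrr cnorm0.
  have [fb /derivable_cdiff[l hl]] := dP b bb.
  have hb : h b != ga by apply/eqP => E; apply: (fga b br); rewrite fb E.
  have [k kP] := moebius_diff hl hb; exists k.
  by apply: cdiff_local d0 _ kP => z /dP[->].
pose d' := Num.min d (r - N (b - a)).
have d'0 : 0 < d' by rewrite lt_min d0 subr_gt0.
apply: (removable_singularity d'0) => [z zb|].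
  rewrite lt_min => /andP[zd zr].
  have zr' : N (z - a) < r by have := cnorm_dist_le z a b; lra.
  have [fz /derivable_cdiff[l hl]] := dP z zd zb.
  have hz : h z != ga by apply/eqP => E; apply: (fga z zr'); rewrite fz E.
  have [k kP] := moebius_diff hl hz; exists k.
  have m0 : 0 < Num.min (N (z - b)) (d - N (z - b)).
    by rewrite lt_min cnorm_gt0 !subr_eq0 zb subr_gt0.
  apply: cdiff_local m0 _ kP => w; rewrite lt_min => /andP[w1 w2].
  have wb : w != b by apply: contraTneq w1 => ->; rewrite cnorm_distC ltxx.
  have wd : N (w - b) < d by have := cnorm_dist_le w b z; lra.
  by have [-> _] := dP w wd wb.
move=> e e0.
pose M := N ga + N (mratio * (ga - al)) / e + 1.
have /nbhs_normcP[d1 d10 d1P] :=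
  (@cvgryPgt _ _ _ (dnbhs_filter (b : C^o)) _).1 hoo M.
exists (Num.min d d1); first by rewrite lt_min d0.
move=> z; rewrite lt_min => /andP[zd zd1].
have [->|zb] := eqVneq z b; first by rewrite subrr cnorm0 ltW.
have [-> _] := dP z zd zb; rewrite fb /=.
have hM := d1P z zd1 zb.
have q0 : 0 <= N (mratio * (ga - al)) / e by rewrite divr_ge0 ?cnorm_ge0// ltW.
have hg : N (mratio * (ga - al)) / e < N (h z - ga).
  by have := cnorm_le_add_dist (h z) ga; rewrite /M in hM; lra.
have hg0 : h z - ga != 0 by rewrite -cnorm_gt0; exact: le_lt_trans hg.
rewrite (_ : _ - _ = mratio * (ga - al) / (h z - ga)); last by field.
rewrite cnormM cnormV ler_pdivrMr ?cnorm_gt0// [leRHS]mulrC -ler_pdivrMr//.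
exact: ltW.
Qed.

(** Montel's test in quantitative form: L depends on r and on the omitted
    values only. *)
Lemma omit3_equi_lipschitz r : 0 < r -> exists2 L : R, 0 <= L &
  forall f a, meromorphic [set z | N (z - a) < r] f ->
  (forall z, N (z - a) < r -> [/\ f z <> Some al, f z <> Some be & f z <> Some ga]) ->
  forall z b, N (z - a) < r / 4 -> N (b - a) < r / 4 ->
  [/\ `|sphX (f z) - sphX (f b)| <= L * N (z - b),
      `|sphY (f z) - sphY (f b)| <= L * N (z - b) &
      `|sphZ (f z) - sphZ (f b)| <= L * N (z - b)].
Proof.
move=> r0.
have B0 : 0 <= spherical_const r by rewrite divr_ge0 ?sqrtr_ge0 ?ltW.
have [L L0 LP] := moebius_inverse_lip B0; exists L => // f a fm fo.
have gh : holo (fun z => moebius (f z)) a r.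
  by apply: meromorphic_holo => // z /fo[].
have g01 z : N (z - a) < r -> moebius (f z) != 0 /\ moebius (f z) != 1.
  by move=> /fo[? ? ?]; split; [exact: moebius_neq0|exact: moebius_neq1].
have loc z : N (z - a) < r / 4 -> exists2 d : R, 0 < d & forall w : C, N (w - z) < d ->
      chordal (f w) (f z) <= L * N (w - z).
  move=> zr; have zr1 : N (z - a) < r by lra.
  apply: (LP _ _ (cderiv (fun z => moebius (f z)) z)).
  - by apply: cderivP; exact: gh.
  - exact: (spherical_derivative_le r0 gh g01).
  - exists (r - N (z - a)); first by rewrite subr_gt0.
    by move=> w wz; have [] : [/\ f w <> Some al, f w <> Some be & f w <> Some ga]
      by apply: fo; have := cnorm_dist_le w a z; lra.
move=> z b zr br; split.
- apply: (@lipschitz_of_local R (fun z => sphX (f z)) a (r / 4)) => // u /loc[d d0 dP];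
  exists d => // w /dP.
  by apply: le_trans; have [] := sph_le_chordal (f w) (f u).
- apply: (@lipschitz_of_local R (fun z => sphY (f z)) a (r / 4)) => // u /loc[d d0 dP];
  exists d => // w /dP.
  by apply: le_trans; have [] := sph_le_chordal (f w) (f u).
- apply: (@lipschitz_of_local R (fun z => sphZ (f z)) a (r / 4)) => // u /loc[d d0 dP];
  exists d => // w /dP.
  by apply: le_trans; have [] := sph_le_chordal (f w) (f u).
Qed.

End Moebius.

(** * A sequential Arzela-Ascoli theorem *)

Section ArzelaAscoli.
Variables (R : realType) (X : topologicalType) (I : finType).
Implicit Types (e : R).

(** A bounded real sequence converges along an ultrafilter. Taking limits
    along one ultrafilter replaces a diagonal extraction. *)
Lemma ultra_limit (U : set_system nat) (a : nat -> R) : UltraFilter U ->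
  (forall n, `|a n| <= 1) ->
  exists c, forall e, 0 < e -> U [set n | `|a n - c| <= e].
Proof.
move=> UU a1; have UF : ProperFilter U := ultra_proper.
(* The levels that the sequence exceeds along U. *)
pose S := [set x | U [set n | x <= a n]].
have S0 : S !=set0.
  by exists (- 1); apply: filterS filterT => n _ /=; have := a1 n; rewrite ler_norml => /andP[].
have Sub : ubound S 1.
  move=> x Sx; have [n /= xn] := filter_ex Sx.
  by apply: le_trans xn _; have := a1 n; rewrite ler_norml => /andP[].
exists (sup S) => e e0.
have up : U [set n | a n <= sup S + e].
  (* The supremum of S is the limit: no larger level is exceeded along U. *)
  have [Sc|] := in_ultra_setVsetC [set n | sup S + e <= a n] UU.
    have : sup S + e <= sup S by apply: ub_le_sup; [exists 1|].
    by lra.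
  by apply: filterS => n /= /negP; rewrite -ltNge => /ltW.
have [x Sx xS] : exists2 x, S x & sup S - e < x.
  by apply: sup_adherent => //; split => //; exists 1.
have lo : U [set n | sup S - e <= a n].
  by apply: filterS Sx => n /= xn; apply: le_trans xn; exact: ltW.
by apply: filterS (filterI up lo) => n /= [h1 h2]; rewrite ler_norml; lra.
Qed.

(** Let c be the limits of the values at the points of D along an ultrafilter
    U. Finitely many of these values are simultaneously close to their limits
    on a set of U, which is infinite, so that indices phi j can be chosen
    inductively; equicontinuity then gives uniform convergence near each point
    of Omega. *)
Lemma arzela_ascoli (Omega : set X) (D : nat -> X) (h : nat -> I -> X -> R) :
  (forall x V, Omega x -> nbhs x V -> exists k, V (D k)) ->
  (forall n i x, `|h n i x| <= 1) ->
  (forall x, Omega x -> forall e, 0 < e ->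
     nbhs x [set x' | forall n i, `|h n i x' - h n i x| <= e]) ->
  exists2 phi : nat -> nat, {homo phi : m n / (m < n)%N} &
  exists H : I -> X -> R, forall K : set X, compact K -> K `<=` Omega ->
    forall e, 0 < e -> exists n0, forall n, (n0 <= n)%N -> forall x i, K x ->
      `|h (phi n) i x - H i x| <= e.
Proof.
move=> dense bnd equi.
have [U [UU oU]] := ultraFilterLemma (@eventually_filter).
have UF : ProperFilter U := ultra_proper.
have tail N : U [set n | (N < n)%N].
  by apply: oU; exists N.+1.
have /choice[c cP] : forall ki : nat * I, exists c, forall e, 0 < e ->
    U [set n | `|h n ki.2 (D ki.1) - c| <= e].
  by move=> ki; exact: ultra_limit.
have /choice[g gP] : forall jN : nat * nat, exists n, (jN.2 < n)%N /\
    forall k i, (k <= jN.1)%N -> `|h n i (D k) - c (k, i)| <= jN.1.+1%:R^-1.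
  move=> [j N] /=.
  have Fj : U [set n | forall ki : 'I_j.+1 * I,
      `|h n ki.2 (D ki.1) - c (val ki.1, ki.2)| <= j.+1%:R^-1].
    apply: (@filter_forall nat _ (fun ki : 'I_j.+1 * I => [set n |
      `|h n ki.2 (D ki.1) - c (val ki.1, ki.2)| <= j.+1%:R^-1]) U _) => ki.
    by apply: (cP (val ki.1, ki.2)); rewrite invr_gt0.
  have [n [n1 n2]] := filter_ex (filterI (tail N) Fj).
  exists n; split => // k i kj.
  by have := n2 (@Ordinal j.+1 k kj, i).
(* g (j, N) is larger than N, and at this index the values at the first j + 1
   points of D are close to their limits. *)
pose phi := fix phi j := if j is j'.+1 then g (j, phi j') else g (0%N, 0%N).
have phiS j : (phi j < phi j.+1)%N by have [] := gP (j.+1, phi j).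
have phi_inc : {homo phi : m n / (m < n)%N}.
  by apply: homo_ltn => // y x z; exact: ltn_trans.
have phiP j k i : (k <= j)%N -> `|h (phi j) i (D k) - c (k, i)| <= j.+1%:R^-1.
  by case: j => [|j]; [exact: (gP (0%N, 0%N)).2|exact: (gP (j.+1, phi j)).2].
exists phi => //.
(* The limit is again taken along the ultrafilter; that it is uniform is shown
   by loc. *)
have /choice[H HP] : forall ix : I * X, exists l, forall e, 0 < e ->
    U [set n | `|h (phi n) ix.1 ix.2 - l| <= e].
  by move=> ix; exact: ultra_limit.
exists (fun i x => H (i, x)).
(* At x' close to x, the values of two functions of large index differ by at
   most 6 e, through a point of D close to x; one of the two indices is then
   chosen with value close to the limit. *)
have loc x : Omega x -> forall e, 0 < e -> exists J, nbhs x [set x' |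
    forall j i, (J <= j)%N -> `|h (phi j) i x' - H (i, x')| <= 7 * e].
  move=> Ox e e0; have Vx := equi x Ox e e0.
  have [k kP] := dense x _ Ox Vx.
  have [J JP] : exists J : nat, J.+1%:R^-1 <= e.
    exists (Num.bound e^-1); rewrite -[leRHS]invrK lef_pV2 ?posrE ?invr_gt0//.
    by rewrite (le_trans (ltW (archi_boundP _))) ?invr_ge0 ?ler_nat ?ltW.
  exists (maxn J k); apply: filterS Vx => x' x'P j i; rewrite geq_max => /andP[jJ jk].
  have small n : (J <= n)%N -> n.+1%:R^-1 <= e.
    by move=> Jn; apply: le_trans JP; rewrite lef_pV2 ?posrE// ler_nat.
  have near n : (maxn J k <= n)%N -> `|h (phi n) i x' - c (k, i)| <= 3 * e.
    rewrite geq_max => /andP[nJ nk].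
    have h1 := x'P (phi n) i; have h2 := kP (phi n) i.
    have h3 := le_trans (phiP n k i nk) (small n nJ).
    have h4 := ler_distD (h (phi n) i x) (h (phi n) i x') (c (k, i)).
    have h5 := ler_distD (h (phi n) i (D k)) (h (phi n) i x) (c (k, i)).
    rewrite (distrC (h (phi n) i x) (h (phi n) i (D k))) in h5; lra.
  have [m [m1 /= m2]] := filter_ex (filterI (tail (maxn J k)) (HP (i, x') e e0)).
  have k1 := near j; rewrite geq_max jJ jk in k1; have {}k1 := k1 isT.
  have k2 := near m (ltnW m1).
  have k3 := ler_distD (c (k, i)) (h (phi j) i x') (H (i, x')).
  have k4 := ler_distD (h (phi m) i x') (c (k, i)) (H (i, x')).
  by rewrite (distrC (c (k, i)) (h (phi m) i x')) in k4; move: m2 => /=; lra.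
move=> K cK KO e e0.
have e7 : 0 < e / 7 by rewrite divr_gt0.
have := (compact_near_coveringP K).1 cK nat \oo (fun n x => forall i, `|h (phi n) i x - H (i,
  x)| <= e).
move=> /(_ _)[x Kx|n0 _ n0P].
  have [J JP] := loc x (KO x Kx) _ e7.
  exists ([set x' | forall j i, (J <= j)%N -> `|h (phi j) i x' - H (i, x')| <= 7 * (e / 7)],
    [set n | (J <= n)%N]).
    by split => //; exists J.
  move=> [x' n] [h1 h2] i /=; apply: le_trans (h1 n i h2) _; lra.
by exists n0 => n nn x i Kx; apply: (n0P n nn x Kx).
Qed.

End ArzelaAscoli.

(** * Bicomplex numbers *)

Section Bicomplex.
Variable R : realType.
Local Notation C := R[i].
Local Notation N := (@Normc.normc R).
Local Notation Re := (@complex.Re R).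
Local Notation Im := (@complex.Im R).
Local Notation T := (bicomplex R).
Local Notation ext := (ext_cplx R).
Implicit Types (w v : T) (f : C -> ext) (e : R).

Lemma nbhs_bicomplexP w (A : set T) : nbhs w A <->
  exists2 d : R, 0 < d & forall v, N (v.1 - w.1) < d -> N (v.2 - w.2) < d -> A v.
Proof.
split=> [|[d d0 dP]].
  move=> [[P Q] [/= /nbhs_normcP[d1 d10 d1P] /nbhs_normcP[d2 d20 d2P]] PQ].
  exists (Num.min d1 d2); first by rewrite lt_min d10.
  move=> v; rewrite !lt_min => /andP[v1 _] /andP[_ v2].
  by apply: PQ; split; [exact: d1P|exact: d2P].
exists ([set z | N (z - w.1) < d], [set z | N (z - w.2) < d]).
  by split; apply/nbhs_normcP; exists d.
by move=> v [v1 v2]; exact: dP.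
Qed.

Lemma rational_points_dense : exists D : nat -> T, forall w (A : set T),
  nbhs w A -> exists k, A (D k).
Proof.
exists (fun k => if unpickle k is Some (a, b, c, d)
  then (Complex (ratr a) (ratr b), Complex (ratr c) (ratr d)) else (0, 0)).
move=> w A /nbhs_bicomplexP[d d0 dP].
have app x : exists q : rat, `|ratr q - x| < d / 2.
  have [|q] := @rat_in_itvoo R (x - d / 2) (x + d / 2); first lra.
  by rewrite in_itv /= => ?; exists q; rewrite ltr_norml; lra.
have [a aP] := app (Re w.1); have [b bP] := app (Im w.1).
have [c cP] := app (Re w.2); have [d' d'P] := app (Im w.2).
exists (pickle (a, b, c, d')); rewrite pickleK.
apply: dP; apply: le_lt_trans (cnorm_le_ReIm _) _; rewrite !raddfB /=; lra.
Qed.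

(** Poles are isolated. *)
Lemma meromorphic_not_infinite (U : set C) f b (d : R) : meromorphic U f -> U b -> 0 < d ->
  exists2 z, N (z - b) < d & f z <> None.
Proof.
move=> fm Ub d0; have [h [/nbhs_normcP[r r0 rP]|[_ /nbhs_normcP[r r0 rP] _]]] := fm b Ub.
  have bb : N (b - b) < r by rewrite subrr cnorm0.
  by exists b; [rewrite subrr cnorm0|have [->] := rP b bb].
have [z [+ zb]] : exists z, N (z - b) < Num.min r d /\ z \notin [:: b].
  by apply: exists_near_notin; rewrite lt_min r0.
rewrite lt_min inE in zb * => /andP[zr zd].
by exists z => //; have [->] := rP z zr zb.
Qed.

End Bicomplex.

(** * Idempotent components and the normality criterion *)

Section Idempotents.
Variable R : realType.
Local Notation C := R[i].
Local Notation N := (@Normc.normc R).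
Local Notation T := (bicomplex R).
Local Notation ext := (ext_cplx R).
Local Notation P1 := (@bc_proj1 R).
Local Notation P2 := (@bc_proj2 R).
Implicit Types (w : T) (e : R).

(** The bicomplex number z1 e1 + z2 e2. *)
Definition bc_of (z1 z2 : C) : T := ((z1 + z2) / 2, 'i%C * (z1 - z2) / 2).

Lemma bc_of1 z1 z2 : P1 (bc_of z1 z2) = z1.
Proof.
rewrite /bc_proj1 /=; have := sqr_i R; move: ('i%C : C) => I II.
by rewrite (_ : _ - _ = (z1 + z2) / 2 - I ^+ 2 * (z1 - z2) / 2); [rewrite II; field|ring].
Qed.

Lemma bc_of2 z1 z2 : P2 (bc_of z1 z2) = z2.
Proof.
rewrite /bc_proj2 /=; have := sqr_i R; move: ('i%C : C) => I II.
by rewrite (_ : _ + _ * _ = (z1 + z2) / 2 + I ^+ 2 * (z1 - z2) / 2); [rewrite II; field|ring].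
Qed.

(** The null-cone is the union of the kernels of the two projections. *)
Lemma bc_sqn_proj w : w.1 ^+ 2 + w.2 ^+ 2 = P1 w * P2 w.
Proof.
rewrite /bc_proj1 /bc_proj2; have := sqr_i R; move: ('i%C : C) (w.1) (w.2) => I a b II.
by rewrite (_ : (a - b * I) * (a + b * I) = a ^+ 2 - b ^+ 2 * I ^+ 2); [rewrite II; ring|ring].
Qed.

Lemma bc_proj1B w (v : T) : P1 (w - v) = P1 w - P1 v.
Proof. by rewrite /bc_proj1 /=; ring. Qed.
Lemma bc_proj2B w (v : T) : P2 (w - v) = P2 w - P2 v.
Proof. by rewrite /bc_proj2 /=; ring. Qed.

Lemma unit_sub_proj w (v : T) : w - v \is a GRing.unit -> P1 w != P1 v /\ P2 w != P2 v.
Proof.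
move=> wv; have : bc_sqn (w - v) != 0 by exact: wv.
rewrite /bc_sqn bc_sqn_proj mulf_eq0 negb_or bc_proj1B bc_proj2B !subr_eq0.
by move/andP.
Qed.

Lemma bc_proj1_dist w (v : T) : N (P1 w - P1 v) <= N (w.1 - v.1) + N (w.2 - v.2).
Proof.
rewrite -bc_proj1B /bc_proj1 /=; apply: le_trans (cnormB_le _ _) _.
by rewrite cnormM cnorm_i mulr1.
Qed.
Lemma bc_proj2_dist w (v : T) : N (P2 w - P2 v) <= N (w.1 - v.1) + N (w.2 - v.2).
Proof.
rewrite -bc_proj2B /bc_proj2 /=; apply: le_trans (cnormD_le _ _) _.
by rewrite cnormM cnorm_i mulr1.
Qed.

(** In idempotent components an open set contains a product of discs around
    each of its points. *)
Lemma open_bc_of (Omega : set T) w : open Omega -> Omega w ->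
  exists2 d : R, 0 < d & forall z1 z2, N (z1 - P1 w) < d -> N (z2 - P2 w) < d ->
    Omega (bc_of z1 z2).
Proof.
move=> oO Ow; have /nbhs_bicomplexP[d d0 dP] : nbhs w Omega by exact: open_nbhs_nbhs.
exists d => // z1 z2 h1 h2.
have N2 z : N (z / 2) = N z / 2.
  by rewrite cnormM cnormV -(rmorph_nat (real_complex R) 2) cnorm_real ger0_norm.
have E1 : (bc_of z1 z2).1 - w.1 = ((z1 - P1 w) + (z2 - P2 w)) / 2.
  by rewrite /bc_of /bc_proj1 /bc_proj2 /=; field.
have E2 : (bc_of z1 z2).2 - w.2 = 'i%C * ((z1 - P1 w) - (z2 - P2 w)) / 2.
  rewrite /bc_of /bc_proj1 /bc_proj2 /=; have := sqr_i R; move: ('i%C : C) => I II.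
  rewrite [RHS](_ : _ = I * (z1 - z2) / 2 + I ^+ 2 * w.2); last by field.
  by rewrite II; ring.
apply: dP; rewrite ?E1 ?E2.
  by rewrite N2; have := cnormD_le (z1 - P1 w) (z2 - P2 w); lra.
by rewrite -mulrA cnormM cnorm_i mul1r N2; have := cnormB_le (z1 - P1 w) (z2 - P2 w); lra.
Qed.

(** If f1 (P1 w) = c1 with w in Omega, then f2 is infinite at every z close to
    P2 w, since P1 w and z are the components of a point of Omega. *)
Lemma components_omit (Omega : set T) (f1 f2 : C -> ext) (c1 c2 : C) : open Omega ->
  meromorphic (P1 @` Omega) f1 -> meromorphic (P2 @` Omega) f2 ->
  (forall w x y, Omega w -> f1 (P1 w) = Some x -> f2 (P2 w) = Some y -> x <> c1 /\ y <> c2) ->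
  forall w, Omega w -> f1 (P1 w) <> Some c1 /\ f2 (P2 w) <> Some c2.
Proof.
move=> oO m1 m2 H w Ow; have [d d0 dP] := open_bc_of oO Ow.
have z1 : N (P1 w - P1 w) < d by rewrite subrr cnorm0.
have z2 : N (P2 w - P2 w) < d by rewrite subrr cnorm0.
have i1 : (P1 @` Omega) (P1 w) by exists w.
have i2 : (P2 @` Omega) (P2 w) by exists w.
split=> E.
  have [z zd] := meromorphic_not_infinite m2 i2 d0.
  case f2z : (f2 z) => [y|] // _.
  have [] := H (bc_of (P1 w) z) c1 y (dP _ _ z1 zd); rewrite ?bc_of1 ?bc_of2//.
have [z zd] := meromorphic_not_infinite m1 i1 d0.
case f1z : (f1 z) => [x|] // _.
have [] := H (bc_of z (P2 w)) x c2 (dP _ _ zd z2); rewrite ?bc_of1 ?bc_of2//.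
Qed.

(** The six stereographic coordinates of an extended bicomplex number. The
    default value of nth is the third coordinate. *)
Definition sphere_coord (i : bool * 'I_3) (v : ext_bicomplex R) : R :=
  nth (@sphZ R) [:: @sphX R; @sphY R] i.2 (if i.1 then v.1 else v.2).

Lemma sph_limit (x y t : R) : (forall e, 0 < e -> exists v : ext,
    [/\ `|sphX v - x| <= e, `|sphY v - y| <= e & `|sphZ v - t| <= e]) ->
  exists v, [/\ sphX v = x, sphY v = y & sphZ v = t].
Proof.
move=> H; apply: sph_surj; apply/eqP; rewrite -subr_eq0 -normr_le0; apply: ler_all_eps => e e0.
rewrite add0r; pose d := Num.min 1 (e / 10).
have d0 : 0 < d by rewrite lt_min ltr01 divr_gt0.
have [d1 de] : d <= 1 /\ d <= e / 10 by rewrite !ge_min !lexx orbT.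
have [v [hx hy ht]] := H d d0; have S := sph_on v; have [bx bY bt] := sph_bound v.
have sq (X x' : R) : `|X| <= 1 -> `|X - x'| <= d -> `|x' ^+ 2 - X ^+ 2| <= 3 * d.
  move=> X1 h; rewrite subr_sqr normrM distrC mulrC ler_pM//.
  have E : x' - X + (X + X) = x' + X by ring.
  have := ler_normD (x' - X) (X + X); rewrite E.
  by have := ler_normD X X; rewrite distrC in h; lra.
have := sq _ _ bx hx; have := sq _ _ bY hy; have := sq _ _ bt ht.
move: ht; rewrite !ler_norml; lra.
Qed.

End Idempotents.

Local Notation N := (@Normc.normc _).
Local Notation P1 := (@bc_proj1 _).
Local Notation P2 := (@bc_proj2 _).

Theorem theorem4p11 (R : realType) (Omega : set (bicomplex R))
  (F : set (bicomplex R -> ext_bicomplex R)) :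
  is_domain Omega ->
  (forall f, F f -> bc_meromorphic Omega f) ->
  (exists alpha beta gamma : bicomplex R,
    [/\ alpha - beta \is a GRing.unit,
        beta - gamma \is a GRing.unit,
        gamma - alpha \is a GRing.unit &
        forall f, F f ->
          (@bc_embed R @` (null_translate alpha `|` null_translate beta
                            `|` null_translate gamma))
          `&` (f @` Omega) = set0]) ->
  normal_family Omega F.
Proof.
move=> [_ oO _] Fmero [al [be [ga [uab ubg uga Fomit]]]] u uF.
have [ab1 ab2] := unit_sub_proj uab; have [bg1 bg2] := unit_sub_proj ubg.
have [ga1 ga2] := unit_sub_proj uga.
have omit3 n : exists f1 f2 : R[i] -> ext_cplx R, [/\ meromorphic (P1 @` Omega) f1,
    meromorphic (P2 @` Omega) f2,
    forall w, Omega w -> u n w = (f1 (P1 w), f2 (P2 w)) &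
    forall w, Omega w ->
      [/\ f1 (P1 w) <> Some (P1 al), f1 (P1 w) <> Some (P1 be) & f1 (P1 w) <> Some (P1 ga)] /\
      [/\ f2 (P2 w) <> Some (P2 al), f2 (P2 w) <> Some (P2 be) & f2 (P2 w) <> Some (P2 ga)]].
  have [f1 [f2 [m1 m2 fE]]] := Fmero _ (uF n).
  exists f1, f2; split => // w Ow.
  (* Used for the three points alpha, beta, gamma. *)
  have key (c : bicomplex R) : (forall v, null_translate c v ->
    (null_translate al `|` null_translate be
      `|` null_translate ga) v) -> f1 (P1 w) <> Some (P1 c) /\ f2 (P2 w) <> Some (P2 c).
    move=> cS; apply: (components_omit oO m1 m2) => // v x y Ov f1v f2v.
    have notS : null_translate c (bc_of x y) -> False.
      move=> xy; have := Fomit _ (uF n).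
      rewrite -subset0 => /(_ (u n v)); apply; split; last by exists v.
      exists (bc_of x y); first exact: cS.
      by rewrite /bc_embed bc_of1 bc_of2 fE// f1v f2v.
    have NT : (x - P1 c) * (y - P2 c) = 0 -> null_translate c (bc_of x y).
      move=> xy0; change ((bc_of x y - c).1 ^+ 2 + (bc_of x y - c).2 ^+ 2 = 0).
      by rewrite bc_sqn_proj bc_proj1B bc_proj2B bc_of1 bc_of2.
    by split=> E; apply/notS/NT; rewrite E subrr ?mul0r ?mulr0.
  have [a1 a2] : f1 (P1 w) <> Some (P1 al) /\ f2 (P2 w) <> Some (P2 al).
    by apply: key => v; left; left.
  have [b1 b2] : f1 (P1 w) <> Some (P1 be) /\ f2 (P2 w) <> Some (P2 be).
    by apply: key => v; left; right.
  have [c1 c2] : f1 (P1 w) <> Some (P1 ga) /\ f2 (P2 w) <> Some (P2 ga).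
    by apply: key => v; right.
  by [].
have equi w : Omega w -> forall e : R, 0 < e ->
    nbhs w [set v | forall n i, `|sphere_coord i (u n v) - sphere_coord i (u n w)| <= e].
  move=> Ow e e0; have [d d0 dP] := open_bc_of oO Ow.
  have /nbhs_bicomplexP[d' d'0 d'P] : nbhs w Omega by exact: open_nbhs_nbhs.
  have [L1 L10 L1P] := omit3_equi_lipschitz ab1 bg1 ga1 d0.
  have [L2 L20 L2P] := omit3_equi_lipschitz ab2 bg2 ga2 d0.
  have k0 : 0 < e / (L1 + L2 + 1) by rewrite divr_gt0//; lra.
  (* d / 8 because a projection of v - w is at most the sum of the moduli of
     its two coordinates. *)
  pose r := Num.min d' (Num.min (d / 8) (e / (L1 + L2 + 1) / 2)).
  have r0 : 0 < r by rewrite !lt_min d'0 !divr_gt0//; lra.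
  apply/nbhs_bicomplexP; exists r => // v; rewrite !lt_min.
  move=> /and3P[v1 v2 v3] /and3P[v1' v2' v3'] n i.
  have Ov : Omega v by exact: d'P.
  have [f1 [f2 [m1 m2 fE fo]]] := omit3 n.
  rewrite /sphere_coord !fE//=.
  have q1 := bc_proj1_dist v w; have q2 := bc_proj2_dist v w.
  have z1 : N (P1 w - P1 w) < d by rewrite subrr cnorm0.
  have z2 : N (P2 w - P2 w) < d by rewrite subrr cnorm0.
  have s1 : N (P1 v - P1 w) < d / 4 by lra.
  have s2 : N (P2 v - P2 w) < d / 4 by lra.
  have s3 : N (P1 w - P1 w) < d / 4 by rewrite subrr cnorm0; lra.
  have s4 : N (P2 w - P2 w) < d / 4 by rewrite subrr cnorm0; lra.
  have t1 : N (P1 v - P1 w) * (L1 + L2 + 1) <= e by rewrite -ler_pdivlMr; lra.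
  have t2 : N (P2 v - P2 w) * (L1 + L2 + 1) <= e by rewrite -ler_pdivlMr; lra.
  have n1 := cnorm_ge0 (P1 v - P1 w); have n2 := cnorm_ge0 (P2 v - P2 w).
  have b1 : L1 * N (P1 v - P1 w) <= e.
    by apply: le_trans t1; rewrite mulrC ler_wpM2l//; lra.
  have b2 : L2 * N (P2 v - P2 w) <= e.
    by apply: le_trans t2; rewrite mulrC ler_wpM2l//; lra.
  have d1 z : N (z - P1 w) < d -> (P1 @` Omega) z.
    by move=> zd; exists (bc_of z (P2 w)); [exact: dP|exact: bc_of1].
  have d2 z : N (z - P2 w) < d -> (P2 @` Omega) z.
    by move=> zd; exists (bc_of (P1 w) z); [exact: dP|exact: bc_of2].
  have [|z zd|x1 y1 t1'] := L1P f1 (P1 w) _ _ (P1 v) (P1 w) s1 s3.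
  - by move=> z /d1; exact: m1.
  - by have [x Ox <-] := d1 z zd; have [] := fo x Ox.
  have [|z zd|x2 y2 t2'] := L2P f2 (P2 w) _ _ (P2 v) (P2 w) s2 s4.
  - by move=> z /d2; exact: m2.
  - by have [x Ox <-] := d2 z zd; have [] := fo x Ox.
  case: i => [[] [[|[|[|//]]] i3]] /=.
  - exact: le_trans x1 b1.
  - exact: le_trans y1 b1.
  - exact: le_trans t1' b1.
  - exact: le_trans x2 b2.
  - exact: le_trans y2 b2.
  - exact: le_trans t2' b2.
have [D dense] := rational_points_dense R.
have bnd n i w : `|sphere_coord i (u n w)| <= 1.
  rewrite /sphere_coord; set v := (if _ then _ else _); have [h1 h2 h3] := sph_bound v.
  by case: i @v h1 h2 h3 => b [[|[|[|//]]] i3].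
have [phi phi_inc [H HP]] := @arzela_ascoli R (bicomplex R) _ Omega D
  (fun n i w => sphere_coord i (u n w)) (fun w V _ => dense w V) bnd equi.
exists phi => //.
(* A pointwise limit of coordinates is again a point of the sphere. *)
have lim w b : Omega w -> exists v : ext_cplx R, [/\ sphX v = H (b, inord 0) w,
    sphY v = H (b, inord 1) w & sphZ v = H (b, inord 2) w].
  move=> Ow; apply: sph_limit => e e0.
  have [|n0 /(_ n0 (leqnn _) w)] := HP [set w] (@compact_set1 _ w) _ e e0.
    by move=> _ ->.
  move=> h; have h' i := h i erefl.
  exists (if b then (u (phi n0) w).1 else (u (phi n0) w).2).
  have := h' (b, inord 0); have := h' (b, inord 1); have := h' (b, inord 2).
  by rewrite /sphere_coord /= !inordK.
have /choice[G GP] : forall w, exists v : ext_bicomplex R, Omega w ->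
    forall i, sphere_coord i v = H i w.
  move=> w; have [Ow|nO] := pselect (Omega w); last by exists (None, None).
  have [v1 [x1 y1 t1]] := lim w true Ow; have [v2 [x2 y2 t2]] := lim w false Ow.
  exists (v1, v2) => _ [[] j]; rewrite /sphere_coord /=.
    have -> : j = inord j by rewrite inord_val.
    by case: j => [[|[|[|//]]] j3]; rewrite inordK.
  have -> : j = inord j by rewrite inord_val.
  by case: j => [[|[|[|//]]] j3]; rewrite inordK.
exists G => K cK KO e e0.
have e2 : 0 < e / 2 by rewrite divr_gt0.
have [n0 n0P] := HP K cK KO _ e2.
exists n0 => n w nn Kw.
have h i : `|sphere_coord i (u (phi n) w) - sphere_coord i (G w)| <= e / 2.
  by rewrite (GP w (KO w Kw)); exact: n0P.
have sqe (x : R) : `|x| <= e / 2 -> x ^+ 2 <= (e / 2) ^+ 2.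
  by move=> xe; rewrite -(real_normK (num_real x)) ler_pXn2r ?nnegrE// ltW.
have c b : chordal (if b then (u (phi n) w).1 else (u (phi n) w).2)
    (if b then (G w).1 else (G w).2) ^+ 2 <= 3 * (e / 2) ^+ 2.
  rewrite chordal_sph.
  have := sqe _ (h (b, inord 0)); have := sqe _ (h (b, inord 1)); have := sqe _ (h (b, inord 2)).
  by rewrite /sphere_coord /= !inordK//=; lra.
have c1 := c true; have c2 := c false.
rewrite /bc_chordal -[ltRHS](ger0_norm (ltW e0)) -sqrtr_sqr ltr_sqrt ?exprn_gt0//.
move: c1 c2 => /=; have : 0 < e ^+ 2 by rewrite exprn_gt0.
have -> : (e / 2) ^+ 2 = e ^+ 2 / 4 by field.
lra.
Qed.
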